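(* Let $q\in k^\times$ be a primitive $\ell$-th root of unity with $\ell>1$ odd and let $i_0=(\ell+1)/2$. The following relation of ambient isotopy invariants of oriented links holds: $$\overline{\mathrm{Inv}}_{D(\bar{\mathscr A}_q(2)),\,\bar{\mathscr A}_{(\ell-1)\epsilon_2,\,i_0(\epsilon_1+\epsilon_2)}}=\left(\overline{\mathrm{Inv}}_{D(\bar{\mathscr A}_q(1)),\,\bar{\mathscr A}_{(i_0-1)\epsilon_1,\,i_0\epsilon_1}}\right)^2.$$
   Context: Throughout, $k$ is an algebraically closed field of characteristic $0$. **Lattice notation.** $\Lambda=\bigoplus_{i=1}^n\mathbb Z\epsilon_i$ with standard basis $\epsilon_1,\dots,\epsilon_n$; $\alpha*\beta=\sum_{j=1}^{n-1}\sum_{i>j}\alpha_i\beta_j$, $\theta(\alpha,\beta)=q^{\alpha*\beta-\beta*\alpha}$, $\langle\alpha,\beta\rangle=\sum_i\alpha_i\beta_i$. **The $n$-rank Taft algebra.** $\bar{\mathscr A}_q(n)$ is the $k$-algebra generated by $K(\epsilon_i)^{\pm1},x_i$ ($1\le i\le n$) with relations: the $K(\epsilon_i)$ commute and are invertible; $K(\epsilon_i)^\ell=1$; $K(\epsilon_i)x_jK(\epsilon_i)^{-1}=\theta(\epsilon_i,\epsilon_j)q^{\delta_{ij}}x_j$; $x_ix_j=\theta(\epsilon_i,\epsilon_j)x_jx_i$; $x_i^\ell=0$. Write $K(\alpha)=\prod_iK(\epsilon_i)^{\alpha_i}$, $x^\gamma=x_1^{\gamma_1}\cdots x_n^{\gamma_n}$.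 Hopf structure: $\Delta(K(\epsilon_i)^{\pm1})=K(\epsilon_i)^{\pm1}\otimes K(\epsilon_i)^{\pm1}$, $\Delta(x_i)=x_i\otimes1+K(\epsilon_i)\otimes x_i$, $\varepsilon(K(\epsilon_i)^{\pm1})=1$, $\varepsilon(x_i)=0$, $s(K(\epsilon_i)^{\pm1})=K(\epsilon_i)^{\mp1}$, $s(x_i)=-K(\epsilon_i)^{-1}x_i$. Basis: $x^\gamma K(\alpha)$, $0\le\alpha_i,\gamma_i\le\ell-1$. $\mathcal K(\alpha)\in\bar{\mathscr A}_q(n)^*$ is the group-like element with $\mathcal K(\alpha)(x^\gamma K(\beta))=\delta_{\gamma,0}q^{\langle\alpha,\beta\rangle}$. **Drinfel'd double and modules.** For a finite-dimensional Hopf algebra $H$ with antipode $s$, $D(H)=(H^* )^{\mathrm{cop}}\bowtie H$ is $H^*\otimes H$ with multiplication $(p\otimes h)(p'\otimes h')=p\big(h_{(1)}\rightharpoonup p'\leftharpoonup s^{-1}(h_{(3)})\big)\otimes h_{(2)}h'$, where $h\rightharpoonup p=p_{(2)}(h)p_{(1)}$, $p\leftharpoonup h=p_{(1)}(h)p_{(2)}$, the coalgebra structure of $(H^* )^{\mathrm{cop}}\otimes H$, and universal $R$-matrix $\mathcal R=\sum_i(\varepsilon\otimes h_i)\otimes(h^i\otimes1)$ for dual bases $\{h_i\},\{h^i\}$ of $H,H^*$. A Yetter–Drinfel'd module (left $H$-module, right $H$-comodule with $h_{(1)}\cdot m_{(0)}\otimes h_{(2)}m_{(1)}=(h_{(2)}\cdot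 m)_{(0)}\otimes(h_{(2)}\cdot m)_{(1)}h_{(1)}$) is a left $D(H)$-module via $(p\otimes h)\cdot m=p\cdot(h\cdot m)$, $p\cdot m=p(m_{(1)})m_{(0)}$. For $H=\bar{\mathscr A}_q(n)$, $H$ is a Yetter–Drinfel'd module with coaction $\Delta$ and action $h\bullet_{\mathcal K(\alpha)}a=(h_{(2)}\leftharpoonup\mathcal K(\alpha))\,a\,s^{-1}(h_{(1)})$, where $h\leftharpoonup\chi=\chi(h_{(1)})h_{(2)}$; $\bar{\mathscr A}_{\alpha,\beta}:=H\bullet_{\mathcal K(\alpha)}K(\beta)$ is a simple submodule, hence a simple $D(H)$-module. **Ribbon structure.** For a quasitriangular Hopf algebra $(H,R)$ with antipode $s$, $R=\sum a_i\otimes b_i$, put $u=\sum s(b_i)a_i$; a ribbon element is a central $v$ with $v^2=us(u)$, $s(v)=v$, $\varepsilon(v)=1$, $\Delta(v)=(R^{21}R)^{-1}(v\otimes v)$, $R^{21}=\sum b_i\otimes a_i$. For $\ell$ odd, $(D(\bar{\mathscr A}_q(n)),\mathcal R)$ has a unique ribbon element $v$. **The invariant.** Let $(H,R,v)$ be a ribbon Hopf algebra with antipode $s$, $M$ a finite-dimensional irreducible $H$-module with character $\chi_M$, $G=u^{-1}v$, $U=s^{-2}$. Place an oriented link diagram $L$ with components $L_1,\dots,L_r$ in the plane in general position with respect to the vertical direction, after a planar isotopy such that at each crossing both strands are directed upward. An upward crossing is positive if the over-strand runs from bottom left to top right, negative if it runs from bottom right to top left. At a positive crossing decorate the over-strand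 with $e$ and the under-strand with $e'$, where $R=e\otimes e'$ (summation understood); at a negative crossing decorate the over-strand with $E$ and the under-strand with $E'$, where $R^{-1}=E\otimes E'$. Local extrema traversed clockwise (maxima left to right, minima right to left) have rotation number $1/2$, those traversed counterclockwise have rotation number $-1/2$; $\mathrm{Wd}(L_j)$ is the sum of rotation numbers of the extrema of $L_j$. Choose a base point on a vertical line of $L_j$, traverse $L_j$ from it along the orientation, and let $y_1,\dots,y_m$ be the decorations met in order; let $a_i$ be the number of local minima traversed left to right minus the number of local maxima traversed left to right on the part of the traversal from the $i$-th crossing line back to the base point. Put $\mathrm w(L_j)=U^{a_1}(y_1)\cdots U^{a_m}(y_m)$ (and $1$ if there are no crossing lines). Then $$\mathrm{Inv}_{H,M}(L)=\prod_{j=1}^r\chi_M\big(G^{\mathrm{Wd}(L_j)}\mathrm w(L_j)\big),\qquad \overline{\mathrm{Inv}}_{H,M}(L)=c^{\mathrm{Wr}(L)}\,\mathrm{Inv}_{H,M}(L),$$ with the implicit summations over the tensors $R^{\pm1}$ at all crossings carried out in the whole product, $c$ the scalar by which $v$ acts on $M$, and $\mathrm{Wr}(L)$ the number of positive minus the number of negative crossings. $\overline{\mathrm{Inv}}_{H,M}$ is an ambient isotopy invariant of oriented links; its value on the unknot is $\chi_M(u^{-1}v)$. *)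

(* Defs.v *)
From HB Require Import structures.
From mathcomp Require Import all_boot all_order all_algebra all_field.

Set Implicit Arguments.
Unset Strict Implicit.
Unset Printing Implicit Defensive.

Import GRing.Theory.
Local Open Scope ring_scope.

Section Tensor.
Variable k : fieldType.
Implicit Types V W U : vectType k.

(* V ⊗ W is the space of coefficient matrices with respect to the bases       *)
(* vbasis {:V} and vbasis {:W}.                                              *)
Definition tensor V W : vectType k := 'M[k]_(\dim {:V}, \dim {:W}).

Definition tens V W (v : V) (w : W) : tensor V W :=
  \matrix_(i, j) (coord (vbasis {:V}) i v * coord (vbasis {:W}) j w).

Definition tcoef V W (t : tensor V W) i j : k :=
  (t : 'M[k]_(\dim {:V}, \dim {:W})) i j.

Definition lift2_fun V W U (f : V -> W -> U) (t : tensor V W) : U :=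
  \sum_(i < \dim {:V}) \sum_(j < \dim {:W})
    tcoef t i j *: f (vbasis {:V})`_i (vbasis {:W})`_j.

(* For bilinear f, lift2 f t is the sum of the f a b over any decomposition   *)
(* of t into a sum of pure tensors a ⊗ b (see lift2_tens).                   *)
Definition lift2 V W U (f : V -> W -> U) : 'Hom(tensor V W, U) :=
  linfun (lift2_fun f).

Fact lift2_fun_is_linear V W U (f : V -> W -> U) : linear (lift2_fun f).
Proof.
move=> a s t; rewrite /lift2_fun scaler_sumr -big_split; apply: eq_bigr => i _.
rewrite scaler_sumr -big_split; apply: eq_bigr => j _ /=.
by rewrite /tcoef !mxE scalerDl scalerA.
Qed.

HB.instance Definition _ V W U (f : V -> W -> U) :=
  GRing.isLinear.Build k (tensor V W) U *:%R (lift2_fun f)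
    (lift2_fun_is_linear f).

Lemma lift2E V W U (f : V -> W -> U) t : lift2 f t = lift2_fun f t.
Proof. by rewrite lfunE. Qed.

Lemma lift2_tens V W U (f : V -> W -> U) :
    (forall w, linear (f^~ w)) -> (forall v, linear (f v)) ->
  forall v w, lift2 f (tens v w) = f v w.
Proof.
move=> fl fr v w.
pose fL w := GRing.isLinear.Build k V U *:%R (f^~ w) (fl w).
pose FL w : {linear V -> U} := HB.pack (f^~ w) (fL w).
pose fR v := GRing.isLinear.Build k W U *:%R (f v) (fr v).
pose FR v : {linear W -> U} := HB.pack (f v) (fR v).
rewrite lift2E /lift2_fun.
have -> : f v w = FL w v by [].
rewrite [v in RHS](coord_vbasis (memvf v)) linear_sum; apply: eq_bigr => i _.
rewrite linearZ /=; have -> u : f u w = FR u w by [].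
rewrite [w in RHS](coord_vbasis (memvf w)) linear_sum scaler_sumr.
by apply: eq_bigr => j _; rewrite linearZ scalerA /tcoef mxE.
Qed.

Definition tflip V W : 'Hom(tensor V W, tensor W V) :=
  lift2 (fun v w => tens w v).

End Tensor.

Notation "v ⊗ w" := (tens v w) (at level 45, left associativity).

(* alg and hopf hold only the structure maps.  The algebras below satisfy the *)
(* axioms, but no construction depends on a proof that they do.               *)
Record alg (k : fieldType) := Alg {
  alg_sort :> vectType k;
  alg_mul : 'Hom(tensor alg_sort alg_sort, alg_sort);
  alg_one : alg_sort }.

Notation "a ** b" := (alg_mul _ (a ⊗ b)) (at level 40, left associativity).

Section Alg.
Variable k : fieldType.

Definition falg (A : falgType k) : alg k :=
  @Alg k A (lift2 (fun a b : A => a * b)) 1.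

Definition tensor_alg (A B : alg k) : alg k :=
  @Alg k (tensor A B)
    (lift2 (fun s t : tensor A B =>
       lift2 (fun a b => lift2 (fun a' b' => (a ** a') ⊗ (b ** b')) t) s))
    (alg_one A ⊗ alg_one B).

Variable A : alg k.

Definition lmul (a : A) : 'End(A) := linfun (fun b => a ** b).

(* The inverse of an invertible a: left multiplication by a is then bijective *)
(* and sends the inverse of a to 1.                                          *)
Definition alg_inv (a : A) : A := ((lmul a)^-1)%VF (alg_one A).

Definition alg_exp (a : A) (n : nat) : A := iter n (lmul a) (alg_one A).

Definition alg_expz (a : A) (z : int) : A :=
  match z with
  | Posz n => alg_exp a n
  | Negz n => alg_exp (alg_inv a) n.+1
  end.

End Alg.

Record hopf (k : fieldType) := Hopf {
  hopf_alg :> alg k;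
  comul : 'Hom(hopf_alg, tensor hopf_alg hopf_alg);
  counit : 'Hom(hopf_alg, k^o);
  antip : 'End(hopf_alg) }.

Arguments comul {k h}.
Arguments counit {k h}.
Arguments antip {k h}.

Section Hopf.
Variables (k : fieldType) (H : hopf k).

Definition antipV : 'End(H) := (antip^-1)%VF.

(* sw2 h f and sw3 h f are f(h_(1), h_(2)) and f(h_(1), h_(2), h_(3)).        *)
Definition sw2 (U : vectType k) (h : H) (f : H -> H -> U) : U :=
  lift2 f (comul h).

Definition sw3 (U : vectType k) (h : H) (f : H -> H -> H -> U) : U :=
  sw2 h (fun h1 h23 => sw2 h23 (fun h2 h3 => f h1 h2 h3)).

End Hopf.

Section Double.
Variables (k : fieldType) (H : hopf k).

Definition ldual : vectType k := 'Hom(H, k^o).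

Definition dual_basis (i : 'I_(\dim {:H})) : ldual :=
  linfun (fun h : H => coord (vbasis {:H}) i h : k^o).

Definition dual_mul (p p' : ldual) : ldual :=
  linfun (fun y => sw2 y (fun y1 y2 => p y1 * p' y2 : k^o)).

(* The tensor with p_(1)(a) p_(2)(b) = p(ab).                                *)
Definition dual_comul (p : ldual) : tensor ldual ldual :=
  \sum_(i < \dim {:H}) \sum_(j < \dim {:H})
    p ((vbasis {:H})`_i ** (vbasis {:H})`_j) *: (dual_basis i ⊗ dual_basis j).

Definition hitl (h : H) (p : ldual) : ldual :=
  lift2 (fun p1 p2 : ldual => p2 h *: p1) (dual_comul p).

Definition hitr (p : ldual) (h : H) : ldual :=
  lift2 (fun p1 p2 : ldual => p1 h *: p2) (dual_comul p).

(* The dual Hopf algebra with the opposite comultiplication; its antipode is  *)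
(* the transpose of the inverse of the antipode of H.                        *)
Definition dual_cop : hopf k :=
  @Hopf k (@Alg k ldual (lift2 dual_mul) counit)
    (linfun (fun p : ldual => tflip _ _ (dual_comul p)))
    (linfun (fun p : ldual => p (alg_one H)))
    (linfun (fun p : ldual => (p \o antipV H)%VF)).

Definition double_alg : alg k :=
  @Alg k (tensor ldual H)
    (lift2 (fun d d' : tensor ldual H =>
       lift2 (fun (p : ldual) (h : H) =>
         lift2 (fun (p' : ldual) (h' : H) =>
           sw3 h (fun h1 h2 h3 =>
             dual_mul p (hitr (hitl h1 p') (antipV H h3)) ⊗ (h2 ** h'))) d') d))
    (counit ⊗ alg_one H).

(* The antipode of D(H) is the anti-multiplicative map extending the antipodes *)
(* of the Hopf subalgebras dual_cop and H.                                   *)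
Definition drinfeld_double : hopf k :=
  @Hopf k double_alg
    (lift2 (fun (p : dual_cop) (h : H) =>
       sw2 p (fun p1 p2 => sw2 h (fun h1 h2 =>
         ((p1 ⊗ h1 : double_alg) ⊗ (p2 ⊗ h2 : double_alg))))))
    (lift2 (fun (p : dual_cop) (h : H) => counit p * counit h : k^o))
    (lift2 (fun (p : dual_cop) (h : H) =>
       (counit ⊗ antip h : double_alg) ** (antip p ⊗ alg_one H : double_alg))).

Definition double_R : tensor drinfeld_double drinfeld_double :=
  \sum_(i < \dim {:H})
    ((counit ⊗ (vbasis {:H})`_i : drinfeld_double)
     ⊗ (dual_basis i ⊗ alg_one H : drinfeld_double)).

End Double.

Section Ribbon.
Variables (k : fieldType) (H : hopf k) (R : tensor H H).

Definition R_inv : tensor H H := alg_inv (R : tensor_alg H H).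

Definition drinfeld_u : H := lift2 (fun a b => antip b ** a) R.

Definition ribbon_element (v : H) : Prop :=
  let R21R : tensor_alg H H :=
    (tflip H H R : tensor_alg H H) ** (R : tensor_alg H H) in
  [/\ forall a, v ** a = a ** v,
      v ** v = drinfeld_u ** antip drinfeld_u,
      antip v = v,
      counit v = 1 &
      comul v = alg_inv R21R ** (v ⊗ v : tensor_alg H H)].

End Ribbon.

Record hmod (k : fieldType) (H : hopf k) := HMod {
  mod_sort :> vectType k;
  hact : 'Hom(H, 'End(mod_sort)) }.

Section Modules.
Variables (k : fieldType) (H : hopf k).

Definition hchar (M : hmod H) (h : H) : k :=
  \sum_(i < \dim {:M}) coord (vbasis {:M}) i (hact M h (vbasis {:M})`_i).

Definition acts_as (M : hmod H) (h : H) (c : k) : Prop :=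
  forall m : M, hact M h m = c *: m.

Variable chi : ldual H.

Definition hit_chi (h : H) : H := sw2 h (fun h1 h2 => chi h1 *: h2).

Definition bullet (h a : H) : H :=
  sw2 h (fun h1 h2 => hit_chi h2 ** a ** antipV H h1).

Definition dual_act (p : ldual H) (m : H) : H :=
  sw2 m (fun m0 m1 => p m1 *: m0).

Definition yd_act (d : drinfeld_double H) : 'End(H) :=
  lift2 (fun (p : ldual H) (h : H) =>
    linfun (fun m => dual_act p (bullet h m))) d.

Definition bullet_space (g : H) : {vspace H} :=
  limg (linfun (fun h => bullet h g)).

Definition bullet_mod (g : H) : hmod (drinfeld_double H) :=
  let W := bullet_space g in
  @HMod k (drinfeld_double H) (subvs_of W)
    (linfun (fun d : drinfeld_double H =>
       linfun (fun w : subvs_of W => vsproj W (yd_act d (vsval w))))).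

End Modules.

Section Taft.
Variables (k : fieldType) (q : k) (l n : nat).

Definition lattice := 'rV[int]_n.

Definition epsilon (i : 'I_n) : lattice := delta_mx 0 i.

Definition lstar (a b : lattice) : int :=
  \sum_(j < n) \sum_(i < n | (j < i)%N) a 0 i * b 0 j.

Definition theta (a b : lattice) : k := q ^ (lstar a b - lstar b a).

Definition pairing (a b : lattice) : int := \sum_(i < n) a 0 i * b 0 i.

(* K' i stands for the generator K(eps_i)^(-1).                               *)
Record taft_relations (B : algType k) (K K' x : 'I_n -> B) : Prop := {
  rel_KK : forall i j, K i * K j = K j * K i;
  rel_KV : forall i, K i * K' i = 1;
  rel_VK : forall i, K' i * K i = 1;
  rel_Kl : forall i, K i ^+ l = 1;
  rel_Kx : forall i j, K i * x j * K' i =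
             (theta (epsilon i) (epsilon j) * q ^+ (i == j)) *: x j;
  rel_xx : forall i j, x i * x j = theta (epsilon i) (epsilon j) *: (x j * x i);
  rel_xl : forall i, x i ^+ l = 0 }.

Definition exponents := {ffun 'I_n -> 'I_l}.

Definition monomial (A : falgType k) (K x : 'I_n -> A) (m : exponents * exponents)
  : A := (\prod_(i < n) x i ^+ m.1 i) * (\prod_(i < n) K i ^+ m.2 i).

Definition monomials (A : falgType k) (K x : 'I_n -> A) :=
  [tuple of [seq monomial K x m | m <- enum {: exponents * exponents}]].

(* The relations, taft_univ and taft_gen present the algebra by generators and *)
(* relations; taft_basis is a consequence of them.  The maps tcomul and       *)
(* tcounit are algebra maps and tantip is an anti-algebra map, so their       *)
(* values on the generators determine them.                                  *)
Record taft := Taft {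
  taft_alg :> falgType k;
  tK : 'I_n -> taft_alg;
  tx : 'I_n -> taft_alg;
  taft_rel : taft_relations tK (fun i => (tK i)^-1) tx;
  taft_univ : forall (B : algType k) (K K' x : 'I_n -> B),
    taft_relations K K' x ->
    exists f : {lrmorphism taft_alg -> B},
      [/\ forall i, f (tK i) = K i,
          forall i, f (tK i)^-1 = K' i &
          forall i, f (tx i) = x i];
  taft_gen : forall (B : algType k) (f g : {lrmorphism taft_alg -> B}),
    (forall i, f (tK i) = g (tK i)) ->
    (forall i, f (tK i)^-1 = g (tK i)^-1) ->
    (forall i, f (tx i) = g (tx i)) -> f =1 g;
  taft_basis : basis_of {:taft_alg} (monomials tK tx);
  tcomul : 'Hom(taft_alg, tensor taft_alg taft_alg);
  tcomul1 : tcomul 1 = 1 ⊗ 1;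
  tcomulM : forall a b : taft_alg, let T := falg taft_alg in
    tcomul (a * b) = (tcomul a : tensor_alg T T) ** (tcomul b : tensor_alg T T);
  tcomulK : forall i, tcomul (tK i) = tK i ⊗ tK i;
  tcomulKV : forall i, tcomul (tK i)^-1 = (tK i)^-1 ⊗ (tK i)^-1;
  tcomulx : forall i, tcomul (tx i) = tx i ⊗ 1 + tK i ⊗ tx i;
  tcounit : 'Hom(taft_alg, k^o);
  tcounit1 : tcounit 1 = 1;
  tcounitM : forall a b : taft_alg, tcounit (a * b) = tcounit a * tcounit b;
  tcounitK : forall i, tcounit (tK i) = 1;
  tcounitKV : forall i, tcounit (tK i)^-1 = 1;
  tcounitx : forall i, tcounit (tx i) = 0;
  tantip : 'End(taft_alg);
  tantip1 : tantip 1 = 1;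
  tantipM : forall a b : taft_alg, tantip (a * b) = tantip b * tantip a;
  tantipK : forall i, tantip (tK i) = (tK i)^-1;
  tantipKV : forall i, tantip (tK i)^-1 = tK i;
  tantipx : forall i, tantip (tx i) = - ((tK i)^-1 * tx i) }.

Variable A : taft.

Definition taft_hopf : hopf k :=
  @Hopf k (falg A) (tcomul A) (tcounit A) (tantip A).

Definition Kpow (a : lattice) : A := \prod_(i < n) tK A i ^ (a 0 i).

(* The linear form whose value on x^gamma K(beta) is                          *)
(* delta_(gamma,0) q^<a, beta>.                                               *)
Definition calK (a : lattice) : ldual taft_hopf :=
  linfun (fun h : A =>
    \sum_(m : exponents * exponents)
      coord (monomials (tK A) (tx A)) (enum_rank m) h *
      (if [forall i, m.1 i == 0%N :> nat]
       then q ^ pairing a (\row_i (m.2 i)%:Z) else 0) : k^o).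

Definition taft_mod (a b : lattice) : hmod (drinfeld_double taft_hopf) :=
  bullet_mod (calK a) (Kpow b : taft_hopf).

End Taft.

(* A diagram in general position with respect to the vertical direction is    *)
(* the list, from bottom to top, of its local minima, local maxima and        *)
(* crossings.  A horizontal line between two consecutive events meets the     *)
(* diagram in strands, recorded from left to right with their directions      *)
(* (true = upward).  An event at position i involves strands i and i+1        *)
(* (counted from 0).  For extrema, ltr tells whether they are traversed from  *)
(* left to right.                                                            *)
Inductive event :=
  | Minimum (i : nat) (ltr : bool)
  | Maximum (i : nat) (ltr : bool)
  | Crossing (i : nat) (positive : bool).

Definition diagram := seq event.

Definition admissible (e : event) (s : seq bool) : bool :=
  match e with
  | Minimum i _ => (i <= size s)%N
  | Maximum i ltr => take 2 (drop i s) == [:: ltr; ~~ ltr]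
  | Crossing i _ => take 2 (drop i s) == [:: true; true]
  end.

Definition after (s : seq bool) (e : event) : seq bool :=
  match e with
  | Minimum i ltr => take i s ++ [:: ~~ ltr; ltr] ++ drop i s
  | Maximum i _ => take i s ++ drop i.+2 s
  | Crossing _ _ => s
  end.

Fixpoint closes (s : seq bool) (D : diagram) : bool :=
  if D is e :: D' then admissible e s && closes (after s e) D' else s == [::].

Definition link_diagram (D : diagram) : bool := closes [::] D.

Section Traversal.
Variable D : diagram.

Definition level (t : nat) : seq bool := foldl after [::] (take t D).

Definition event_at (t : nat) : event := nth (Crossing 0 true) D t.

(* (t, p) is strand p on the line just below event t.                         *)
Definition point : eqType := (nat * nat)%type.

Definition points : seq point :=
  [seq (t, p) | t <- iota 0 (size D).+1, p <- iota 0 (size (level t))].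

Inductive visit :=
  | Pass
  | Cross (t : nat) (over : bool)
  | Extremum (is_max ltr : bool).

Definition insert2 (i p : nat) : nat := if (p < i)%N then p else p.+2.
Definition delete2 (i p : nat) : nat := if (p < i)%N then p else p.-2.

(* One step of the traversal along the orientation, past the next event.      *)
Definition step (x : point) : point * visit :=
  let: (t, p) := x in
  if nth false (level t) p then
    match event_at t with
    | Minimum i _ => ((t.+1, insert2 i p), Pass)
    | Maximum i _ =>
        if p == i then ((t, i.+1), Extremum true true)
        else if p == i.+1 then ((t, i), Extremum true false)
        else ((t.+1, delete2 i p), Pass)
    | Crossing i pos =>
        if p == i then ((t.+1, i.+1), Cross t pos)
        else if p == i.+1 then ((t.+1, i), Cross t (~~ pos))
        else ((t.+1, p), Pass)
    end
  else
    match event_at t.-1 with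
    | Minimum i _ =>
        if p == i then ((t, i.+1), Extremum false true)
        else if p == i.+1 then ((t, i), Extremum false false)
        else ((t.-1, delete2 i p), Pass)
    | Maximum i _ => ((t.-1, insert2 i p), Pass)
    | Crossing _ _ => ((t.-1, p), Pass)
    end.

(* The components of the diagram, each one listed as a cycle of points that   *)
(* starts at its base point.                                                 *)
Definition based_components (cs : seq (seq point)) : bool :=
  all (fun c => (c != [::]) && fcycle (fun x => (step x).1) c) cs
  && perm_eq (flatten cs) points.

Definition visits (c : seq point) : seq visit := [seq (step x).2 | x <- c].

End Traversal.

(* Clockwise extrema are the maxima traversed from left to right and the      *)
(* minima traversed from right to left.  This is twice the rotation number.   *)
Definition twice_rotation (x : visit) : int :=
  if x is Extremum is_max ltr then (if is_max == ltr then 1 else -1) else 0.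

(* The sum is even on a closed curve.                                         *)
Definition Wd (vs : seq visit) : int :=
  ((\sum_(x <- vs) twice_rotation x) %/ 2)%Z.

Definition ltr_balance (vs : seq visit) : int :=
  \sum_(x <- vs) match x with
    | Extremum false true => 1
    | Extremum true true => -1
    | _ => 0
    end.

Definition writhe (D : diagram) : int :=
  \sum_(e <- D) match e with
    | Crossing _ true => 1
    | Crossing _ false => -1
    | _ => 0
    end.

Section Invariant.
Variables (k : fieldType) (H : hopf k) (R : tensor H H) (v : H) (M : hmod H).

Definition Upow (a : int) (y : H) : H :=
  match a with
  | Posz n => iter n (fun z => antipV H (antipV H z)) y
  | Negz n => iter n.+1 (fun z => antip (antip z)) y
  end.

Definition Gelt : H := alg_inv (drinfeld_u R) ** v.

(* ds lists, for each event of the diagram, the decorations of the over- and  *)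
(* the under-strand (a dummy entry for extrema).                              *)
Fixpoint word (ds : seq (H * H)) (vs : seq visit) : H :=
  match vs with
  | [::] => alg_one H
  | Cross t over :: vs' =>
      let d := nth (0, 0) ds t in
      Upow (ltr_balance vs') (if over then d.1 else d.2) ** word ds vs'
  | _ :: vs' => word ds vs'
  end.

Fixpoint state_sum (D : diagram) (F : seq (H * H) -> k^o) : k^o :=
  match D with
  | [::] => F [::]
  | Crossing _ pos :: D' =>
      lift2 (fun e e' => state_sum D' (fun ds => F ((e, e') :: ds)))
            (if pos then R else R_inv R)
  | _ :: D' => state_sum D' (fun ds => F ((0, 0) :: ds))
  end.

Definition Inv (D : diagram) (cs : seq (seq point)) : k :=
  state_sum D (fun ds =>
    \prod_(c <- cs)
      hchar M (alg_expz Gelt (Wd (visits D c)) ** word ds (visits D c))).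

(* c is the scalar by which v acts on M.                                      *)
Definition Invbar (c : k) (D : diagram) (cs : seq (seq point)) : k :=
  c ^ writhe D * Inv D cs.

End Invariant.

(* Main.v *)
Require Import Defs.
From HB Require Import structures.
From mathcomp Require Import all_boot all_order all_algebra all_field.
From mathcomp Require Import ring zify.

(** The module of rank one has a basis labelled by bool, and the module of rank
    two a basis labelled by bool * bool; the second module behaves like the
    tensor square of the first, up to a twist that no link diagram can see.

    Let r be the fourth root q^(i0^2) of q in the group generated by q, and give
    the two labels the weights 1 and -1 (wt). In suitable bases, every entry of
    the R-matrix of rank two is the product of the two entries of the R-matrix
    of rank one for the first and for the second components of the labels, times
    a power of r whose exponent is a difference of products of weights (T2E); the
    same holds for the inverses (Q2E). The R-matrix of rank one conserves the
    total weight. The element u acts diagonally in both cases, and its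
    eigenvalues in rank two are products of those in rank one (U2).

    On any module with such a basis the invariant is a state sum (Inv_labels):
    the sum, over all labelings of the points of the diagram that are constant
    along the strands between crossings, of a product of pivotal factors and of
    one entry of the R-matrix per crossing. A labeling by pairs is a pair of
    labelings, so the state sum of rank two would be the square of the one of
    rank one, if it were not for the powers of r. For a given pair of labelings
    of non-zero weight their exponents add up to zero (twist_sum): to every
    horizontal line one attaches the sum, over its ordered pairs of strands, of
    the signed second weight of the left strand times the signed first weight of
    the right one. Up to a correction on downward strands this potential does
    not change at extrema, where two antiparallel strands with equal labels
    cancel, and at a crossing it changes exactly by the exponent of r, because
    the weights are conserved. It vanishes below and above the diagram.

    It remains to compare the scalars c2 and c1 by which the ribbon elements act
    (they enter through the pivotal factors and the writhe): c2 = c1^2. From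
    v^2 = u s(u), evaluated on the group-like generators of the modules, c1^2 is
    r^6 and c2^2 is r^12, so the two sides have the same square; as l is odd, it
    is enough that both are l-th roots of unity. For this let lambda_n be the
    scalar by which v acts on the nth power of the group-like generator g in the
    module twisted by the nth power of the character chi. The coproduct of v
    gives chi(g)^(n (n - 1)) lambda_n = (lambda_1)^n (central_scalar_pow), and
    for n = l the module is trivial, so lambda_l is the counit of v, which is 1.

    The structure maps of the double are given in coordinates, without axioms.
    Associativity, the antipode and the elements u and R are treated by
    identifying the double of H with the endomorphisms of H (ev), under which u
    is the inverse antipode. *)

Set Implicit Arguments.
Unset Strict Implicit.
Unset Printing Implicit Defensive.

Import GRing.Theory.
Local Open Scope ring_scope.

(** * Linear maps and tensors *)

Section Linear.
Variable k : fieldType.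
Implicit Types U V W T : vectType k.

(** Linearity as a predicate on plain functions, because most maps below are
    open terms built from lift2, for which no bundled linear map is at hand. *)
Definition islin V W (f : V -> W) :=
  forall a u v, f (a *: u + v) = a *: f u + f v.

Definition islinP V W (f : V -> W) (fl : islin f) : {linear V -> W} :=
  HB.pack f (GRing.isLinear.Build k V W *:%R f fl).

Lemma linfunK V W (f : V -> W) : islin f -> forall v, linfun f v = f v.
Proof. by move=> fl v; rewrite (lfunE (islinP fl)). Qed.

Lemma islin_sum V W (f : V -> W) (fl : islin f) (I : Type) (s : seq I) (P : pred I) (F : I -> V) :
  f (\sum_(i <- s | P i) F i) = \sum_(i <- s | P i) f (F i).
Proof. exact: (linear_sum (islinP fl)). Qed.

Lemma islinZ V W (f : V -> W) (fl : islin f) a v : f (a *: v) = a *: f v.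
Proof. exact: (linearZZ (islinP fl)). Qed.

Lemma lin_id V : islin (fun x : V => x). Proof. by []. Qed.
Lemma lin_zero V W : islin (fun _ : V => 0 : W).
Proof. by move=> a u v; rewrite scaler0 addr0. Qed.
Lemma lin_hom V W U (F : 'Hom(W, U)) (f : V -> W) : islin f -> islin (fun x => F (f x)).
Proof. by move=> fl a u v; rewrite fl linearP. Qed.
Lemma lin_homl V W U (F : V -> 'Hom(W, U)) (w : W) : islin F -> islin (fun x => F x w).
Proof. by move=> fl a u v; rewrite fl add_lfunE scale_lfunE. Qed.
Lemma lin_scaler V W c (f : V -> W) : islin f -> islin (fun x => c *: f x).
Proof. by move=> fl a u v; rewrite fl scalerDr !scalerA mulrC. Qed.
Lemma lin_scalel V W (f : V -> k^o) (w : W) : islin f -> islin (fun x => f x *: w).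
Proof. by move=> fl a u v; rewrite fl scalerDl scalerA. Qed.
Lemma lin_mulr V (c : k) (f : V -> k^o) : islin f -> islin (fun x => c * f x : k^o).
Proof. by move=> fl a u v; rewrite fl (mulrDr c : forall x y : k, _); congr (_ + _); rewrite mulrCA. Qed.
Lemma lin_mull V (c : k) (f : V -> k^o) : islin f -> islin (fun x => f x * c : k^o).
Proof. by move=> fl a u v; rewrite fl (mulrDl (_ : k)); congr (_ + _); rewrite -mulrA. Qed.
Lemma lin_add V W (f g : V -> W) : islin f -> islin g -> islin (fun x => f x + g x).
Proof. by move=> fl gl a u v; rewrite fl gl scalerDr addrACA. Qed.
Lemma lin_opp V W (f : V -> W) : islin f -> islin (fun x => - f x).
Proof. by move=> fl a u v; rewrite fl opprD scalerN. Qed.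
Lemma lin_bigsum V W (I : Type) (s : seq I) (P : pred I) (f : I -> V -> W) :
  (forall i, islin (f i)) -> islin (fun x => \sum_(i <- s | P i) f i x).
Proof.
move=> fl a u v; rewrite scaler_sumr -big_split; apply: eq_bigr => i _; exact: fl.
Qed.
Lemma lin_coord V W n (X : n.-tuple W) i (f : V -> W) :
  islin f -> islin (fun v => coord X i (f v) : k^o).
Proof. by move=> fl a u v; rewrite fl linearP. Qed.
Lemma lin_comp V W U (g : W -> U) (f : V -> W) : islin g -> islin f -> islin (fun x => g (f x)).
Proof. by move=> gl fl a u v; rewrite fl gl. Qed.
Lemma lin_tensl V W U (f : V -> W) (w : U) : islin f -> islin (fun x => f x ⊗ w).
Proof.
by move=> fl a u v; apply/matrixP => i j; rewrite !mxE fl linearP /= mulrDl mulrA.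
Qed.
Lemma lin_tensr V W U (f : V -> W) (w : U) : islin f -> islin (fun x => w ⊗ f x).
Proof.
by move=> fl a u v; apply/matrixP => i j; rewrite !mxE fl linearP /= mulrDr mulrCA.
Qed.
Lemma lin_lift2 V W U T (F : V -> T -> U -> W) (t : tensor T U) :
  (forall x y, islin (fun v => F v x y)) -> islin (fun v => lift2 (F v) t).
Proof.
move=> Fl a u v; rewrite !lift2E /lift2_fun scaler_sumr -big_split; apply: eq_bigr => i _.
rewrite scaler_sumr -big_split; apply: eq_bigr => j _ /=.
by rewrite Fl scalerDr !scalerA mulrC.
Qed.

Lemma eq_lift2 V W U (f g : V -> W -> U) t : (forall x y, f x y = g x y) -> lift2 f t = lift2 g t.
Proof.
move=> fg; rewrite !lift2E; apply: eq_bigr => i _; apply: eq_bigr => j _.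
by rewrite fg.
Qed.

Definition bilin V W U (f : V -> W -> U) :=
  (forall w, islin (fun v => f v w)) /\ (forall v, islin (f v)).

Lemma lift2T V W U (f : V -> W -> U) : bilin f -> forall v w, lift2 f (v ⊗ w) = f v w.
Proof. by case=> fl fr; apply: lift2_tens. Qed.

Lemma lift2_lin V W U T (g : U -> T) (f : V -> W -> U) t : islin g ->
  g (lift2 f t) = lift2 (fun x y => g (f x y)) t.
Proof.
move=> gl; rewrite !lift2E /lift2_fun (islin_sum gl); apply: eq_bigr => i _.
by rewrite (islin_sum gl); apply: eq_bigr => j _; rewrite (islinZ gl).
Qed.

Lemma lin_tcoef V W a b : islin (fun t : tensor V W => tcoef t a b : k^o).
Proof. by move=> c u v; rewrite /tcoef !mxE. Qed.

Lemma tcoefE V W (v : V) (w : W) i j :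
  tcoef (v ⊗ w) i j = coord (vbasis {:V}) i v * coord (vbasis {:W}) j w.
Proof. exact: mxE. Qed.

Lemma tensor_decomp V W (t : tensor V W) :
  t = \sum_(i < \dim {:V}) \sum_(j < \dim {:W})
        tcoef t i j *: ((vbasis {:V})`_i ⊗ (vbasis {:W})`_j).
Proof.
suff E a b : tcoef t a b = tcoef (\sum_(i < \dim {:V}) \sum_(j < \dim {:W})
    tcoef t i j *: ((vbasis {:V})`_i ⊗ (vbasis {:W})`_j)) a b by apply/matrixP; exact: E.
have L := @lin_tcoef V W a b; rewrite (islin_sum L) (bigD1 a) //= (islin_sum L) (bigD1 b) //=.
have fV := basis_free (vbasisP {:V}); have fW := basis_free (vbasisP {:W}).
rewrite (islinZ L) tcoefE !coord_free // !eqxx mulr1 !big1 ?addr0 => [|i ia|j jb].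
- by rewrite /GRing.scale /= mulr1.
- rewrite (islin_sum L) big1 // => j _; rewrite (islinZ L) tcoefE !coord_free //.
  by rewrite (negPf ia) mul0r scaler0.
- rewrite (islinZ L) tcoefE !coord_free //.
  by rewrite (negPf jb) mulr0 scaler0.
Qed.

(** Pure tensors span, so an identity between linear maps on a tensor product is
    proved by inserting a pure tensor. *)
Lemma tensor_ext V W U (f g : tensor V W -> U) : islin f -> islin g ->
  (forall v w, f (v ⊗ w) = g (v ⊗ w)) -> forall t, f t = g t.
Proof.
move=> fl gl fg t; rewrite (tensor_decomp t) !(islin_sum fl) !(islin_sum gl).
apply: eq_bigr => i _; rewrite !(islin_sum fl) !(islin_sum gl); apply: eq_bigr => j _.
by rewrite (islinZ fl) (islinZ gl) fg.
Qed.

Lemma tensZl V W a (v : V) (w : W) : (a *: v) ⊗ w = a *: (v ⊗ w).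
Proof. exact: (islinZ (@lin_tensl V V W id w (@lin_id V))). Qed.
Lemma tensZr V W a (v : V) (w : W) : v ⊗ (a *: w) = a *: (v ⊗ w).
Proof. exact: (islinZ (@lin_tensr W W V id v (@lin_id W))). Qed.
Lemma tens_suml V W (I : Type) (s : seq I) P (f : I -> V) (w : W) :
  (\sum_(i <- s | P i) f i) ⊗ w = \sum_(i <- s | P i) (f i ⊗ w).
Proof. exact: (islin_sum (@lin_tensl V V W id w (@lin_id V))). Qed.
Lemma tens_sumr V W (I : Type) (s : seq I) P (v : V) (f : I -> W) :
  v ⊗ (\sum_(i <- s | P i) f i) = \sum_(i <- s | P i) (v ⊗ f i).
Proof. exact: (islin_sum (@lin_tensr W W V id v (@lin_id W))). Qed.

(** Contraction with a pair of dual bases. The canonical elements of the double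
    (its R-matrix and the element u) are sums over dual bases, and reading this
    identity from right to left removes them from a formula. *)
Lemma dual_coord V (v : V) (U : vectType k) (F : V -> U) : islin F ->
  F v = \sum_(i < \dim {:V}) coord (vbasis {:V}) i v *: F (vbasis {:V})`_i.
Proof.
move=> Fl; rewrite {1}(coord_vbasis (memvf v)) (islin_sum Fl).
by apply: eq_bigr => i _; rewrite (islinZ Fl).
Qed.

End Linear.

(** * Sweedler calculus *)

Section Sweedler.
Variables (k : fieldType) (H : hopf k).
Implicit Types (U V W : vectType k).

Lemma lin_sw2 V U (h : H) (F : V -> H -> H -> U) :
  (forall x y, islin (fun v => F v x y)) -> islin (fun v => sw2 h (F v)).
Proof. exact: lin_lift2. Qed.

Lemma lin_sw2h V U (f : V -> H) (F : H -> H -> U) : islin f -> islin (fun v => sw2 (f v) F).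
Proof. by move=> fl; rewrite /sw2; do 2!apply: lin_hom. Qed.

Lemma sw2Z U a (h : H) (F : H -> H -> U) : sw2 (a *: h) F = a *: sw2 h F.
Proof. by rewrite /sw2 !linearZ. Qed.

Lemma sum_sw2 U (I : Type) (s : seq I) h (F : I -> H -> H -> U) :
  \sum_(i <- s) sw2 h (F i) = sw2 h (fun a b => \sum_(i <- s) F i a b).
Proof.
rewrite /sw2 lift2E /lift2_fun; under eq_bigr do rewrite lift2E /lift2_fun.
rewrite exchange_big; apply: eq_bigr => j _; rewrite exchange_big; apply: eq_bigr => l _.
by rewrite scaler_sumr.
Qed.

Lemma eq_sw2 U (h : H) f (g : H -> H -> U) :
  (forall a b, f a b = g a b) -> sw2 h f = sw2 h g.
Proof. exact: eq_lift2. Qed.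

Lemma sw2_lin U V (g : U -> V) h (f : H -> H -> U) : islin g ->
  g (sw2 h f) = sw2 h (fun a b => g (f a b)).
Proof. exact: lift2_lin. Qed.

Lemma scale_sw2 U a h (f : H -> H -> U) : a *: sw2 h f = sw2 h (fun x y => a *: f x y).
Proof. by apply: sw2_lin => b u v; rewrite scalerDr !scalerA mulrC. Qed.

(** Sums over two independent coproducts can be interchanged: in coordinates both
    sides are the same quadruple sum. *)
Lemma sw2C U (h h' : H) (F : H -> H -> H -> H -> U) :
  sw2 h (fun a b => sw2 h' (fun c d => F a b c d)) =
  sw2 h' (fun c d => sw2 h (fun a b => F a b c d)).
Proof.
have E a b : sw2 h' (fun c d => F a b c d) = lift2_fun (F a b) (comul h').
  by rewrite /sw2 lift2E.
rewrite (eq_sw2 _ E) /sw2 lift2E [in LHS]/lift2_fun.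
rewrite [RHS]lift2E [in RHS]/lift2_fun /lift2_fun.
under eq_bigr do under eq_bigr do rewrite scaler_sumr.
under eq_bigr do under eq_bigr do under eq_bigr do rewrite scaler_sumr.
under [RHS]eq_bigr do under eq_bigr do rewrite lift2E /lift2_fun scaler_sumr.
under [RHS]eq_bigr do under eq_bigr do under eq_bigr do rewrite scaler_sumr.
have X (m : nat) (G : 'I_m -> 'I_m -> 'I_m -> 'I_m -> U) :
  \sum_i \sum_j \sum_i' \sum_j' G i j i' j' = \sum_i' \sum_j' \sum_i \sum_j G i j i' j'.
  under eq_bigr do rewrite exchange_big; rewrite exchange_big; apply: eq_bigr => i' _.
  by under eq_bigr do rewrite exchange_big; rewrite exchange_big.
rewrite X; apply: eq_bigr => i _; apply: eq_bigr => j _; apply: eq_bigr => i' _.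
by apply: eq_bigr => j' _; rewrite !scalerA mulrC.
Qed.

Definition trilin U V W (T : vectType k) (f : U -> V -> W -> T) :=
  [/\ forall b c, islin (fun a => f a b c), forall a c, islin (fun b => f a b c) &
      forall a b, islin (fun c => f a b c)].

(** The axioms are stated in the form in which Sweedler notation uses them, with an
    arbitrary multilinear map applied to the tensor factors; coassociativity and
    multiplicativity of the coproduct can then be used for rewriting anywhere
    inside an iterated sum. *)
Record hopf_laws : Prop := HopfLaws {
  hmulA : forall a b c : H, a ** (b ** c) = (a ** b) ** c;
  hmul1l : forall a : H, alg_one H ** a = a;
  hmul1r : forall a : H, a ** alg_one H = a;
  coassoc : forall U (f : H -> H -> H -> U), trilin f -> forall h : H,
    sw2 h (fun a b => sw2 a (fun c d => f c d b)) =
    sw2 h (fun a b => sw2 b (fun c d => f a c d));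
  counitl : forall h : H, sw2 h (fun a b => (counit a : k) *: b) = h;
  counitr : forall h : H, sw2 h (fun a b => (counit b : k) *: a) = h;
  sw2M : forall U (f : H -> H -> U), bilin f -> forall h h' : H,
    sw2 (h ** h') f = sw2 h (fun a b => sw2 h' (fun c d => f (a ** c) (b ** d)));
  comul_1 : comul (alg_one H) = alg_one H ⊗ alg_one H;
  counitM : forall a b : H, counit (a ** b) = counit a * counit b;
  counit_1 : counit (alg_one H) = 1;
  antipL : forall h : H, sw2 h (fun a b => antip a ** b) = (counit h : k) *: alg_one H;
  antipR : forall h : H, sw2 h (fun a b => a ** antip b) = (counit h : k) *: alg_one H;
  antipM : forall a b : H, antip (a ** b) = antip b ** antip a;
  antip_1 : antip (alg_one H) = alg_one H;
  antipK : cancel antip (antipV H);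
  antipVK : cancel (antipV H) antip;
  sw2S : forall U (f : H -> H -> U), bilin f -> forall h : H,
    sw2 (antip h) f = sw2 h (fun a b => f (antip b) (antip a));
  counitS : forall h : H, counit (antip h) = counit h }.

End Sweedler.

Ltac lin_hyp :=
  match goal with
  | H : bilin _ |- _ => solve [apply (proj1 H) | apply (proj2 H)]
  | H : trilin _ |- _ => let h1 := fresh in let h2 := fresh in let h3 := fresh in
      solve [case: (H) => h1 h2 h3; first [apply h1 | apply h2 | apply h3]]
  | H : _ |- _ => solve [apply H]
  end.

Ltac lin_hook := fail.

Ltac is_const f := lazymatch f with (fun _ => ?c) => idtac end.

(** Proves linearity in a variable by descending to the subterm that contains it.
    The extension point lin_hook is for operations with linearity lemmas of their
    own. *)
Ltac lin :=
  cbv beta;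
  lazymatch goal with
  | |- bilin _ => split; lin
  | |- trilin _ => split; lin
  | |- forall _, _ => intro; lin
  | |- islin (fun x => x) => exact: lin_id
  | |- islin (fun x => 0) => exact: lin_zero
  | |- islin (fun x => sw3 _ _) => rewrite /sw3; lin
  | |- islin (fun x => sw2 (@?h x) (@?F x)) =>
      (tryif is_const h then refine (@lin_sw2 _ _ _ _ _ F _) else refine (@lin_sw2h _ _ _ _ h _ _)); lin
  | |- islin (fun x => fun_of_lfun (@?F x) (@?f x)) =>
      (tryif is_const F then refine (@lin_hom _ _ _ _ _ f _) else
       first [ lazymatch F with (fun x => lift2 (@?G x)) => refine (@lin_lift2 _ _ _ _ _ G _ _) end
             | refine (@lin_homl _ _ _ _ F _ _)]); lin
  | |- islin (fun_of_lfun ?F) => refine (@lin_hom _ _ _ _ F (fun x => x) _); lin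
  | |- islin (fun x => (@?f x) ⊗ (@?g x)) =>
      (tryif is_const f then refine (@lin_tensr _ _ _ _ g _ _) else refine (@lin_tensl _ _ _ _ f _ _)); lin
  | |- islin (tens ?w) => refine (@lin_tensr _ _ _ _ id w _); lin
  | |- islin (fun x => (@?c x) *: (@?f x)) =>
      (tryif is_const c then refine (@lin_scaler _ _ _ _ f _) else refine (@lin_scalel _ _ _ c _ _)); lin
  | |- islin (fun x => (@?f x) + (@?g x)) => refine (@lin_add _ _ _ f g _ _); lin
  | |- islin (fun x => - (@?f x)) => refine (@lin_opp _ _ _ f _); lin
  | |- islin (fun x => (@?f x) * (@?g x)) =>
      (tryif is_const f then refine (@lin_mulr _ _ _ g _) else refine (@lin_mull _ _ _ f _)); lin
  | |- islin (fun x => \sum_(i <- ?s | @?P i) (@?f i x)) => refine (@lin_bigsum _ _ _ _ s P f _); lin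
  | |- _ =>
    match goal with
    | |- _ => lin_hyp
    | |- _ => lin_hook
    | |- islin (fun x => ?g (@?f x) ?b ?c) =>
        refine (@lin_comp _ _ _ _ (fun z => g z b c) f _ _); [lin_hyp | lin]
    | |- islin (fun x => ?g (@?f x) ?b) =>
        refine (@lin_comp _ _ _ _ (fun z => g z b) f _ _); [lin_hyp | lin]
    | |- islin (fun x => ?g (@?f x)) =>
        refine (@lin_comp _ _ _ _ g f _ _); [lin_hyp | lin]
    | |- ?G => fail 1 "lin" G
    end
  end.

Section HopfTheory.
Variables (k : fieldType) (H : hopf k).
Hypothesis L : hopf_laws H.
Implicit Types (U V W : vectType k).
Local Notation S' := (antipV H).
Local Notation "1H" := (alg_one H).

Lemma antipVM (a b : H) : S' (a ** b) = S' b ** S' a.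
Proof.
by apply: (can_inj (antipK L)); rewrite (antipM L) !(antipVK L).
Qed.

Lemma antipV1 : S' 1H = 1H.
Proof. by rewrite -{1}(antip_1 L) (antipK L). Qed.

Lemma counitV (h : H) : counit (S' h) = counit h.
Proof. by rewrite -(counitS L) (antipVK L). Qed.

Lemma sw2V U (f : H -> H -> U) : bilin f -> forall h : H,
    sw2 (S' h) f = sw2 h (fun a b => f (S' b) (S' a)).
Proof.
move=> fl h; rewrite -{2}(antipVK L h) (sw2S L); last by lin.
by apply: eq_sw2 => a b; rewrite !(antipK L).
Qed.

Lemma sw2_1 U (f : H -> H -> U) : bilin f -> sw2 1H f = f 1H 1H.
Proof. by move=> fl; rewrite /sw2 (comul_1 L) lift2T. Qed.

Lemma counitlF U (f : H -> U) h : islin f -> sw2 h (fun a b => (counit a : k) *: f b) = f h.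
Proof.
move=> fl; rewrite -{2}(counitl L h) (sw2_lin _ _ fl).
by apply: eq_sw2 => a b; rewrite (islinZ fl).
Qed.

Lemma counitrF U (f : H -> U) h : islin f -> sw2 h (fun a b => (counit b : k) *: f a) = f h.
Proof.
move=> fl; rewrite -{2}(counitr L h) (sw2_lin _ _ fl).
by apply: eq_sw2 => a b; rewrite (islinZ fl).
Qed.

(** Applying the antipode, which reverses products, turns the statement for the
    inverse antipode into the axiom for the antipode with the factors exchanged. *)
Lemma antipVL h : sw2 h (fun a b => S' b ** a) = (counit h : k) *: 1H.
Proof.
apply: (can_inj (antipK L)); rewrite (@sw2_lin _ _ _ _ (fun z => antip z)); last by lin.
rewrite linearZ /= (antip_1 L) -(antipL L).
by apply: eq_sw2 => a b; rewrite (antipM L) (antipVK L).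
Qed.

Lemma antipVR h : sw2 h (fun a b => b ** S' a) = (counit h : k) *: 1H.
Proof.
apply: (can_inj (antipK L)); rewrite (@sw2_lin _ _ _ _ (fun z => antip z)); last by lin.
rewrite linearZ /= (antip_1 L) -(antipR L).
by apply: eq_sw2 => a b; rewrite (antipM L) (antipVK L).
Qed.

Lemma antipVLF U (f : H -> U) h : islin f ->
  sw2 h (fun a b => f (S' b ** a)) = (counit h : k) *: f 1H.
Proof. by move=> fl; rewrite -(islinZ fl) -antipVL (sw2_lin _ _ fl). Qed.

Lemma antipVRF U (f : H -> U) h : islin f ->
  sw2 h (fun a b => f (b ** S' a)) = (counit h : k) *: f 1H.
Proof. by move=> fl; rewrite -(islinZ fl) -antipVR (sw2_lin _ _ fl). Qed.

End HopfTheory.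

Section Sweedler5.
Variables (k : fieldType) (H : hopf k).
Hypothesis L : hopf_laws H.
Implicit Types (U V W : vectType k).
Local Notation S' := (antipV H).

Lemma eq_sw3 U (h : H) f (g : H -> H -> H -> U) :
  (forall a b c, f a b c = g a b c) -> sw3 h f = sw3 h g.
Proof. by move=> fg; apply: eq_sw2 => a x; apply: eq_sw2 => b c; apply: fg. Qed.

Lemma scale_sw3 U a h (f : H -> H -> H -> U) :
  a *: sw3 h f = sw3 h (fun x y z => a *: f x y z).
Proof. by rewrite /sw3 scale_sw2; apply: eq_sw2 => x t; rewrite scale_sw2. Qed.

Lemma sw3Z U a (h : H) (F : H -> H -> H -> U) : sw3 (a *: h) F = a *: sw3 h F.
Proof. exact: sw2Z. Qed.

Lemma sum_sw3 U (I : Type) (s : seq I) h (F : I -> H -> H -> H -> U) :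
  \sum_(i <- s) sw3 h (F i) = sw3 h (fun a b c => \sum_(i <- s) F i a b c).
Proof. by rewrite /sw3 sum_sw2; apply: eq_sw2 => a x; rewrite sum_sw2. Qed.

Lemma sw3_lin U V (g : U -> V) h (f : H -> H -> H -> U) : islin g ->
  g (sw3 h f) = sw3 h (fun a b c => g (f a b c)).
Proof.
by move=> gl; rewrite /sw3 sw2_lin //; apply: eq_sw2 => a x; rewrite sw2_lin.
Qed.

Lemma sw23C U (h h' : H) (F : H -> H -> H -> H -> H -> U) :
  sw2 h (fun a b => sw3 h' (fun c d e => F a b c d e)) =
  sw3 h' (fun c d e => sw2 h (fun a b => F a b c d e)).
Proof. by rewrite /sw3 sw2C; apply: eq_sw2 => c x; rewrite sw2C. Qed.

Lemma sw3M U (f : H -> H -> H -> U) : trilin f -> forall h h' : H,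
  sw3 (h ** h') f = sw3 h (fun a b c => sw3 h' (fun a' b' c' =>
     f (a ** a') (b ** b') (c ** c'))).
Proof.
move=> fl h h'; rewrite /sw3 (sw2M L); last by lin.
apply: eq_sw2 => a x; rewrite sw2C; apply: eq_sw2 => a' x'.
by rewrite (sw2M L); last by lin.
Qed.

Lemma sw3V U (f : H -> H -> H -> U) : trilin f -> forall h : H,
  sw3 (S' h) f = sw3 h (fun a b c => f (S' c) (S' b) (S' a)).
Proof.
move=> fl h; rewrite /sw3 (sw2V L); last by lin.
rewrite -(coassoc L); last by lin.
by apply: eq_sw2 => x a; rewrite (sw2V L); last by lin.
Qed.

Lemma sw3S U (f : H -> H -> H -> U) : trilin f -> forall h : H,
  sw3 (antip h) f = sw3 h (fun a b c => f (antip c) (antip b) (antip a)).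
Proof.
move=> fl h; rewrite /sw3 (sw2S L); last by lin.
rewrite -(coassoc L); last by lin.
by apply: eq_sw2 => x a; rewrite (sw2S L); last by lin.
Qed.

Lemma sw3_1 U (f : H -> H -> H -> U) : trilin f ->
  sw3 (alg_one H) f = f (alg_one H) (alg_one H) (alg_one H).
Proof. by move=> fl; rewrite /sw3 (sw2_1 L); [rewrite (sw2_1 L) //|]; lin. Qed.

Lemma sw3_counit U (f : H -> U) h : islin f ->
  sw3 h (fun a b c => ((counit a : k) * (counit c : k)) *: f b) = f h.
Proof.
move=> fl; rewrite /sw3 -[RHS](counitlF L (f := f)) //; apply: eq_sw2 => a x.
rewrite -(counitrF L (f := f) x) // scale_sw2; apply: eq_sw2 => b c.
by rewrite scalerA.
Qed.

(** By coassociativity, splitting the middle factor of a threefold coproduct in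
    three gives the same as splitting both outer factors in two. This is the form
    in which coassociativity enters the associativity of the double and the
    multiplicativity of its action. *)
Lemma sw5_mid U (F : H -> H -> H -> H -> H -> U) :
  (forall b c d e, islin (fun a => F a b c d e)) ->
  (forall a c d e, islin (fun b => F a b c d e)) ->
  (forall a b d e, islin (fun c => F a b c d e)) ->
  (forall a b c e, islin (fun d => F a b c d e)) ->
  (forall a b c d, islin (fun e => F a b c d e)) -> forall h : H,
  sw3 h (fun a b c => sw3 b (fun b1 b2 b3 => F a b1 b2 b3 c)) =
  sw3 h (fun a b c => sw2 a (fun a1 a2 => sw2 c (fun c1 c2 => F a1 a2 b c1 c2))).
Proof.
move=> l1 l2 l3 l4 l5 h; rewrite /sw3.
transitivity (sw2 h (fun a x => sw2 x (fun b y => sw2 y (fun c z => sw2 z (fun d e =>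
    F a b c d e))))).
  apply: eq_sw2 => a x.
  rewrite (coassoc L (f := fun b y c => sw2 y (fun d e => F a b d e c))); last by lin.
  apply: eq_sw2 => b y.
  by rewrite (coassoc L (f := fun c d e => F a b c d e)); last by lin.
rewrite -(coassoc L (f := fun a b y => sw2 y (fun c z => sw2 z (fun d e => F a b c d e)))); last by lin.
by apply: eq_sw2 => a x; rewrite sw2C.
Qed.
End Sweedler5.

(** * The Drinfeld double as an algebra of operators *)

Section Dual.
Variables (k : fieldType) (H : hopf k).
Implicit Types (U V W T : vectType k).
Local Notation dual := (ldual H).

Lemma dual_basisE i (h : H) : dual_basis i h = coord (vbasis {:H}) i h.
Proof. by rewrite linfunK // => a u v; rewrite linearP. Qed.

Lemma dual_mulE (p p' : dual) y : dual_mul p p' y = sw2 y (fun a b => p a * p' b : k^o).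
Proof. by rewrite linfunK //; lin. Qed.

Lemma dual_exp (p : dual) y :
  p y = \sum_(i < \dim {:H}) coord (vbasis {:H}) i y * p (vbasis {:H})`_i.
Proof. by rewrite (dual_coord y (F := p)) //; lin. Qed.

Lemma hitlE h (p : dual) y : hitl h p y = p (y ** h).
Proof.
rewrite /hitl /dual_comul linear_sum sum_lfunE (dual_coord y (F := fun y => p (y ** h))); last by lin.
apply: eq_bigr => i _; rewrite linear_sum sum_lfunE.
rewrite (dual_coord h (F := fun h => p (_ ** h))); last by lin.
rewrite scaler_sumr; apply: eq_bigr => j _; rewrite linearZ /= lift2T; last by lin.
by rewrite !scale_lfunE !dual_basisE /GRing.scale /=; ring.
Qed.

Lemma hitrE h (p : dual) y : hitr p h y = p (h ** y).
Proof.
rewrite /hitr /dual_comul linear_sum sum_lfunE (dual_coord h (F := fun h => p (h ** y))); last by lin.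
apply: eq_bigr => i _; rewrite linear_sum sum_lfunE.
rewrite (dual_coord y (F := fun y => p (_ ** y))); last by lin.
rewrite scaler_sumr; apply: eq_bigr => j _; rewrite linearZ /= lift2T; last by lin.
by rewrite !scale_lfunE !dual_basisE /GRing.scale /=; ring.
Qed.

Lemma lin_dual_mull V (f : V -> dual) (p : dual) : islin f -> islin (fun v => dual_mul (f v) p).
Proof.
move=> fl a u v; apply/lfunP => y; rewrite add_lfunE scale_lfunE !dual_mulE.
have G : islin (fun q : dual => sw2 y (fun a b => q a * p b : k^o)) by lin.
by rewrite fl G.
Qed.
Lemma lin_dual_mulr V (f : V -> dual) (p : dual) : islin f -> islin (fun v => dual_mul p (f v)).
Proof.
move=> fl a u v; apply/lfunP => y; rewrite add_lfunE scale_lfunE !dual_mulE.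
have G : islin (fun q : dual => sw2 y (fun a b => p a * q b : k^o)) by lin.
by rewrite fl G.
Qed.
Lemma lin_hitl V (f : V -> dual) (h : H) : islin f -> islin (fun v => hitl h (f v)).
Proof.
by move=> fl a u v; apply/lfunP => y; rewrite add_lfunE scale_lfunE !hitlE fl add_lfunE scale_lfunE.
Qed.
Lemma lin_hitlh V (f : V -> H) (p : dual) : islin f -> islin (fun v => hitl (f v) p).
Proof.
move=> fl a u v; apply/lfunP => y; rewrite add_lfunE scale_lfunE !hitlE fl.
by have G : islin (fun z => p (y ** z)) by [lin]; rewrite G.
Qed.
Lemma lin_hitr V (f : V -> dual) (h : H) : islin f -> islin (fun v => hitr (f v) h).
Proof.
by move=> fl a u v; apply/lfunP => y; rewrite add_lfunE scale_lfunE !hitrE fl add_lfunE scale_lfunE.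
Qed.
Lemma lin_hitrh V (f : V -> H) (p : dual) : islin f -> islin (fun v => hitr p (f v)).
Proof.
move=> fl a u v; apply/lfunP => y; rewrite add_lfunE scale_lfunE !hitrE fl.
by have G : islin (fun z => p (z ** y)) by [lin]; rewrite G.
Qed.
Lemma lin_compl V U W (f : V -> 'Hom(U, W)) T (g : 'Hom(T, U)) :
  islin f -> islin (fun v => (f v \o g)%VF).
Proof.
by move=> fl a u v; apply/lfunP => y; rewrite add_lfunE scale_lfunE !comp_lfunE fl add_lfunE scale_lfunE.
Qed.
End Dual.

Ltac lin_dual :=
  lazymatch goal with
  | |- islin (fun x => dual_mul (@?f x) (@?g x)) =>
      (tryif is_const f then refine (@lin_dual_mulr _ _ _ g _ _) else refine (@lin_dual_mull _ _ _ f _ _)); lin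
  | |- islin (fun x => hitl (@?h x) (@?f x)) =>
      (tryif is_const h then refine (@lin_hitl _ _ _ f _ _) else refine (@lin_hitlh _ _ _ h _ _)); lin
  | |- islin (fun x => hitr (@?f x) (@?h x)) =>
      (tryif is_const f then refine (@lin_hitrh _ _ _ h _ _) else refine (@lin_hitr _ _ _ f _ _)); lin
  | |- islin (fun x => coord ?X ?i (@?f x)) => refine (@lin_coord _ _ _ _ X i f _); lin
  | |- islin (fun x => ((@?f x) \o ?g)%VF) => refine (@lin_compl _ _ _ _ f _ g _); lin
  end.
Ltac lin_hook ::= lin_dual.

Section DoubleMul.
Variables (k : fieldType) (H : hopf k).
Hypothesis L : hopf_laws H.
Local Notation D := (drinfeld_double H).
Implicit Types (U V W T : vectType k).
Local Notation dual := (ldual H).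
Local Notation S' := (antipV H).
Local Notation S := (@antip _ H).
Local Notation "1H" := (alg_one H).
Local Notation eps := (@counit _ H).

(** The tensor of p and h is read as the operator sending y to p(y) h. Since H is
    finite-dimensional, this identifies the double with the endomorphisms of H, so
    that an identity in the double can be checked on the vectors y of H; the dual
    space, whose structure is only given in coordinates, then no longer occurs. *)
Definition ev (d : D) (y : H) : H := lift2 (fun (p : dual) h => (p y : k) *: h) d.

Lemma evT (p : dual) (h : H) y : ev (p ⊗ h) y = (p y : k) *: h.
Proof. by rewrite /ev lift2T //; lin. Qed.

(** An operator is recovered from its values on a basis, which gives the
    injectivity of ev. *)
Lemma ev_dec (d : D) : d = \sum_(i < \dim {:H}) (dual_basis i ⊗ ev d (vbasis {:H})`_i : D).
Proof.
move: d; apply: tensor_ext; rewrite /=; try by rewrite /ev; lin.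
move=> p h; under eq_bigr do rewrite evT.
have {1}-> : p = \sum_(i < \dim {:H}) p (vbasis {:H})`_i *: dual_basis i.
  apply/lfunP => y; rewrite dual_exp sum_lfunE; apply: eq_bigr => i _.
  by rewrite scale_lfunE dual_basisE mulrC.
by rewrite tens_suml; apply: eq_bigr => i _; rewrite tensZl tensZr.
Qed.

Lemma ev_inj (d d' : D) : (forall y, ev d y = ev d' y) -> d = d'.
Proof. by move=> e; rewrite (ev_dec d) (ev_dec d'); apply: eq_bigr => i _; rewrite e. Qed.

Lemma mulDT (p p' : dual) (h h' : H) :
  (p ⊗ h : D) ** (p' ⊗ h' : D) = sw3 h (fun a b c =>
     (dual_mul p (hitr (hitl a p') (S' c)) ⊗ (b ** h') : D)).
Proof. by rewrite /= lift2T; [rewrite lift2T; [rewrite lift2T; [|lin]|lin]|lin]. Qed.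

(** The multiplication of the double in terms of operators. The two actions of H on
    its dual become multiplications of the argument from both sides. *)
Lemma evM (d d' : D) y : ev (d ** d') y =
  sw2 y (fun y1 y2 => sw3 (ev d y1) (fun a b c => b ** ev d' (S' c ** y2 ** a))).
Proof.
move: d; apply: tensor_ext => [| |p h]; try by rewrite /ev; lin.
move: d'; apply: tensor_ext => [| |p' h']; try by rewrite /ev; lin.
rewrite mulDT /sw3 (@sw2_lin _ _ _ _ (fun z => ev z y)); last by rewrite /ev; lin.
transitivity (sw2 h (fun a x => sw2 x (fun b c => sw2 y (fun y1 y2 =>
    ((p y1 : k) * (p' (S' c ** y2 ** a) : k)) *: (b ** h'))))).
  apply: eq_sw2 => a x; rewrite (@sw2_lin _ _ _ _ (fun z => ev z y)); last by rewrite /ev; lin.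
  apply: eq_sw2 => b c; rewrite evT dual_mulE.
  rewrite (@sw2_lin _ _ _ _ (fun z : k^o => (z : k) *: (b ** h'))); last by lin.
  by apply: eq_sw2 => y1 y2; rewrite hitrE hitlE.
under eq_sw2 do rewrite sw2C; rewrite sw2C; apply: eq_sw2 => y1 y2.
rewrite evT sw2Z.
rewrite scale_sw2; apply: eq_sw2 => a x; rewrite scale_sw2.
by apply: eq_sw2 => b c; rewrite evT tensZr linearZ /= scalerA.
Qed.

(** Both bracketings evaluate to an expression in a coproduct of y and a fivefold
    coproduct of the value of d; they differ by how the latter is refined, which is
    the content of sw5_mid. *)
Lemma mulDA (d d' d'' : D) : d ** (d' ** d'') = (d ** d') ** d''.
Proof.
have A (X y2 y3 : H) (e' e'' : D) :
  sw3 X (fun a b c => sw3 b (fun b1 b2 b3 => sw3 (ev e' (S' c ** y2 ** a)) (fun z1 z2 z3 =>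
     (b2 ** z2) ** ev e'' (S' (b3 ** z3) ** y3 ** (b1 ** z1))))) =
  sw3 X (fun a b c => sw2 a (fun a1 a2 => sw2 c (fun c1 c2 =>
     sw3 (ev e' (S' c2 ** y2 ** a1)) (fun z1 z2 z3 =>
     (b ** z2) ** ev e'' (S' (c1 ** z3) ** y3 ** (a2 ** z1)))))).
  by apply: sw5_mid => //; rewrite /ev; lin.
apply: ev_inj => y; rewrite !evM.
transitivity (sw2 y (fun y1 w => sw2 w (fun y2 y3 => sw3 (ev d y1) (fun a b c =>
    sw2 a (fun a1 a2 => sw2 c (fun c1 c2 =>
     sw3 (ev d' (S' c2 ** y2 ** a1)) (fun z1 z2 z3 =>
     (b ** z2) ** ev d'' (S' (c1 ** z3) ** y3 ** (a2 ** z1))))))))).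
  apply: eq_sw2 => y1 w; rewrite sw23C; apply: eq_sw3 => a b c.
  rewrite evM (sw2M L); last by rewrite /ev; lin.
  rewrite (sw2M L); last by rewrite /ev; lin.
  rewrite (sw2V L); last by rewrite /ev; lin.
  rewrite sw2C (@sw2_lin _ _ _ _ (fun z => b ** z)); last by lin.
  apply: eq_sw2 => y2 y3; rewrite sw2C (@sw2_lin _ _ _ _ (fun z => b ** z)); last by lin.
  apply: eq_sw2 => a1 a2; rewrite (@sw2_lin _ _ _ _ (fun z => b ** z)); last by lin.
  apply: eq_sw2 => c1 c2; rewrite (@sw3_lin _ _ _ _ (fun z => b ** z)); last by lin.
  by apply: eq_sw3 => z1 z2 z3; rewrite (antipVM L) !(hmulA L).
rewrite -(coassoc L (f := fun y1 y2 y3 => sw3 (ev d y1) (fun a b c =>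
    sw2 a (fun a1 a2 => sw2 c (fun c1 c2 =>
     sw3 (ev d' (S' c2 ** y2 ** a1)) (fun z1 z2 z3 =>
     (b ** z2) ** ev d'' (S' (c1 ** z3) ** y3 ** (a2 ** z1)))))))); last by rewrite /ev; lin.
apply: eq_sw2 => y12 y3; rewrite evM.
rewrite (@sw2_lin _ _ _ _ (fun z => sw3 z _)); last by rewrite /ev; lin.
apply: eq_sw2 => y1 y2; rewrite -A.
rewrite (@sw3_lin _ _ _ _ (fun z => sw3 z _)); last by rewrite /ev; lin.
by apply: eq_sw3 => a b c; rewrite (sw3M L) //; rewrite /ev; lin.
Qed.

Lemma evpM (p : dual) (d : D) y :
  ev ((p ⊗ 1H : D) ** d) y = sw2 y (fun y1 y2 => (p y1 : k) *: ev d y2).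
Proof.
rewrite evM; apply: eq_sw2 => y1 y2; rewrite evT /sw3 sw2Z; congr (_ *: _).
rewrite -/(sw3 _ _) (sw3_1 L); last by rewrite /ev; lin.
by rewrite (hmul1l L) (hmul1r L) (antipV1 L) (hmul1l L).
Qed.

Lemma evhM (h : H) (d : D) y :
  ev ((eps ⊗ h : D) ** d) y = sw3 h (fun a b c => b ** ev d (S' c ** y ** a)).
Proof.
rewrite evM -[RHS](counitlF L (f := fun y => sw3 h (fun a b c => b ** ev d (S' c ** y ** a))));
  last by rewrite /ev; lin.
by apply: eq_sw2 => y1 y2; rewrite evT /sw3 sw2Z.
Qed.

Lemma evMh (d : D) (h : H) y : ev (d ** (eps ⊗ h : D)) y = ev d y ** h.
Proof.
rewrite evM -[RHS](counitrF L (f := fun y => ev d y ** h)); last by rewrite /ev; lin.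
apply: eq_sw2 => y1 y2.
rewrite -[in RHS](sw3_counit L (f := fun z => z ** h)); last by lin.
rewrite scale_sw3; apply: eq_sw3 => a b c.
rewrite evT tensZr linearZ /= !(counitM L) (counitV L) scalerA; congr (_ *: _); ring.
Qed.

Lemma mulHp (p : dual) (h : H) : (p ⊗ 1H : D) ** (eps ⊗ h : D) = (p ⊗ h : D).
Proof. by apply: ev_inj => y; rewrite evMh !evT tensZl linearZ /= (hmul1l L). Qed.

Lemma mulD1 (d : D) : alg_one D ** d = d.
Proof.
apply: ev_inj => y; rewrite (evpM eps) (counitlF L (f := fun y => ev d y)) //.
by rewrite /ev; lin.
Qed.

Lemma mul1D (d : D) : d ** alg_one D = d.
Proof. by apply: ev_inj => y; rewrite evMh (hmul1r L). Qed.

Lemma mulHH (h h' : H) : (eps ⊗ h : D) ** (eps ⊗ h' : D) = (eps ⊗ (h ** h') : D).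
Proof. by apply: ev_inj => y; rewrite evMh !evT tensZl linearZ. Qed.

Lemma mulpp (p p' : dual) : (p ⊗ 1H : D) ** (p' ⊗ 1H : D) = (dual_mul p p' ⊗ 1H : D).
Proof.
apply: ev_inj => y; rewrite evpM !evT dual_mulE (@sw2_lin _ _ _ _ (fun z : k^o => (z : k) *: 1H)); last by lin.
by apply: eq_sw2 => a b; rewrite evT scalerA.
Qed.

Lemma antipDT (p : dual) (h : H) :
  antip (p ⊗ h : D) = (eps ⊗ S h : D) ** ((p \o S')%VF ⊗ 1H : D).
Proof.
have E : antip (p : dual_cop H) = (p \o S')%VF by rewrite /= linfunK //; lin.
by rewrite -E /= lift2T; last by lin.
Qed.

Lemma ev_antipT (p : dual) (h : H) y : ev (antip (p ⊗ h : D)) y =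
  sw3 h (fun a b c => (p (c ** S' y ** S' a) : k) *: S b).
Proof.
rewrite antipDT evhM (sw3S L); last by rewrite /ev; lin.
apply: eq_sw3 => a b c; rewrite evT tensZr linearZ /= (hmul1r L) comp_lfunE.
by rewrite !(antipVM L) !(antipK L) (hmulA L).
Qed.

Lemma ev_antip (d : D) y : ev (antip d) y = \sum_(i < \dim {:H})
  sw3 (ev d (vbasis {:H})`_i) (fun a b c => coord (vbasis {:H}) i (c ** S' y ** S' a) *: S b).
Proof.
rewrite {1}(ev_dec d) linear_sum (@islin_sum _ _ _ (fun z => ev z y)); last by rewrite /ev; lin.
by apply: eq_bigr => i _; rewrite ev_antipT; apply: eq_sw3 => a b c; rewrite dual_basisE.
Qed.

(** The antipode of H occurs twice on each side of the argument, and the antipode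
    axioms cancel the outer factors of the two nested coproducts. What remains is
    conjugation of the operator by the square of the antipode of H. *)
Lemma ev_antip2 (d : D) y : ev (antip (antip d)) y = S (S (ev d (S' (S' y)))).
Proof.
move: d; apply: tensor_ext => [| |p h]; try by rewrite /ev; lin.
rewrite ev_antip evT linearZ linearZ /=.
transitivity (sw3 h (fun a' b' c' => sw3 b' (fun a b c =>
   (p (c' ** S' (S a ** S' y ** c) ** S' a') : k) *: S (S b)))).
  have E (i : 'I_(\dim {:H})) : sw3 (ev (antip (p ⊗ h : D)) (vbasis {:H})`_i)
      (fun a b c => coord (vbasis {:H}) i (c ** S' y ** S' a) *: S b) =
    sw3 h (fun a' b' c' => sw3 b' (fun a b c =>
      coord (vbasis {:H}) i (S a ** S' y ** c) *:
        ((p (c' ** S' (vbasis {:H})`_i ** S' a') : k) *: S (S b)))).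
    rewrite ev_antipT (@sw3_lin _ _ _ _ (fun z => sw3 z _)); last by lin.
    apply: eq_sw3 => a' b' c'; rewrite sw3Z (sw3S L); last by lin.
    rewrite scale_sw3; apply: eq_sw3 => a b c.
    by rewrite !(antipK L) !scalerA mulrC.
  rewrite (eq_bigr _ (fun i _ => E i)) sum_sw3; apply: eq_sw3 => a' b' c'.
  rewrite sum_sw3; apply: eq_sw3 => a b c.
  by rewrite -(dual_coord _ (F := fun e => (p (c' ** S' e ** S' a') : k) *: S (S b))); last by lin.
rewrite (sw5_mid L (F := fun a' a b c c' => (p (c' ** S' (S a ** S' y ** c) ** S' a') : k) *: S (S b)));
  try by lin.
rewrite -(sw3_counit L (f := fun b => (p (S' (S' y)) : k) *: S (S b))); last by lin.
apply: eq_sw3 => a b c.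
transitivity (sw2 a (fun a1 a2 => (counit c : k) *: ((p (S' (S' y) ** (a2 ** S' a1)) : k) *: S (S b)))).
  apply: eq_sw2 => a1 a2.
  rewrite -[S' (S' y) ** _](hmul1l L) (hmulA L).
  rewrite -(antipVRF L (f := fun z => (p (z ** S' (S' y) ** (a2 ** S' a1)) : k) *: S (S b))); last by lin.
  by apply: eq_sw2 => c1 c2; rewrite !(antipVM L) (antipK L) !(hmulA L).
rewrite -scale_sw2 mulrC -scalerA; congr (_ *: _).
apply: etrans (antipVRF L (f := fun z => (p (S' (S' y) ** z) : k) *: S (S b)) _ _) _; first by lin.
by rewrite (hmul1r L).
Qed.
End DoubleMul.

Section AlgSums.
Variables (k : fieldType) (A : alg k).
Lemma mul_suml (I : Type) (s : seq I) P (f : I -> A) (b : A) :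
  (\sum_(i <- s | P i) f i) ** b = \sum_(i <- s | P i) (f i ** b).
Proof. by apply: (@islin_sum _ _ _ (fun z => z ** b)); lin. Qed.
Lemma mul_sumr (I : Type) (s : seq I) P (f : I -> A) (b : A) :
  b ** (\sum_(i <- s | P i) f i) = \sum_(i <- s | P i) (b ** f i).
Proof. by apply: (@islin_sum _ _ _ (fun z => b ** z)); lin. Qed.
Lemma mulZl a (x y : A) : (a *: x) ** y = a *: (x ** y).
Proof. by apply: (@islinZ _ _ _ (fun z => z ** y)); lin. Qed.
Lemma mulZr a (x y : A) : x ** (a *: y) = a *: (x ** y).
Proof. by apply: (@islinZ _ _ _ (fun z => x ** z)); lin. Qed.
End AlgSums.

(** * Inverses in finite-dimensional algebras *)

Section FiniteInverse.
Variables (k : fieldType).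
Implicit Types (U V W : vectType k).

Lemma surj_lker0 V (f : 'End(V)) : (forall w, exists v, f v = w) -> lker f == 0%VS.
Proof.
move=> sf; have F : limg f = fullv.
  by apply/eqP; rewrite eqEsubv subvf /=; apply/subvP => w _; have [v <-] := sf w; exact: memv_img (memvf v).
have := limg_ker_dim f fullv; rewrite F capfv -dimv_eq0; lia.
Qed.

Variable A : alg k.
Hypothesis mA : forall a b c : A, a ** (b ** c) = (a ** b) ** c.
Hypothesis ml : forall a : A, alg_one A ** a = a.
Hypothesis mr : forall a : A, a ** alg_one A = a.

Lemma lmulE (a b : A) : lmul a b = a ** b.
Proof. by rewrite linfunK //; lin. Qed.

Lemma alg_invR (a b : A) : a ** b = alg_one A -> a ** alg_inv a = alg_one A.
Proof.
move=> ab; rewrite -lmulE /alg_inv limg_lfunVK // -ab -lmulE.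
exact: memv_img (memvf b).
Qed.

(** A one-sided inverse is two-sided: left multiplication by a is surjective, because
    a (b w) = w, hence injective by finite dimension, and a (b a) = a = a 1. *)
Lemma alg_invC (a b : A) : a ** b = alg_one A -> b ** a = alg_one A.
Proof.
move=> ab; have K : lker (lmul a) == 0%VS.
  by apply: surj_lker0 => w; exists (b ** w); rewrite lmulE mA ab ml.
have/lker0P I := K; apply: I; by rewrite !lmulE mA ab ml mr.
Qed.

Lemma alg_invL (a b : A) : a ** b = alg_one A -> alg_inv a ** a = alg_one A.
Proof. by move=> ab; apply: alg_invC; apply: alg_invR ab. Qed.

End FiniteInverse.

Section TensorAlg.
Variables (k : fieldType) (A B : alg k).
Local Notation T := (tensor_alg A B).

Lemma mulTT (a a' : A) (b b' : B) :
  (a ⊗ b : T) ** (a' ⊗ b' : T) = ((a ** a') ⊗ (b ** b') : T).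
Proof.
rewrite /= lift2T; last by lin.
rewrite lift2T; last by lin.
by rewrite lift2T; last by lin.
Qed.

Hypothesis mA : forall a b c : A, a ** (b ** c) = (a ** b) ** c.
Hypothesis ml : forall a : A, alg_one A ** a = a.
Hypothesis mr : forall a : A, a ** alg_one A = a.
Hypothesis mB : forall a b c : B, a ** (b ** c) = (a ** b) ** c.
Hypothesis mBl : forall a : B, alg_one B ** a = a.
Hypothesis mBr : forall a : B, a ** alg_one B = a.

Lemma mulTA (a b c : T) : a ** (b ** c) = (a ** b) ** c.
Proof.
move: a; apply: tensor_ext => [| |x y]; try by lin.
move: b; apply: tensor_ext => [| |x' y']; try by lin.
move: c; apply: tensor_ext => [| |x'' y'']; try by lin.
by rewrite !mulTT mA mB.
Qed.
Lemma mulT1 (a : T) : alg_one T ** a = a.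
Proof.
by move: a; apply: tensor_ext => [| |x y]; try (by lin); rewrite mulTT ml mBl.
Qed.
Lemma mul1T (a : T) : a ** alg_one T = a.
Proof.
by move: a; apply: tensor_ext => [| |x y]; try (by lin); rewrite mulTT mr mBr.
Qed.
End TensorAlg.

Lemma tflipT (k : fieldType) (V W : vectType k) (v : V) (w : W) : tflip V W (v ⊗ w) = w ⊗ v.
Proof. by rewrite /tflip lift2T; last by lin. Qed.

Lemma tflipM (k : fieldType) (A : alg k) (s t : tensor_alg A A) :
  (tflip A A (s ** t) : tensor_alg A A) =
  (tflip A A s : tensor_alg A A) ** (tflip A A t : tensor_alg A A).
Proof.
move: s; apply: tensor_ext => [| |x y]; try by lin.
move: t; apply: tensor_ext => [| |x' y']; try by lin.
by rewrite mulTT !tflipT mulTT.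
Qed.

(** * The antipode, the element u and the R-matrix of the double *)

Section DoubleU.
Variables (k : fieldType) (H : hopf k).
Hypothesis L : hopf_laws H.
Local Notation D := (drinfeld_double H).
Local Notation dual := (ldual H).
Local Notation S' := (antipV H).
Local Notation S := (@antip _ H).
Local Notation "1H" := (alg_one H).
Local Notation eps := (@counit _ H).

Lemma antipDp (p : dual) : antip (p ⊗ 1H : D) = ((p \o S')%VF ⊗ 1H : D).
Proof. by rewrite antipDT (antip_1 L) (mulD1 L). Qed.

Lemma antipDh (h : H) : antip (eps ⊗ h : D) = (eps ⊗ S h : D).
Proof.
rewrite antipDT; have -> : (eps \o S')%VF = eps.
  by apply/lfunP => y; rewrite comp_lfunE (counitV L).
by rewrite (mul1D L).
Qed.

(** The antipode is defined on products p h. For a product in the opposite order,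
    write h p as the antipode of such a product and use the formula for the square
    of the antipode. *)
Lemma antipDhp (p : dual) (h : H) :
  antip ((eps ⊗ h : D) ** (p ⊗ 1H : D)) = ((p \o S')%VF ⊗ 1H : D) ** (eps ⊗ S h : D).
Proof.
have -> : (eps ⊗ h : D) ** (p ⊗ 1H : D) = antip ((p \o S)%VF ⊗ S' h : D).
  rewrite antipDT (antipVK L); suff -> : ((p \o S) \o S')%VF = p by [].
  by apply/lfunP => y; rewrite !comp_lfunE (antipVK L).
apply: ev_inj => y; rewrite (ev_antip2 L) (mulHp L) !evT !comp_lfunE.
by rewrite !(antipVK L) !linearZ /= (antipVK L).
Qed.

Lemma antipDphp (p : dual) (d : D) (h : H) :
  antip ((p ⊗ 1H : D) ** d ** (eps ⊗ h : D)) =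
  (eps ⊗ S h : D) ** antip d ** ((p \o S')%VF ⊗ 1H : D).
Proof.
move: d; apply: tensor_ext => [| |p' h']; try by lin.
have -> : (p ⊗ 1H : D) ** (p' ⊗ h' : D) ** (eps ⊗ h : D) =
          (dual_mul p p' ⊗ (h' ** h) : D).
  by rewrite -(mulHp L p' h') (mulDA L) (mulpp L) -(mulDA L) (mulHH L) (mulHp L).
rewrite !antipDT (antipM L) -(mulHH L) -!(mulDA L) (mulpp L).
have -> : (dual_mul p p' \o S')%VF = dual_mul (p' \o S')%VF (p \o S')%VF.
  apply/lfunP => y; rewrite comp_lfunE !dual_mulE (sw2V L); last by lin.
  by apply: eq_sw2 => a b; rewrite !comp_lfunE mulrC.
by [].
Qed.

(** The double is spanned by products of elements of the two Hopf subalgebras, so the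
    only case that is not formal is the product h p, settled by antipDhp. *)
Lemma antipDM (d d' : D) : antip (d ** d') = antip d' ** antip d.
Proof.
move: d; apply: tensor_ext => [| |p h]; try by lin.
move: d'; apply: tensor_ext => [| |p' h']; try by lin.
have -> : (p ⊗ h : D) ** (p' ⊗ h' : D) =
   (p ⊗ 1H : D) ** ((eps ⊗ h : D) ** (p' ⊗ 1H : D)) ** (eps ⊗ h' : D).
  by rewrite -(mulHp L p h) -(mulHp L p' h') !(mulDA L).
by rewrite antipDphp antipDhp !antipDT !(mulDA L).
Qed.

Lemma antipD_inj : injective (@antip _ D).
Proof.
move=> d d' e; apply: ev_inj => y.
have E : ev (antip (antip d)) (S (S y)) = ev (antip (antip d')) (S (S y)) by rewrite e.
move: E; rewrite !(ev_antip2 L) !(antipK L) => E.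
by apply: (can_inj (antipK L)); apply: (can_inj (antipK L)).
Qed.

Lemma antipDK : cancel (@antip _ D) (antipV D).
Proof. by apply: lker0_lfunK; apply/lker0P; exact: antipD_inj. Qed.

Lemma antipDVK : cancel (antipV D) (@antip _ D).
Proof. by apply: lker0_lfunVK; apply/lker0P; exact: antipD_inj. Qed.

Local Notation R := (double_R H).
Local Notation u := (drinfeld_u R).

(** As an operator, u is the inverse antipode of H. This makes every computation
    with u one in H alone. *)
Lemma ev_u y : ev u y = S' y.
Proof.
rewrite /drinfeld_u /double_R linear_sum /= (@islin_sum _ _ _ (fun z : D => ev z y)); last by rewrite /ev; lin.
rewrite [RHS](dual_coord _ (F := id)) //; apply: eq_bigr => i _.
rewrite lift2T; last by lin.
by rewrite antipDp (mulHp L) evT comp_lfunE dual_basisE.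
Qed.

Lemma ev_um d y : ev (u ** d) y = sw2 y (fun a b => S' b ** ev d (S' (S' a))).
Proof.
rewrite evM.
transitivity (sw2 y (fun y1 y2 => sw3 y1 (fun a b c =>
   S' b ** ev d (S' (S' a) ** y2 ** S' c)))).
  by apply: eq_sw2 => y1 y2; rewrite ev_u (sw3V L); last by rewrite /ev; lin.
rewrite /sw3 (coassoc L (f := fun a x y2 => sw2 x (fun b c =>
   S' b ** ev d (S' (S' a) ** y2 ** S' c)))); last by rewrite /ev; lin.
apply: eq_sw2 => a z.
rewrite (coassoc L (f := fun b c y2 => S' b ** ev d (S' (S' a) ** y2 ** S' c)));
  last by rewrite /ev; lin.
rewrite -(counitrF L (f := fun b => S' b ** ev d (S' (S' a)))); last by lin.
apply: eq_sw2 => b t.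
apply: etrans (_ : sw2 t (fun c y2 => S' b ** ev d (S' (S' a) ** (y2 ** S' c))) = _).
  by apply: eq_sw2 => c y2; rewrite (hmulA L).
apply: etrans (antipVRF L (f := fun z => S' b ** ev d (S' (S' a) ** z)) _ _) _.
  by rewrite /ev; lin.
by rewrite (hmul1r L).
Qed.

Lemma ev_mu d y : ev (d ** u) y = sw2 y (fun a b => S' b ** S' (S' (ev d a))).
Proof.
rewrite evM; apply: eq_sw2 => y1 y2.
transitivity (sw3 (ev d y1) (fun a b c => (b ** S' a) ** (S' y2 ** S' (S' c)))).
  by apply: eq_sw3 => a b c; rewrite ev_u !(antipVM L) !(hmulA L).
rewrite /sw3 -(coassoc L (f := fun a b c => (b ** S' a) ** (S' y2 ** S' (S' c)))); last by lin.
rewrite -(counitlF L (f := fun c => S' y2 ** S' (S' c))); last by lin.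
apply: eq_sw2 => x c.
apply: etrans (antipVRF L (f := fun z => z ** (S' y2 ** S' (S' c))) _ _) _; first by lin.
by rewrite (hmul1l L).
Qed.

(** Conjugation by u is the square of the antipode: by ev_um, ev_mu and ev_antip2 both
    sides are the same operator. *)
Lemma u_antip2 (d : D) : u ** d = antip (antip d) ** u.
Proof.
apply: ev_inj => y; rewrite ev_um ev_mu; apply: eq_sw2 => a b.
by rewrite (ev_antip2 L) !(antipK L).
Qed.

(** The element of the double whose operator is the square of the antipode of H. *)
Definition u_inv : D := \sum_(i < \dim {:H}) (dual_basis i ⊗ S (S (vbasis {:H})`_i) : D).

Lemma ev_uinv y : ev u_inv y = S (S y).
Proof.
rewrite /u_inv (@islin_sum _ _ _ (fun z : D => ev z y)); last by rewrite /ev; lin.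
rewrite [RHS](dual_coord _ (F := fun y => S (S y))); last by lin.
by apply: eq_bigr => i _; rewrite evT dual_basisE.
Qed.

Lemma u_uinv : u ** u_inv = alg_one D.
Proof.
apply: ev_inj => y; rewrite ev_um evT -(antipVL L).
by apply: eq_sw2 => a b; rewrite ev_uinv !(antipVK L).
Qed.

Definition R_inv0 : tensor D D := \sum_(i < \dim {:H})
  ((eps ⊗ S (vbasis {:H})`_i : D) ⊗ (dual_basis i ⊗ 1H : D)).

(** In coordinates the product is a double sum over basis vectors of H and products
    of dual basis vectors; expanding the latter recombines the sum to the right
    antipode axiom. *)
Lemma RRinv : (R : tensor_alg D D) ** (R_inv0 : tensor_alg D D) = alg_one (tensor_alg D D).
Proof.
pose e := (vbasis {:H}).
transitivity (\sum_(m < \dim {:H}) (eps e`_m : k) *: ((eps ⊗ 1H : D) ⊗ (dual_basis m ⊗ 1H : D)));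
  last first.
  under eq_bigr do rewrite -tensZr -tensZl.
  rewrite -tens_sumr -tens_suml; congr (_ ⊗ (_ ⊗ _)).
  apply/lfunP => y; rewrite [eps y]dual_exp sum_lfunE; apply: eq_bigr => m _.
  by rewrite scale_lfunE dual_basisE mulrC.
rewrite /double_R /R_inv0 (mul_suml (A := tensor_alg D D)).
transitivity (\sum_(i < \dim {:H}) \sum_(j < \dim {:H}) \sum_(m < \dim {:H})
     (dual_mul (dual_basis i) (dual_basis j) e`_m : k) *:
     ((eps ⊗ (e`_i ** S e`_j) : D) ⊗ (dual_basis m ⊗ 1H : D))).
  apply: eq_bigr => i _; rewrite (mul_sumr (A := tensor_alg D D)); apply: eq_bigr => j _.
  rewrite (mulTT (A := D) (B := D)) (mulHH L) (mulpp L).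
  have {1}-> : dual_mul (dual_basis i) (dual_basis j) = \sum_(m < \dim {:H})
        (dual_mul (dual_basis i) (dual_basis j) e`_m : k) *: dual_basis m.
    apply/lfunP => y; rewrite dual_exp sum_lfunE; apply: eq_bigr => m _.
    by rewrite scale_lfunE dual_basisE mulrC.
  by rewrite tens_suml tens_sumr; apply: eq_bigr => m _; rewrite tensZl tensZr.
under eq_bigr do rewrite exchange_big; rewrite exchange_big; apply: eq_bigr => m _ /=.
have -> : (eps e`_m : k) *: ((eps ⊗ 1H : D) ⊗ (dual_basis m ⊗ 1H : D)) =
   ((eps ⊗ ((eps e`_m : k) *: 1H) : D) ⊗ (dual_basis m ⊗ 1H : D)).
  by rewrite -tensZl -tensZr.
rewrite -(antipR L) (@sw2_lin _ _ _ _ (fun z => (eps ⊗ z : D) ⊗ (dual_basis m ⊗ 1H : D))); last by lin.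
transitivity (sw2 e`_m (fun a b => \sum_(i < \dim {:H}) \sum_(j < \dim {:H})
   (coord e i a * coord e j b) *: ((eps ⊗ (e`_i ** S e`_j) : D) ⊗ (dual_basis m ⊗ 1H : D)))).
  rewrite -sum_sw2; apply: eq_bigr => i _; rewrite -sum_sw2; apply: eq_bigr => j _.
  rewrite dual_mulE (@sw2_lin _ _ _ _ (fun z : k^o => (z : k) *: _)); last by lin.
  by apply: eq_sw2 => a b; rewrite !dual_basisE.
apply: eq_sw2 => a b.
rewrite (dual_coord a (F := fun a => (eps ⊗ (a ** S b) : D) ⊗ (dual_basis m ⊗ 1H : D))); last by lin.
apply: eq_bigr => i _.
rewrite (dual_coord b (F := fun b => (eps ⊗ (_ ** S b) : D) ⊗ (dual_basis m ⊗ 1H : D))); last by lin.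
by rewrite scaler_sumr; apply: eq_bigr => j _; rewrite scalerA.
Qed.
End DoubleU.

(** * The Yetter-Drinfeld action *)

Section YetterDrinfeld.
Variables (k : fieldType) (H : hopf k).
Implicit Types (U V W : vectType k).
Local Notation D := (drinfeld_double H).
Local Notation dual := (ldual H).
Local Notation S' := (antipV H).
Local Notation "1H" := (alg_one H).

Definition is_char (chi : dual) :=
  chi 1H = 1 /\ forall a b : H, chi (a ** b) = chi a * chi b.

Definition grouplike (g : H) := comul g = g ⊗ g /\ counit g = 1.

Lemma hit_chiE (chi : dual) h : hit_chi chi h = sw2 h (fun a b => (chi a : k) *: b).
Proof. by []. Qed.
Lemma bulletE (chi : dual) h m :
  bullet chi h m = sw2 h (fun a b => hit_chi chi b ** m ** S' a).
Proof. by []. Qed.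
Lemma dual_actE (p : dual) m : dual_act p m = sw2 m (fun a b => (p b : k) *: a).
Proof. by []. Qed.

Lemma lin_hit V chi (f : V -> H) : islin f -> islin (fun x => hit_chi chi (f x)).
Proof. by move=> fl; rewrite /hit_chi; lin. Qed.
Lemma lin_bulletl V chi (f : V -> H) (m : H) : islin f -> islin (fun x => bullet chi (f x) m).
Proof. by move=> fl; rewrite /bullet; lin. Qed.
Lemma lin_bulletr V chi (f : V -> H) (h : H) : islin f -> islin (fun x => bullet chi h (f x)).
Proof. by move=> fl; rewrite /bullet; lin. Qed.
Lemma lin_dual_act V (p : dual) (f : V -> H) : islin f -> islin (fun x => dual_act p (f x)).
Proof. by move=> fl; rewrite /dual_act; lin. Qed.

Lemma lin_dual_actp V (m : H) (f : V -> dual) : islin f -> islin (fun x => dual_act (f x) m).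
Proof. by move=> fl; rewrite /dual_act; lin. Qed.
Lemma lin_yd V chi (f : V -> D) : islin f -> islin (fun x => yd_act chi (f x)).
Proof. by move=> fl; rewrite /yd_act; lin. Qed.
End YetterDrinfeld.

Opaque hit_chi bullet dual_act.

Ltac lin_hook ::= first [lin_dual |
  lazymatch goal with
  | |- islin (fun x => yd_act _ (@?f x)) => refine (@lin_yd _ _ _ _ f _); lin
  | |- islin (fun x => hit_chi _ (@?f x)) => refine (@lin_hit _ _ _ _ f _); lin
  | |- islin (fun x => bullet _ (@?h x) (@?f x)) =>
      (tryif is_const h then refine (@lin_bulletr _ _ _ _ f _ _) else refine (@lin_bulletl _ _ _ _ h _ _)); lin
  | |- islin (fun x => dual_act (@?h x) (@?f x)) =>
      (tryif is_const h then refine (@lin_dual_act _ _ _ _ f _) else refine (@lin_dual_actp _ _ _ _ h _)); lin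
  end].

Section YetterDrinfeldModule.
Variables (k : fieldType) (H : hopf k).
Hypothesis L : hopf_laws H.
Implicit Types (U V W : vectType k).
Local Notation D := (drinfeld_double H).
Local Notation dual := (ldual H).
Local Notation S' := (antipV H).
Local Notation S := (@antip _ H).
Local Notation "1H" := (alg_one H).
Local Notation eps := (@counit _ H).
Local Notation R := (double_R H).

Lemma rhoT (chi p : dual) (h m : H) :
  yd_act chi (p ⊗ h : D) m = dual_act p (bullet chi h m).
Proof.
have Hl q h' : islin (fun m => dual_act q (bullet chi h' m)) by lin.
rewrite /yd_act lift2T; first by rewrite linfunK.
by split=> [h' | p'] a x y; apply/lfunP => z; rewrite add_lfunE scale_lfunE !linfunK //;
  [have -> : islin (fun q => dual_act q (bullet chi h' z)) by lin
  |have -> : islin (fun h'' => dual_act p' (bullet chi h'' z)) by lin].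
Qed.

Lemma dual_act_eps m : dual_act (eps : dual) m = m.
Proof. exact: (counitr L). Qed.

Lemma dual_actM (p p' : dual) m : dual_act (dual_mul p p') m = dual_act p (dual_act p' m).
Proof.
rewrite !dual_actE [in RHS](@sw2_lin _ _ _ _ (fun z => sw2 z _)); last by lin.
transitivity (sw2 m (fun a b => sw2 b (fun c d => ((p c : k) * (p' d : k)) *: a))).
  apply: eq_sw2 => a b; rewrite dual_mulE (@sw2_lin _ _ _ _ (fun z : k^o => (z : k) *: a)) //; lin.
rewrite -(coassoc L (f := fun a c d => ((p c : k) * (p' d : k)) *: a)); last first.
  by split=> *; [lin| |]; move=> z x y; rewrite linearP /= ?mulrDl ?mulrDr scalerDl !scalerA; 
     congr (_ *: _ + _); rewrite /GRing.scale /=; ring.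
apply: eq_sw2 => a b; rewrite sw2Z scale_sw2; apply: eq_sw2 => c d.
by rewrite scalerA mulrC.
Qed.

Lemma counit_dual_act (p : dual) x : counit (dual_act p x) = p x.
Proof.
rewrite dual_actE (@sw2_lin _ _ _ _ (fun z => counit z)); last by lin.
rewrite -[in RHS](counitl L x) (@sw2_lin _ _ _ _ (fun z => p z)); last by lin.
by apply: eq_sw2 => a b; rewrite !linearZ /= /GRing.scale /= mulrC.
Qed.

Section OneChar.
Variable chi : dual.
Hypothesis chiP : is_char chi.
Local Notation Th := (hit_chi chi).
Local Notation rho := (yd_act chi).

Lemma hit_chiM h h' : Th (h ** h') = Th h ** Th h'.
Proof.
rewrite !hit_chiE (sw2M L); last by lin.
rewrite (@sw2_lin _ _ _ _ (fun z => z ** _)); last by lin.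
apply: eq_sw2 => a b; rewrite (@sw2_lin _ _ _ _ (fun z => _ ** z)); last by lin.
by apply: eq_sw2 => c d; rewrite mulZl mulZr scalerA (proj2 chiP).
Qed.

Lemma hit_chi1 : Th 1H = 1H.
Proof. by rewrite hit_chiE (sw2_1 L); [rewrite (proj1 chiP) scale1r | lin]. Qed.

Lemma sw2_hit U (f : H -> H -> U) : bilin f -> forall h,
  sw2 (Th h) f = sw2 h (fun a b => f (Th a) b).
Proof.
move=> fl h; rewrite hit_chiE (@sw2_lin _ _ _ _ (fun z => sw2 z f)); last by lin.
transitivity (sw2 h (fun a b => sw2 b (fun c d => (chi a : k) *: f c d))).
  by apply: eq_sw2 => a b; rewrite sw2Z scale_sw2.
rewrite -(coassoc L (f := fun a c d => (chi a : k) *: f c d)); last by lin.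
apply: eq_sw2 => a b; rewrite hit_chiE (@sw2_lin _ _ _ _ (fun z => f z b)); last by lin.
by apply: eq_sw2 => c d; rewrite (@islinZ _ _ _ (fun z => f z b)) //; lin.
Qed.

Lemma bulletM h h' m : bullet chi (h ** h') m = bullet chi h (bullet chi h' m).
Proof.
rewrite !bulletE (sw2M L); last by lin.
apply: eq_sw2 => a b; rewrite (@sw2_lin _ _ _ _ (fun z => Th b ** z ** S' a)); last by lin.
by apply: eq_sw2 => c d; rewrite hit_chiM (antipVM L) !(hmulA L).
Qed.

Lemma bullet1 m : bullet chi 1H m = m.
Proof.
rewrite bulletE (sw2_1 L); last by lin.
by rewrite hit_chi1 (antipV1 L) (hmul1l L) (hmul1r L).
Qed.

(** The compatibility of the action of H with the coaction: only the middle factor of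
    h acts on the first leg of the coproduct of m, the outer ones multiply the second
    leg. *)
Lemma sw2_bullet U (f : H -> H -> U) : bilin f -> forall h m,
  sw2 (bullet chi h m) f = sw3 h (fun a b c => sw2 m (fun m0 m1 =>
    f (bullet chi b m0) (c ** m1 ** S' a))).
Proof.
move=> fl h m; rewrite bulletE (@sw2_lin _ _ _ _ (fun z => sw2 z f)); last by lin.
transitivity (sw2 h (fun a x => sw2 x (fun b y => sw2 y (fun c d => sw2 m (fun m0 m1 =>
  f (Th c ** m0 ** S' b) (d ** m1 ** S' a)))))).
  rewrite -(coassoc L (f := fun a b y => sw2 y (fun c d => sw2 m (fun m0 m1 =>
    f (Th c ** m0 ** S' b) (d ** m1 ** S' a))))); last by lin.
  apply: eq_sw2 => x y; rewrite (sw2M L); last by lin.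
  rewrite (sw2M L); last by lin.
  rewrite sw2_hit; last by lin.
  rewrite [RHS]sw2C; apply: eq_sw2 => c d; rewrite [RHS]sw2C; apply: eq_sw2 => m0 m1.
  by rewrite (sw2V L); last by lin.
apply: eq_sw2 => a x.
rewrite -(coassoc L (f := fun b c d => sw2 m (fun m0 m1 =>
  f (Th c ** m0 ** S' b) (d ** m1 ** S' a)))); last by lin.
apply: eq_sw2 => y d; rewrite sw2C; apply: eq_sw2 => m0 m1.
rewrite bulletE (@sw2_lin _ _ _ _ (fun z => f z _)) //; lin.
Qed.

(** After moving h past p' by the compatibility sw2_bullet, the factors of h that act
    on p' from the two sides meet those produced by the coaction and cancel by the
    antipode axiom; hence the action of H and the coaction combine to an action of
    the double. *)
Lemma rhoM (d d' : D) m : rho (d ** d') m = rho d (rho d' m).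
Proof.
have lr (e : D) : islin (fun z => rho e z) by lin.
move: d; apply: tensor_ext => [| |p h]; try by rewrite /yd_act; lin.
move: d'; apply: tensor_ext => [| |p' h']; try by rewrite /yd_act; lin.
rewrite mulDT (@sw3_lin _ _ _ _ (fun z => rho z m)); last by rewrite /yd_act; lin.
rewrite !rhoT; set m' := bullet chi h' m.
transitivity (dual_act p (sw3 h (fun a b c => dual_act (hitr (hitl a p') (S' c)) (bullet chi b m')))).
  rewrite (@sw3_lin _ _ _ _ (fun z => dual_act p z)); last by lin.
  by apply: eq_sw3 => a b c; rewrite rhoT dual_actM bulletM.
congr (dual_act p _).
transitivity (sw3 h (fun a b c => sw3 b (fun b1 b2 b3 => sw2 m' (fun m0 m1 =>
   (p' (S' c ** (b3 ** m1 ** S' b1) ** a) : k) *: bullet chi b2 m0)))).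
  apply: eq_sw3 => a b c; rewrite dual_actE sw2_bullet; last by lin.
  by apply: eq_sw3 => b1 b2 b3; apply: eq_sw2 => m0 m1; rewrite hitrE hitlE.
rewrite (sw5_mid L (F := fun a b1 b2 b3 c => sw2 m' (fun m0 m1 =>
   (p' (S' c ** (b3 ** m1 ** S' b1) ** a) : k) *: bullet chi b2 m0))); try by lin.
rewrite -(sw3_counit L (f := fun b => bullet chi b (dual_act p' m'))); last by lin.
apply: eq_sw3 => a b c.
rewrite dual_actE (@sw2_lin _ _ _ _ (fun z => bullet chi b z)); last by lin.
rewrite scale_sw2.
under eq_sw2 do rewrite sw2C; rewrite sw2C; apply: eq_sw2 => m0 m1.
transitivity (sw2 a (fun a1 a2 => (eps c : k) *:
   ((p' (m1 ** (S' a2 ** a1)) : k) *: bullet chi b m0))).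
  apply: eq_sw2 => a1 a2; rewrite -[m1 ** _](hmul1l L).
  rewrite -(antipVLF L (f := fun z => (p' (z ** (m1 ** (S' a2 ** a1))) : k) *: bullet chi b m0)); last by lin.
  by apply: eq_sw2 => c1 c2; rewrite !(hmulA L).
rewrite -scale_sw2 mulrC -scalerA; congr (_ *: _).
apply: etrans (antipVLF L (f := fun z => (p' (m1 ** z) : k) *: bullet chi b m0) _ _) _; first by lin.
by rewrite (hmul1r L) (@islinZ _ _ _ (fun z => bullet chi b z)); last by lin.
Qed.

Lemma rho1 m : rho (alg_one D) m = m.
Proof. by rewrite rhoT dual_act_eps bullet1. Qed.

Lemma rho_h h m : rho (eps ⊗ h : D) m = bullet chi h m.
Proof. by rewrite rhoT dual_act_eps. Qed.

Lemma rho_p p m : rho (p ⊗ 1H : D) m = dual_act p m.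
Proof. by rewrite rhoT bullet1. Qed.

Lemma counit_rhoT (p : dual) h m : counit (rho (p ⊗ h : D) m) = p (bullet chi h m).
Proof. by rewrite rhoT counit_dual_act. Qed.

Lemma sep_dual (x y : H) : (forall p : dual, p x = p y) -> x = y.
Proof.
move=> e; rewrite (dual_coord x (F := id)) // (dual_coord y (F := id)) //.
by apply: eq_bigr => i _; rewrite -!dual_basisE e.
Qed.

(** A functional p acts on the group-like vector g by the scalar p(g), and a central v
    commutes with this action. Applying the counit shows that p(v g) is p(g) times a
    scalar independent of p. *)
Lemma central_grouplike (v : D) g : grouplike g -> (forall a, v ** a = a ** v) ->
  rho v g = (counit (rho v g) : k) *: g.
Proof.
move=> [Dg eg] cv; apply: sep_dual => p.
have E : dual_act p (rho v g) = (p g : k) *: rho v g.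
  rewrite -rho_p -rhoM -cv rhoM rho_p dual_actE /sw2 Dg lift2T; last by lin.
  by rewrite linearZ.
by rewrite -counit_dual_act E !linearZ /= /GRing.scale /= mulrC.
Qed.

Lemma grouplike_inv g : grouplike g -> g ** S' g = 1H /\ S' g ** g = 1H.
Proof.
move=> [Dg eg]; split.
  have := antipVR L g; rewrite eg scale1r /sw2 Dg lift2T //; lin.
have := antipVL L g; rewrite eg scale1r /sw2 Dg lift2T //; lin.
Qed.

Lemma bullet_grouplike g m : grouplike g ->
  bullet chi g m = (chi g : k) *: (g ** m ** S' g).
Proof.
move=> [Dg eg]; rewrite bulletE /sw2 Dg lift2T; last by lin.
by rewrite hit_chiE /sw2 Dg lift2T; [rewrite !mulZl | lin].
Qed.
End OneChar.
End YetterDrinfeldModule.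

(** * The ribbon element on group-like vectors *)

Section RibbonUnits.
Variables (k : fieldType) (H : hopf k).
Hypothesis L : hopf_laws H.
Local Notation D := (drinfeld_double H).
Local Notation R := (double_R H).
Local Notation u := (drinfeld_u R).
Local Notation one := (alg_one D).
Local Notation DD := (tensor_alg D D).

Lemma u_invC : alg_inv u ** u = one.
Proof. exact: (alg_invL (mulDA L) (mulD1 L) (mul1D L) (u_uinv L)). Qed.

Lemma antip_u_unit : antip u ** antip (u_inv H) = one.
Proof.
rewrite -(antipDM L) (alg_invC (mulDA L) (mulD1 L) (mul1D L) (u_uinv L)).
by rewrite (antipDh L) (antip_1 L).
Qed.

Lemma DDA (a b c : DD) : a ** (b ** c) = (a ** b) ** c.
Proof. by apply: mulTA; exact: mulDA. Qed.
Lemma DD1 (a : DD) : alg_one DD ** a = a.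
Proof. by apply: mulT1; exact: mulD1. Qed.
Lemma DDr1 (a : DD) : a ** alg_one DD = a.
Proof. by apply: mul1T; exact: mul1D. Qed.

Lemma R_invR : (R : DD) ** (R_inv R : DD) = alg_one DD.
Proof. exact: (alg_invR (RRinv L)). Qed.

Lemma R21R_invC : let Q : DD := (tflip D D R : DD) ** (R : DD) in alg_inv Q ** Q = alg_one DD.
Proof.
move=> Q; apply: (alg_invL DDA DD1 DDr1 (b := (R_inv0 H : DD) ** (tflip D D (R_inv0 H) : DD))).
rewrite /Q -DDA [X in _ ** X]DDA (RRinv L) DD1 -tflipM (RRinv L).
by rewrite /= tflipT.
Qed.

Variable v : D.
Hypothesis hv : ribbon_element R v.

(** The square of v is the product of the two invertible elements u and s(u). *)
Lemma v_unit : exists z, v ** z = one.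
Proof.
exists (v ** (antip (u_inv H) ** u_inv H)); case: hv => _ vv _ _ _.
by rewrite (mulDA L) vv -(mulDA L) [X in _ ** X](mulDA L) antip_u_unit (mulD1 L) (u_uinv L).
Qed.

Lemma G_unit : exists z, Gelt R v ** z = one.
Proof.
have [z vz] := v_unit; exists (z ** u); rewrite /Gelt.
by rewrite -(mulDA L) [X in _ ** X](mulDA L) vz (mulD1 L) u_invC.
Qed.
End RibbonUnits.

Lemma lift2_flip (k : fieldType) (V W U : vectType k) (F : W -> V -> U) (t : tensor V W) :
  bilin F -> lift2 F (tflip V W t) = lift2 (fun a b => F b a) t.
Proof.
move=> Fl; move: t; apply: tensor_ext => [| |a b]; try by lin.
by rewrite tflipT !lift2T //; lin.
Qed.

Section Braiding.
Variables (k : fieldType) (H : hopf k).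
Hypothesis L : hopf_laws H.
Implicit Types (U V W : vectType k).
Local Notation D := (drinfeld_double H).
Local Notation dual := (ldual H).
Local Notation S' := (antipV H).
Local Notation R := (double_R H).
Local Notation DD := (tensor_alg D D).
(** The R-matrix acts through one action of H and one coaction, since the sum over
    dual bases contracts. *)
Lemma rho_R (chi chi' : dual) (chiP : is_char chi) (chiP' : is_char chi') U (F : H -> H -> U) :
  bilin F -> forall m n,
  lift2 (fun d d' => F (yd_act chi d m) (yd_act chi' d' n)) R = sw2 n (fun a b => F (bullet chi b m) a).
Proof.
move=> Fl m n; rewrite /double_R linear_sum /=.
transitivity (\sum_(i < \dim {:H}) sw2 n (fun a b =>
   coord (vbasis {:H}) i b *: F (bullet chi (vbasis {:H})`_i m) a)).
  apply: eq_bigr => i _; rewrite lift2T; last by lin.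
  rewrite (rho_h L) // (rho_p L) // dual_actE (@sw2_lin _ _ _ _ (fun z => F _ z)); last by lin.
  by apply: eq_sw2 => a b; rewrite (@islinZ _ _ _ (fun z => F _ z)) ?dual_basisE //; lin.
rewrite sum_sw2; apply: eq_sw2 => a b.
by rewrite -(dual_coord b (F := fun b => F (bullet chi b m) a)); last by lin.
Qed.

Variables chi chi' : dual.
Hypothesis chiP : is_char chi.
Hypothesis chiP' : is_char chi'.
Local Notation rho := (yd_act chi).
Local Notation rho' := (yd_act chi').

Definition op2 (t : DD) (z : tensor H H) : tensor H H :=
  lift2 (fun d d' => lift2 (fun m n => rho d m ⊗ rho' d' n) z) t.

Lemma op2T (d d' : D) (m n : H) : op2 (d ⊗ d') (m ⊗ n) = rho d m ⊗ rho' d' n.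
Proof. by rewrite /op2 lift2T; [rewrite lift2T; [|lin] | lin]. Qed.

Lemma op2M (s t : DD) z : op2 (s ** t) z = op2 s (op2 t z).
Proof.
move: s; apply: tensor_ext => [| |a b]; try by rewrite /op2; lin.
move: t; apply: tensor_ext => [| |a' b']; try by rewrite /op2; lin.
move: z; apply: tensor_ext => [| |m n]; try by rewrite /op2; lin.
by rewrite (mulTT (A := D) (B := D)) !op2T !(rhoM L).
Qed.

Lemma op2_1 z : op2 (alg_one DD) z = z.
Proof.
move: z; apply: tensor_ext => [| |m n]; try by rewrite /op2; lin.
by rewrite op2T !(rho1 L).
Qed.

Lemma dual_comul_lin (p : dual) U (F : dual -> dual -> U) : bilin F ->
  lift2 F (dual_comul p) = \sum_(i < \dim {:H}) \sum_(j < \dim {:H})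
    (p ((vbasis {:H})`_i ** (vbasis {:H})`_j) : k) *: F (dual_basis i) (dual_basis j).
Proof.
move=> Fl; rewrite /dual_comul linear_sum; apply: eq_bigr => i _.
by rewrite linear_sum; apply: eq_bigr => j _; rewrite linearZ /= lift2T.
Qed.

Lemma is_char_mul : is_char (dual_mul chi chi').
Proof.
split=> [|a b]; rewrite !dual_mulE.
  by rewrite (sw2_1 L); [rewrite (proj1 chiP) (proj1 chiP') mulr1 | lin].
rewrite (sw2M L); last by lin.
rewrite (@sw2_lin _ _ _ _ (fun z : k^o => z * _ : k^o)); last by lin.
apply: eq_sw2 => x y; rewrite (@sw2_lin _ _ _ _ (fun z : k^o => _ * z : k^o)); last by lin.
by apply: eq_sw2 => c d; rewrite (proj2 chiP) (proj2 chiP') mulrACA.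
Qed.

Lemma hit_conv z :
  hit_chi (dual_mul chi chi') z = sw2 z (fun b t => (chi b : k) *: hit_chi chi' t).
Proof.
transitivity (sw2 z (fun x d => sw2 x (fun b c => ((chi b : k) * (chi' c : k)) *: d))).
  rewrite hit_chiE; apply: eq_sw2 => x d.
  by rewrite dual_mulE (@sw2_lin _ _ _ _ (fun w : k^o => (w : k) *: d)); last by lin.
transitivity (sw2 z (fun b t => sw2 t (fun c d => ((chi b : k) *: ((chi' c : k) *: d))))).
  rewrite -(coassoc L (f := fun b c d => ((chi b : k) *: ((chi' c : k) *: d)))); last by lin.
  by apply: eq_sw2 => x d; apply: eq_sw2 => b c; rewrite scalerA.
by apply: eq_sw2 => b t; rewrite hit_chiE scale_sw2.
Qed.

Lemma counit_op2 (t : tensor D D) m n :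
  lift2 (fun a b : H => counit a * counit b : k^o) (op2 t (m ⊗ n)) =
  lift2 (fun a b => counit (rho a m) * counit (rho' b n) : k^o) t.
Proof.
move: t; apply: tensor_ext => [| |a b]; try by rewrite /op2; lin.
by rewrite op2T !lift2T //; lin.
Qed.

(** The action twisted by a product of characters, on a product of vectors, is the
    product of the twisted actions. The inner factors of the coproduct of h meet and
    cancel by the antipode axiom. *)
Lemma bullet_conv g g' h :
  sw2 h (fun a b => bullet chi' b g' ** bullet chi a g) =
  bullet (dual_mul chi chi') h (g' ** g).
Proof.
(* The inner factors c and b are the ones that cancel at the end. *)
pose Phi a b c d := (hit_chi chi' d ** g') ** (S' c ** b) ** (g ** S' a) : H.
transitivity (sw2 h (fun a z => sw2 z (fun b y => sw2 y (fun c d => Phi a (hit_chi chi b) c d)))).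
  rewrite -(coassoc L (f := fun a b y => sw2 y (fun c d => Phi a (hit_chi chi b) c d)));
    last by rewrite /Phi; lin.
  apply: eq_sw2 => x y; rewrite !bulletE (@sw2_lin _ _ _ _ (fun z => z ** _)); last by lin.
  rewrite [RHS]sw2C; apply: eq_sw2 => c d.
  rewrite (@sw2_lin _ _ _ _ (fun z => _ ** z)); last by lin.
  by apply: eq_sw2 => a b; rewrite /Phi !(hmulA L).
rewrite [RHS]bulletE; apply: eq_sw2 => a z.
rewrite hit_conv (@sw2_lin _ _ _ _ (fun z => z ** _ ** S' a)); last by lin.
transitivity (sw2 z (fun b1 t => sw2 t (fun b2 y => sw2 y (fun c d => (chi b1 : k) *: Phi a b2 c d)))).
  rewrite -(coassoc L (f := fun b1 b2 y => sw2 y (fun c d => (chi b1 : k) *: Phi a b2 c d)));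
    last by rewrite /Phi; lin.
  apply: eq_sw2 => b y; rewrite sw2C; apply: eq_sw2 => c d.
  rewrite hit_chiE (@sw2_lin _ _ _ _ (fun z => Phi a z c d)); last by rewrite /Phi; lin.
  by apply: eq_sw2 => b1 b2; rewrite /Phi !(mulZl, mulZr).
apply: eq_sw2 => b1 t.
rewrite -(coassoc L (f := fun b2 c d => (chi b1 : k) *: Phi a b2 c d)); last by rewrite /Phi; lin.
rewrite !mulZl.
rewrite -(counitlF L (f := fun d => (chi b1 : k) *: (hit_chi chi' d ** (g' ** g) ** S' a))); last by lin.
apply: eq_sw2 => w d.
apply: etrans (antipVLF L (f := fun z => (chi b1 : k) *: ((hit_chi chi' d ** g') ** z ** (g ** S' a))) _ _) _.
  by lin.
by rewrite (hmul1r L) !(hmulA L).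
Qed.

(** The counit of d g is a matrix coefficient of the double. By bullet_conv the
    coefficient for the product of two characters and of two vectors is obtained from
    the two factors by convolution. *)
Lemma counit_conv (d : D) g g' :
  counit (yd_act (dual_mul chi chi') d (g' ** g)) =
  lift2 (fun a b => counit (rho a g) * counit (rho' b g') : k^o) (comul d).
Proof.
move: d; apply: tensor_ext => [| |p h]; try by lin.
rewrite (counit_rhoT L) -bullet_conv.
pose F (a b : D) : k^o := counit (rho a g) * counit (rho' b g') : k^o.
have Fl : bilin F by rewrite /F; lin.
have -> : lift2 F (comul (p ⊗ h : D)) = lift2 (fun p2 p1 : dual => sw2 h (fun h1 h2 =>
    F (p1 ⊗ h1) (p2 ⊗ h2))) (dual_comul p).
  rewrite /= lift2T; last by rewrite /sw2; lin.
  rewrite (@sw2_lin _ _ _ _ (fun z => lift2 F z)); last by lin.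
  rewrite /sw2 /= linfunK; last by rewrite /dual_comul; lin.
  rewrite lift2_flip; last by lin.
  apply: eq_lift2 => p2 p1; rewrite -!/(sw2 _ _) (@sw2_lin _ _ _ _ (fun z => lift2 F z)); last by lin.
  by apply: eq_sw2 => h1 h2; rewrite lift2T.
rewrite dual_comul_lin; last by lin.
rewrite (@sw2_lin _ _ _ _ (fun z => p z)); last by lin.
transitivity (sw2 h (fun h1 h2 => \sum_(i < \dim {:H}) \sum_(j < \dim {:H})
   (p ((vbasis {:H})`_i ** (vbasis {:H})`_j) : k) *: F (dual_basis j ⊗ h1) (dual_basis i ⊗ h2))); last first.
  rewrite -sum_sw2; apply: eq_bigr => i _; rewrite -sum_sw2; apply: eq_bigr => j _.
  by rewrite scale_sw2.
apply: eq_sw2 => h1 h2.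
rewrite (dual_coord (bullet chi' h2 g') (F := fun z => p (z ** _))); last by lin.
apply: eq_bigr => i _.
rewrite (dual_coord (bullet chi h1 g) (F := fun z => p (_ ** z))); last by lin.
rewrite scaler_sumr; apply: eq_bigr => j _.
by rewrite /F !(counit_rhoT L) !dual_basisE /GRing.scale /=; ring.
Qed.

Lemma chi_neq0 g (psi : dual) : grouplike g -> is_char psi -> psi g != 0.
Proof.
move=> gP psiP; have E := proj1 (grouplike_inv L gP).
have : psi (g ** S' g) = 1 by rewrite E (proj1 psiP).
rewrite (proj2 psiP); case: eqP => // -> /eqP.
by rewrite mul0r eq_sym oner_eq0.
Qed.

Section CentralCharacter.
Variable v : D.
Hypothesis hv : ribbon_element R v.
Variables g g' : H.
Hypothesis gP : grouplike g.
Hypothesis gP' : grouplike g'.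
Hypothesis gC : g ** g' = g' ** g.

(** On a pair of commuting group-like vectors the double braiding is a scalar: each
    of the two braidings acts by a character value. *)
Lemma op2_R21R : op2 ((tflip D D R : DD) ** (R : DD)) (g ⊗ g') =
  (chi g' * chi' g : k) *: (g ⊗ g').
Proof.
have conj (a b : H) : grouplike a -> a ** b = b ** a -> a ** b ** S' a = b.
  move=> aP aC; rewrite aC -(hmulA L) (proj1 (grouplike_inv L aP)) ?(hmul1r L) //.
have E1 : op2 R (g ⊗ g') = (chi g' : k) *: (g ⊗ g').
  transitivity (lift2 (fun d d' => rho d g ⊗ rho' d' g') R).
    by apply: eq_lift2 => d d'; rewrite lift2T //; lin.
  rewrite rho_R //; last by lin.
  rewrite /sw2 (proj1 gP') lift2T; last by lin.
  by rewrite bullet_grouplike // conj // tensZl.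
rewrite op2M E1 (@islinZ _ _ _ (fun z => op2 _ z)); last by rewrite /op2; lin.
rewrite -scalerA; congr (_ *: _).
transitivity (lift2 (fun d d' => rho d g ⊗ rho' d' g') (tflip D D R)).
  by apply: eq_lift2 => d d'; rewrite lift2T //; lin.
rewrite lift2_flip; last by lin.
rewrite (rho_R chiP' chiP (F := fun x y => y ⊗ x)); last by lin.
rewrite /sw2 (proj1 gP) lift2T; last by lin.
by rewrite bullet_grouplike // conj // tensZr.
Qed.

(** A central element acts on group-like vectors by scalars. The formula for the
    coproduct of v, evaluated in the convolution of two coefficients, relates the
    scalar for the product to those of the factors, up to the eigenvalue of the double
    braiding. *)
Lemma counit_central_mul :
  (chi g' * chi' g) * counit (yd_act (dual_mul chi chi') v (g' ** g)) =
  counit (rho v g) * counit (rho' v g') :> k.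
Proof.
case: hv => cv _ _ _ Dv.
have a0 := chi_neq0 gP' chiP; have b0 := chi_neq0 gP chiP'.
rewrite counit_conv Dv; set Y := alg_inv _.
rewrite -counit_op2.
rewrite op2M op2T (central_grouplike L chiP gP cv) (central_grouplike L chiP' gP' cv).
rewrite tensZl tensZr !(@islinZ _ _ _ (fun z => op2 _ z)); try by rewrite /op2; lin.
have -> : op2 Y (g ⊗ g') = (chi g' * chi' g : k)^-1 *: (g ⊗ g').
  have /esym := op2M Y ((tflip D D R : DD) ** (R : DD)) (g ⊗ g').
  rewrite op2_R21R (R21R_invC L) op2_1 (@islinZ _ _ _ (fun z => op2 _ z)); last by rewrite /op2; lin.
  by move=> E; rewrite -[X in _ = _ *: X]E scalerA mulVf ?scale1r //; apply: (@mulf_neq0 k).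
rewrite !linearZ /= lift2T; last by lin.
rewrite (proj2 gP) (proj2 gP') /GRing.scale /=.
move: a0 b0; move: (chi g' : k) (chi' g : k) (counit _ : k) (counit _ : k) => a b c d a0 b0.
by field; rewrite a0 b0.
Qed.
End CentralCharacter.
End Braiding.

Section RootOfUnity.
Variables (k : fieldType) (H : hopf k).
Hypothesis L : hopf_laws H.
Local Notation D := (drinfeld_double H).
Local Notation dual := (ldual H).
Local Notation "1H" := (alg_one H).
Local Notation eps := (@counit _ H : dual).
Local Notation R := (double_R H).

Lemma is_char_eps : is_char eps.
Proof. by split; [exact: counit_1 | exact: (counitM L)]. Qed.

Lemma grouplike1 : grouplike 1H.
Proof. by split; [exact: comul_1 | exact: counit_1]. Qed.

Lemma sw2_tens (h : H) : sw2 h (fun a b => a ⊗ b) = comul h.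
Proof.
rewrite /sw2; move: (comul h) => t; move: t; apply: tensor_ext => [| |a b]; try by lin.
by rewrite lift2T //; lin.
Qed.

Lemma grouplikeM (g g' : H) : grouplike g -> grouplike g' -> grouplike (g ** g').
Proof.
move=> [Dg eg] [Dg' eg']; split; last by rewrite (counitM L) eg eg' mulr1.
rewrite -sw2_tens (sw2M L); last by lin.
rewrite /sw2 Dg Dg' lift2T; last by lin.
by rewrite lift2T; last by lin.
Qed.

Variable v : D.
Hypothesis hv : ribbon_element R v.
Variables (chi : dual) (g : H).
Hypothesis chiP : is_char chi.
Hypothesis gP : grouplike g.

Definition char_exp n : dual := iter n (fun x => dual_mul x chi) eps.
Definition elt_exp n : H := iter n (fun x => g ** x) 1H.

Lemma char_expP n : is_char (char_exp n).
Proof. by elim: n => [|n IH]; [exact: is_char_eps | exact: is_char_mul]. Qed.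
Lemma elt_expP n : grouplike (elt_exp n).
Proof. by elim: n => [|n IH]; [exact: grouplike1 | exact: grouplikeM]. Qed.
Lemma elt_expC n : elt_exp n ** g = g ** elt_exp n.
Proof.
elim: n => [|n IH] /=; first by rewrite (hmul1l L) (hmul1r L).
by rewrite -(hmulA L) IH.
Qed.
Lemma chi_elt_exp n : chi (elt_exp n) = (chi g : k) ^+ n :> k.
Proof.
elim: n => [|n IH] /=; first by rewrite (proj1 chiP).
by rewrite (proj2 chiP) IH exprS.
Qed.
Lemma char_exp_g n : char_exp n g = (chi g : k) ^+ n :> k.
Proof.
elim: n => [|n IH] /=; first by rewrite (proj2 gP).
rewrite dual_mulE /sw2 (proj1 gP) lift2T; last by lin.
by rewrite IH exprSr.
Qed.

Lemma counit_act_eps (d : D) : counit (yd_act eps d 1H) = counit d.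
Proof.
move: d; apply: tensor_ext => [| |p h]; try by lin.
rewrite (counit_rhoT L) bulletE.
transitivity (p (sw2 h (fun a b => b ** antipV H a))).
  by congr (p _); apply: eq_sw2 => a b; rewrite hit_chiE (counitl L) (hmul1r L).
rewrite (antipVR L) linearZ /= lift2T; last by lin.
by rewrite /= linfunK; [rewrite /GRing.scale /= mulrC | lin].
Qed.

(** Induction with counit_central_mul: passing from n to n + 1 contributes the double
    braiding eigenvalue of the nth power with the first, which is the (2 n)th power of
    chi(g), and these exponents sum up to n (n - 1). *)
Lemma central_scalar_pow n :
  (chi g : k) ^+ (n * (n - 1)) * counit (yd_act (char_exp n) v (elt_exp n)) =
  (counit (yd_act chi v g) : k) ^+ n.
Proof.
elim: n => [|n IH].
  by rewrite mul0n !expr0 mul1r counit_act_eps; case: hv.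
have E := counit_central_mul L (char_expP n) chiP hv (elt_expP n) gP (elt_expC n).
rewrite /= exprSr -IH subn1 /= -mulrA -E char_exp_g chi_elt_exp.
rewrite !mulrA -!exprD; congr (_ ^+ _ * _).
by case: n {IH E} => //= n; lia.
Qed.

(** When the nth powers of chi and g are trivial, the scalar for the nth powers is the
    counit of v, which is 1. *)
Lemma central_scalar_root n : (0 < n)%N -> char_exp n = eps -> elt_exp n = 1H ->
  (chi g : k) ^+ n = 1 -> (counit (yd_act chi v g) : k) ^+ n = 1.
Proof.
move=> n0 cn gn xn; have := central_scalar_pow n.
rewrite cn gn counit_act_eps exprM xn expr1n mul1r => <-.
by case: hv.
Qed.

End RootOfUnity.

(** * Matrices of the action on a simple module *)

Lemma lift2_mem (k : fieldType) (V W U : vectType k) (X : {vspace U}) (F : V -> W -> U) t :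
  (forall a b, F a b \in X) -> lift2 F t \in X.
Proof.
move=> FX; rewrite lift2E; apply: memv_suml => i _; apply: memv_suml => j _.
exact: memvZ.
Qed.

Section ModuleMatrices.
Variables (k : fieldType) (H : hopf k).
Hypothesis L : hopf_laws H.
Local Notation D := (drinfeld_double H).
Local Notation dual := (ldual H).
Variables (chi : dual) (g : H).
Hypothesis chiP : is_char chi.
Local Notation M := (bullet_mod chi g).
Local Notation W := (bullet_space chi g).
Local Notation rho := (yd_act chi).

Lemma mem_bullet_space h : bullet chi h g \in W.
Proof.
have Bl : islin (fun h => bullet chi h g) by lin.
by rewrite -(linfunK Bl); apply: memv_img; exact: memvf.
Qed.

Lemma bullet_spaceP w : w \in W -> exists h, w = bullet chi h g.
Proof.
have Bl : islin (fun h => bullet chi h g) by lin.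
by case/memv_imgP => h _ ->; exists h; rewrite linfunK.
Qed.

(** By sw2_bullet and because g is group-like, the coaction sends h g to vectors of
    the same form. *)
Lemma bullet_space_stable (d : D) w : grouplike g -> w \in W -> rho d w \in W.
Proof.
move=> [Dg _] /bullet_spaceP [h ->].
have lr m : islin (fun z => rho z m) by lin.
rewrite (tensor_decomp d) (islin_sum (lr _)); apply: memv_suml => i _.
rewrite (islin_sum (lr _)); apply: memv_suml => j _.
rewrite (islinZ (lr _)); apply: memvZ; move: (_`_i) (_`_j) => p h'.
rewrite rhoT -(bulletM L chiP); move: (h' ** h) => x.
rewrite dual_actE (sw2_bullet L); last by lin.
rewrite /sw3 /sw2 Dg; do 2!apply: lift2_mem => ? ?; rewrite lift2T; last by lin.
by apply: memvZ; exact: mem_bullet_space.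
Qed.

Hypothesis gP : grouplike g.
Variables (I : finType) (f : I -> H) (lam : I -> dual).
Hypothesis fW : forall a, f a \in W.
Hypothesis lamf : forall a b, lam a (f b) = (a == b)%:R :> k.
Hypothesis expW : forall w, w \in W -> w = \sum_a (lam a w : k) *: f a.

Definition mcoef (d : D) (a b : I) : k := lam a (rho d (f b)).

Lemma mcoefM (d d' : D) a b : mcoef (d ** d') a b = \sum_c mcoef d a c * mcoef d' c b.
Proof.
rewrite /mcoef (rhoM L chiP) {1}(expW (bullet_space_stable d' gP (fW b))).
rewrite !linear_sum; apply: eq_bigr => c _.
by rewrite !linearZ /= /GRing.scale /= mulrC.
Qed.

Lemma mcoef1 a b : mcoef (alg_one D) a b = (a == b)%:R.
Proof. by rewrite /mcoef (rho1 L chiP) lamf. Qed.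

Lemma lin_mcoef a b : islin (fun d => mcoef d a b : k^o).
Proof. by rewrite /mcoef; lin. Qed.

Lemma hactE (d : D) (m : M) : vsval (hact M d m) = rho d (vsval m).
Proof.
have Ml d' : islin (fun w : subvs_of W => vsproj W (rho d' (vsval w))).
  by move=> a x y; rewrite !linearP.
rewrite linfunK ?linfunK //; last first.
  move=> a x y; apply/lfunP => z; rewrite add_lfunE scale_lfunE !linfunK //.
  have lr : islin (fun d => rho d (vsval z)) by lin.
  by rewrite lr linearP.
by rewrite vsprojK // bullet_space_stable // subvsP.
Qed.

(** The character is a trace in a coordinate basis that is not explicit; expanding each
    basis in the other one exchanges the two traces. *)
Lemma hchar_mcoef (d : D) : hchar (M : hmod D) d = \sum_a mcoef d a a.
Proof.
rewrite /hchar; pose F a : M := vsproj W (f a).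
have FE a : vsval (F a) = f a by rewrite vsprojK.
have E (w : M) : w = \sum_a (lam a (vsval w) : k) *: F a.
  apply: val_inj; rewrite /= {1}(expW (subvsP w)) linear_sum.
  by apply: eq_bigr => a _; rewrite linearZ /= FE.
transitivity (\sum_(i < \dim {:M}) \sum_a (lam a (vsval (vbasis {:M})`_i) : k) *
    coord (vbasis {:M}) i (hact M d (F a))).
  apply: eq_bigr => i _.
  have G : islin (fun w : M => coord (vbasis {:M}) i (hact M d w) : k^o) by lin.
  apply: etrans (congr1 (fun w : M => coord (vbasis {:M}) i (hact M d w)) (E _)) _.
  by rewrite (islin_sum G); apply: eq_bigr => a _; rewrite (islinZ G).
rewrite exchange_big; apply: eq_bigr => a _; rewrite /mcoef -FE -hactE.
have G : islin (fun w : M => lam a (vsval w) : k^o) by move=> x y z; rewrite !linearP.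
apply: esym; apply: etrans (congr1 (fun w : M => lam a (vsval w)) (coord_vbasis (memvf _))) _.
by rewrite (islin_sum G); apply: eq_bigr => i _; rewrite (islinZ G) /GRing.scale /= mulrC.
Qed.

Lemma acts_asE (d : D) c : acts_as (M : hmod D) d c -> forall w, w \in W -> rho d w = c *: w.
Proof.
move=> dc w wW; have := congr1 vsval (dc (vsproj W w)).
by rewrite hactE linearZ /= vsprojK.
Qed.
End ModuleMatrices.

Section PivotMatrices.
Variables (k : fieldType) (H : hopf k).
Hypothesis L : hopf_laws H.
Local Notation D := (drinfeld_double H).
Local Notation R := (double_R H).
Local Notation u := (drinfeld_u R).
Variable v : D.
Hypothesis hv : ribbon_element R v.
Variables (I : finType) (mu : D -> I -> I -> k).
Hypothesis mu_lin : forall a b, islin (fun d => mu d a b : k^o).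
Hypothesis muM : forall d d' a b, mu (d ** d') a b = \sum_c mu d a c * mu d' c b.
Hypothesis mu1 : forall a b, mu (alg_one D) a b = (a == b)%:R.
Variables (U : I -> k) (c : k).
Hypothesis U_neq0 : forall a, U a != 0.
Hypothesis mu_u : forall a b, mu u a b = (a == b)%:R * U b.
Hypothesis mu_v : forall a b, mu v a b = (a == b)%:R * c.

Lemma diag_mull d d' (e : I -> k) a b : (forall a b, mu d a b = (a == b)%:R * e b) ->
  mu (d ** d') a b = e a * mu d' a b.
Proof.
move=> E; rewrite muM (bigD1 a) //= E eqxx mul1r big1 ?addr0 // => i.
by rewrite E eq_sym => /negPf ->; rewrite !mul0r.
Qed.

Lemma diag_mulr d d' (e : I -> k) a b : (forall a b, mu d' a b = (a == b)%:R * e b) ->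
  mu (d ** d') a b = mu d a b * e b.
Proof.
move=> E; rewrite muM (bigD1 b) //= E eqxx mul1r big1 ?addr0 // => i.
by rewrite E => /negPf ->; rewrite mul0r mulr0.
Qed.

Lemma diag_inv d d' (e : I -> k) : (forall a, e a != 0) -> d' ** d = alg_one D ->
  (forall a b, mu d a b = (a == b)%:R * e b) -> forall a b, mu d' a b = (a == b)%:R * (e b)^-1.
Proof.
move=> e0 dd E a b; have := diag_mulr d' a b E; rewrite dd mu1 => ->.
by rewrite mulfK.
Qed.

Lemma c_neq0 (a : I) : c != 0.
Proof.
have [z vz] := v_unit L hv; have := diag_mull z a a mu_v; rewrite vz mu1 eqxx.
by case: eqP => // -> /eqP; rewrite mul0r oner_eq0.
Qed.

(** The eigenvalue of the pivotal element, the product of the inverse of u with v. *)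
Definition pivot a := c / U a.

Lemma pivot_neq0 a : pivot a != 0.
Proof. by rewrite /pivot mulf_neq0 ?invr_neq0 // (c_neq0 a). Qed.

Lemma mu_G a b : mu (Gelt R v) a b = (a == b)%:R * pivot b.
Proof.
have E := diag_inv U_neq0 (u_invC L) mu_u.
rewrite /Gelt (diag_mull _ _ _ E) mu_v /pivot.
by case: eqP => [->|_]; rewrite ?mul1r ?mul0r ?mulr0 // mulrC.
Qed.

Lemma mu_exp d (e : I -> k) n : (forall a b, mu d a b = (a == b)%:R * e b) ->
  forall a b, mu (alg_exp d n) a b = (a == b)%:R * e b ^+ n.
Proof.
move=> E; elim: n => [|n IH] a b; first by rewrite expr0 mulr1 mu1.
rewrite /alg_exp iterS lmulE (diag_mull _ _ _ E) IH.
by case: eqP => [->|_]; rewrite ?mul0r ?mulr0 // !mul1r exprS.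
Qed.

Lemma mu_Gexp w a b : mu (alg_expz (Gelt R v) w) a b = (a == b)%:R * pivot b ^ w.
Proof.
case: w => n; first exact: (mu_exp n mu_G).
have [z Gz] := G_unit L hv.
have E := diag_inv pivot_neq0 (alg_invL (mulDA L) (mulD1 L) (mul1D L) Gz) mu_G.
by rewrite /= (mu_exp n.+1 E) NegzE -exprz_inv.
Qed.

(** Conjugation by u is the square of the antipode and v acts by a scalar, so in
    matrices the inverse square of the antipode is conjugation by the pivotal element. *)
Lemma mu_antipV2 y i j : mu (antipV D (antipV D y)) i j = pivot i * mu y i j / pivot j.
Proof.
have := u_antip2 L (antipV D (antipV D y)); rewrite !(antipDVK L) => E.
have := congr1 (fun d => mu d i j) E.
rewrite (diag_mull _ _ _ mu_u) (diag_mulr _ _ _ mu_u) => F.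
have c0 := c_neq0 i; rewrite /pivot invf_div.
by apply: (mulfI (U_neq0 i)); rewrite F; field; rewrite U_neq0 c0.
Qed.

Lemma mu_antip2 y i j : mu (antip (antip y)) i j = (pivot i)^-1 * mu y i j * pivot j.
Proof.
have := mu_antipV2 (antip (antip y)) i j; rewrite !(antipDK L) => ->.
by field; rewrite !pivot_neq0.
Qed.

Lemma mu_Upow a y i j : mu (Upow a y) i j = pivot i ^ a * mu y i j * pivot j ^ (- a).
Proof.
case: a => n.
  rewrite /Upow; elim: n i j => [|n IH] i j; first by rewrite oppr0 !expr0z mul1r mulr1.
  by rewrite iterS mu_antipV2 IH -!exprz_inv !exprSz; ring.
rewrite /Upow NegzE opprK -exprz_inv.
elim: {n}n.+1 i j => [|n IH] i j; first by rewrite !expr0z mul1r mulr1.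
by rewrite iterS mu_antip2 IH !exprSz; ring.
Qed.
End PivotMatrices.

(** * The invariant as a sum over labelings *)

Lemma sum_deltal (k : fieldType) (I : finType) (a : I) (F : I -> k) :
  \sum_b (a == b)%:R * F b = F a.
Proof.
rewrite (bigD1 a) //= eqxx mul1r big1 ?addr0 // => i.
by rewrite eq_sym => /negPf ->; rewrite mul0r.
Qed.

Section LabelSums.
Variables (k : fieldType) (T : eqType) (I : finType) (s0 : T -> I).
Implicit Types (s : T -> I) (c P : seq T) (F : (T -> I) -> k).

Definition upd s (x : T) (a : I) : T -> I := fun y => if y == x then a else s y.

Lemma updE s x a : upd s x a x = a. Proof. by rewrite /upd eqxx. Qed.
Lemma updN s x a y : y != x -> upd s x a y = s y. Proof. by rewrite /upd => /negPf ->. Qed.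

(** The sum of F over all labelings of the points of P. Points outside P keep the label
    given by s0. A recursion over the list of points, rather than a sum over a finite
    function type, lets the traversal of a component be unfolded point by point. *)
Fixpoint sumlab P F : k :=
  if P is x :: P' then \sum_a sumlab P' (fun s => F (upd s x a)) else F s0.

Lemma sumlab_cons x P F :
  sumlab (x :: P) F = \sum_a sumlab P (fun s => F (upd s x a)).
Proof. by []. Qed.

Definition local F c := forall s s', {in c, s =1 s'} -> F s = F s'.

Lemma eq_sumlab P F F' : (forall s, F s = F' s) -> sumlab P F = sumlab P F'.
Proof.
elim: P F F' => [|x P IH] F F' E //=; apply: eq_bigr => a _.
by apply: IH => s; apply: E.
Qed.

Lemma sumlab_mull P a F : sumlab P (fun s => a * F s) = a * sumlab P F.
Proof.
elim: P F => [|x P IH] F //=; rewrite mulr_sumr; apply: eq_bigr => b _.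
by rewrite IH.
Qed.

(** A sum over labelings of disjoint sets of points factors when each factor looks at
    one of the sets. *)
Lemma sumlab_cat c P F F' : uniq (c ++ P) -> local F c -> local F' P ->
  sumlab (c ++ P) (fun s => F s * F' s) = sumlab c F * sumlab P F'.
Proof.
elim: c F => [|x c IH] F /=.
  move=> _ Fl _; rewrite -sumlab_mull; apply: eq_sumlab => s.
  by congr (_ * _); apply: Fl.
case/andP => xcP U Fl F'l; rewrite mulr_suml; apply: eq_bigr => a _.
rewrite -IH //; last first.
  move=> s s' E; apply: Fl => y; rewrite inE /upd; case: eqP => //= _ yc; exact: E.
apply: eq_sumlab => s; congr (_ * _); apply: F'l => y yP.
rewrite updN //; apply: contraNneq xcP => <-; by rewrite mem_cat yP orbT.
Qed.
End LabelSums.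

Section PairLabels.
Variables (k : fieldType) (T : eqType) (I J : finType) (s0 : T -> I) (t0 : T -> J).
(** A labeling by pairs is a pair of labelings. *)
Lemma sumlab_pair P (F : (T -> I) -> k) (F' : (T -> J) -> k) :
  (forall s s', s =1 s' -> F s = F s') -> (forall s s', s =1 s' -> F' s = F' s') ->
  sumlab (fun x => (s0 x, t0 x)) P (fun s => F (fun x => (s x).1) * F' (fun x => (s x).2)) =
  sumlab s0 P F * sumlab t0 P F'.
Proof.
elim: P F F' => [|x P IH] F F' Fe Fe' //=.
pose G a b := sumlab (fun x => (s0 x, t0 x)) P (fun s =>
   F (fun y => (upd s x (a, b) y).1) * F' (fun y => (upd s x (a, b) y).2)).
transitivity (\sum_(p : I * J) G p.1 p.2); first by apply: eq_bigr => -[].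
rewrite mulr_suml -(pair_bigA _ G) /=.
apply: eq_bigr => a _; rewrite mulr_sumr; apply: eq_bigr => b _; rewrite /G.
rewrite -IH; last 2 first.
- by move=> s s' E; apply: Fe => y; rewrite /upd E.
- by move=> s s' E; apply: Fe' => y; rewrite /upd E.
apply: eq_sumlab => s; congr (_ * _); [apply: Fe | apply: Fe'] => y; rewrite /upd; by case: eqP.
Qed.
End PairLabels.

Section StateSum.
Variables (k : fieldType) (H : hopf k) (R : tensor H H) (v : H) (M : hmod H).
Variables (I : finType) (mu : H -> I -> I -> k) (g : I -> k) (a0 : I).
Hypothesis mu_lin : forall a b, islin (fun d => mu d a b : k^o).
Hypothesis muM : forall d d' a b, mu (d ** d') a b = \sum_c mu d a c * mu d' c b.
Hypothesis mu1 : forall a b, mu (alg_one H) a b = (a == b)%:R.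
Hypothesis hchar_mu : forall d, hchar M d = \sum_a mu d a a.
Hypothesis mu_G : forall w a b, mu (alg_expz (Gelt R v) w) a b = (a == b)%:R * g b ^ w.
Hypothesis mu_U : forall a y i j, mu (Upow a y) i j = g i ^ a * mu y i j * g j ^ (- a).

Variable Di : diagram.
Variable cs : seq (seq point).
Local Notation step := (step Di).
Definition succ_pt (x : nat * nat) : nat * nat := (step x).1.
Implicit Types (s : nat * nat -> I) (ds : seq (H * H)) (x : nat * nat) (c : seq (nat * nat)).

(** The matrix entry contributed when the traversal leaves the point x: that of the
    decoration at a crossing, and otherwise a Kronecker symbol, which makes the label
    constant along strands and extrema. *)
Definition ent ds x (a b : I) : k :=
  match (step x).2 with
  | Cross t over => let d := nth (0, 0) ds t in mu (if over then d.1 else d.2) a b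
  | _ => (a == b)%:R
  end.

(** The operators U act on matrices by conjugation with the diagonal pivotal matrix;
    this is the resulting scalar at a crossing. *)
Definition gfac (g : I -> k) x (n : int) (a b : I) : k :=
  if (step x).2 is Cross _ _ then g a ^ n * g b ^ (- n) else 1.

Fixpoint cwt ds s c (b : I) : k :=
  if c is x :: p then
    let m := if p is y :: _ then s y else b in
    gfac g x (ltr_balance (visits Di p)) (s x) m * ent ds x (s x) m * cwt ds s p b
  else 1.

Lemma cwt2 ds s x y p b : cwt ds s (x :: y :: p) b =
    gfac g x (ltr_balance (visits Di (y :: p))) (s x) (s y) * ent ds x (s x) (s y) * cwt ds s (y :: p) b.
Proof. by []. Qed.

Lemma cwt_local ds c b : local (fun s => cwt ds s c b) c.
Proof.
elim: c => [|x p IH] // s s' E /=; rewrite (E x) ?mem_head // (IH s s'); last first.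
  by move=> y yp; apply: E; rewrite inE yp orbT.
by case: p {IH} E => [|y p] // E; rewrite (E y) // !inE eqxx orbT.
Qed.

(** A matrix entry of a product of decorations is a sum over intermediate labels, one
    for each point of the component after the base point. *)
Lemma mu_word ds x p a b : uniq (x :: p) ->
  mu (word ds (visits Di (x :: p))) a b =
  sumlab (fun _ => a0) p (fun s => cwt ds (upd s x a) (x :: p) b).
Proof.
have W y q (c d : I) : mu (word ds (visits Di (y :: q))) c d =
    \sum_m gfac g y (ltr_balance (visits Di q)) c m * ent ds y c m * mu (word ds (visits Di q)) m d.
  rewrite /= /gfac /ent; case E : (step y).2 => [|t o|mx lr].
  - rewrite (bigD1 c) //= eqxx !mul1r big1 ?addr0 // => i; rewrite eq_sym => /negPf ->.
    by rewrite mulr0 mul0r.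
  - by rewrite muM; apply: eq_bigr => m _; rewrite mu_U; ring.
  - rewrite (bigD1 c) //= eqxx !mul1r big1 ?addr0 // => i; rewrite eq_sym => /negPf ->.
    by rewrite mulr0 mul0r.
elim: p x a => [|y p IH] x a; rewrite W.
  move=> _ /=; rewrite updE (bigD1 b) //= mu1 eqxx !mulr1 big1 ?addr0 // => i.
  by rewrite mu1 => /negPf ->; rewrite mulr0.
rewrite cons_uniq => /andP [xp U]; rewrite sumlab_cons; apply: eq_bigr => m _.
rewrite (IH _ _ U) -sumlab_mull; apply: eq_sumlab => s.
rewrite cwt2 updE [upd (upd s y m) x a y]updN ?updE; last first.
  by apply: contraNneq xp => ->; rewrite mem_head.
congr (_ * _); apply: cwt_local => z zp.
by rewrite [RHS]updN //; apply: contraNneq xp => <-.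
Qed.

Definition cyc ds s c : k :=
  if c is x :: p then g (s x) ^ Wd (visits Di c) * cwt ds s c (s x) else 1.

Lemma cyc_local ds c : local (fun s => cyc ds s c) c.
Proof.
case: c => [|x p] // s s' E; rewrite /cyc (cwt_local _ _ E) (E x) ?mem_head //.
Qed.

Lemma hchar_cyc ds c : c != [::] -> uniq c ->
  hchar M (alg_expz (Gelt R v) (Wd (visits Di c)) ** word ds (visits Di c)) =
  sumlab (fun _ => a0) c (fun s => cyc ds s c).
Proof.
case: c => // x p _ U; rewrite hchar_mu /cyc sumlab_cons; apply: eq_bigr => a _.
rewrite muM; under eq_bigr => j _ do rewrite mu_G -mulrA.
rewrite sum_deltal.
by rewrite (mu_word _ _ _ U) -sumlab_mull; apply: eq_sumlab => s; rewrite updE.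
Qed.

Lemma prod_hchar ds (C : seq (seq (nat * nat))) : all (fun c => c != [::]) C -> uniq (flatten C) ->
  \prod_(c <- C) hchar M (alg_expz (Gelt R v) (Wd (visits Di c)) ** word ds (visits Di c)) =
  sumlab (fun _ => a0) (flatten C) (fun s => \prod_(c <- C) cyc ds s c).
Proof.
elim: C => [|c C IH] /=; first by rewrite !big_nil.
case/andP => c0 Ca U; have := U; rewrite cat_uniq => /and3P [Uc _ UC].
rewrite big_cons IH // hchar_cyc // -sumlab_cat //.
- by apply: eq_sumlab => s; rewrite big_cons.
- exact: cyc_local.
- elim: C {IH Ca U UC c0 Uc} => [|c' C IH] s s' E; first by rewrite !big_nil.
  have E1 : {in c', s =1 s'} by move=> y yc; apply: E; rewrite /= mem_cat yc.
  have E2 : {in flatten C, s =1 s'} by move=> y yc; apply: E; rewrite /= mem_cat yc orbT.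
  by rewrite !big_cons (cyc_local _ E1) (IH _ _ E2).
Qed.

Fixpoint gcwt s c (b : I) : k :=
  if c is x :: p then
    let m := if p is y :: _ then s y else b in
    gfac g x (ltr_balance (visits Di p)) (s x) m * gcwt s p b
  else 1.

Lemma gcwt2 s x y p b : gcwt s (x :: y :: p) b =
    gfac g x (ltr_balance (visits Di (y :: p))) (s x) (s y) * gcwt s (y :: p) b.
Proof. by []. Qed.

Definition gcyc s c : k :=
  if c is x :: p then g (s x) ^ Wd (visits Di c) * gcwt s c (s x) else 1.

Lemma cwt_split ds s x p z : fpath succ_pt x (rcons p z) ->
  cwt ds s (x :: p) (s z) =
  gcwt s (x :: p) (s z) * \prod_(y <- x :: p) ent ds y (s y) (s (succ_pt y)).
Proof.
elim: p x => [|y p IH] x; first by rewrite big_seq1 /= !mulr1 => /andP [/eqP -> _].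
rewrite rcons_cons [fpath _ _ _]/= => /andP [/eqP E /IH Ep].
rewrite cwt2 gcwt2 Ep [in RHS]big_cons E; ring.
Qed.

(** The pivotal factors depend on the traversal, the decorations only on the point and
    its successor; separating them makes it possible to regroup the decorations by
    crossings. *)
Lemma cyc_split ds s c : c != [::] -> fcycle succ_pt c ->
  cyc ds s c = gcyc s c * \prod_(y <- c) ent ds y (s y) (s (succ_pt y)).
Proof. by case: c => // x p _ cc; rewrite /cyc /gcyc (cwt_split _ _ cc) mulrA. Qed.

Lemma state_sum_ext (D : diagram) (F F' : seq (H * H) -> k^o) : (forall ds, F ds = F' ds) ->
  state_sum R D F = state_sum R D F'.
Proof.
elim: D F F' => [|e D IH] F F' E //=.
case: e => [i lr|i lr|i pos]; try by apply: IH => ds; apply: E.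
by apply: eq_lift2 => e e'; apply: IH => ds; apply: E.
Qed.

Lemma state_sum_mull (D : diagram) (a : k) (F : seq (H * H) -> k^o) :
  state_sum R D (fun ds => a * F ds) = a * state_sum R D F.
Proof.
elim: D F => [|e D IH] F //=; case: e => [i lr|i lr|i pos]; try exact: IH.
rewrite (@lift2_lin _ _ _ _ _ (fun z : k^o => a * z : k^o)); last by lin.
by apply: eq_lift2 => e e'; apply: IH.
Qed.

Lemma state_sum_sum (D : diagram) (J : finType) (F : J -> seq (H * H) -> k^o) :
  state_sum R D (fun ds => \sum_j F j ds) = \sum_j state_sum R D (F j).
Proof.
elim: D F => [|e D IH] F //=; case: e => [i lr|i lr|i pos]; try exact: IH.
rewrite !lift2E /lift2_fun; under [RHS]eq_bigr do rewrite lift2E /lift2_fun.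
rewrite [RHS]exchange_big /=; apply: eq_bigr => a _.
rewrite [RHS]exchange_big /=; apply: eq_bigr => b _.
by rewrite (IH (fun j ds => F j (_ :: ds))) scaler_sumr.
Qed.

Lemma state_sum_sumlab (D : diagram) (P : seq (nat * nat)) (F : _ -> seq (H * H) -> k^o) :
  state_sum R D (fun ds => sumlab (fun _ => a0) P (fun s => F s ds)) =
  sumlab (fun _ => a0) P (fun s => state_sum R D (F s)).
Proof.
elim: P F => [|x P IH] F //=; rewrite state_sum_sum; apply: eq_bigr => a _.
exact: IH.
Qed.

Definition event_sum (e : event) (F : H * H -> k^o) : k^o :=
  match e with
  | Crossing _ pos => lift2 (fun a b => F (a, b)) (if pos then R else R_inv R)
  | _ => F (0, 0)
  end.

(** The tensors at different events are independent, so the sum over all decorations of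
    a product of local terms is the product of the local sums. *)
Lemma state_sum_prod (D : diagram) (F : nat -> H * H -> k^o) :
  state_sum R D (fun ds => \prod_(t < size D) F t (nth (0, 0) ds t) : k^o) =
  \prod_(t < size D) (event_sum (nth (Crossing 0 true) D t) (F t) : k).
Proof.
elim: D F => [|e D IH] F; first by rewrite /= !big_ord0.
rewrite /= big_ord_recl /=.
have E d : state_sum R D (fun ds => \prod_(t < (size D).+1) F t (nth (0, 0) (d :: ds) t) : k^o) =
   F 0%N d * \prod_(t < size D) (event_sum (nth (Crossing 0 true) D t) (F t.+1) : k).
  rewrite -(IH (fun t => F t.+1)) -state_sum_mull; apply: state_sum_ext => ds.
  by rewrite big_ord_recl.
case: e => [i lr|i lr|i pos]; rewrite ?E //.
rewrite /event_sum.
have -> := @eq_lift2 k H H _ _ _ (if pos then R else R_inv R) (fun e e' => E (e, e')).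
rewrite mulrC (@lift2_lin _ _ _ _ _ (fun z : k^o => _ * z : k^o)); last by lin.
by apply: eq_lift2 => a b; rewrite mulrC.
Qed.
End StateSum.

Section Levels.
Implicit Types (D : diagram) (st : seq bool).

Lemma closes_level st D : closes st D -> foldl after st D = [::].
Proof. by elim: D st => [|e D IH] st /=; [move/eqP | case/andP => _ /IH]. Qed.

Lemma closes_admissible st D t : closes st D -> (t < size D)%N ->
  admissible (nth (Crossing 0 true) D t) (foldl after st (take t D)).
Proof.
elim: D st t => [|e D IH] st [|t] //=; first by case/andP.
by case/andP => _ cD; rewrite ltnS => tD; exact: IH.
Qed.

Lemma level_next D t : (t < size D)%N -> level D t.+1 = after (level D t) (event_at D t).
Proof. by move=> tD; rewrite /level (take_nth (Crossing 0 true)) // -cats1 foldl_cat. Qed.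

Lemma level_size D : link_diagram D -> level D (size D) = [::].
Proof. by move=> cD; rewrite /level take_size; exact: closes_level. Qed.

Lemma admissible_at D t : link_diagram D -> (t < size D)%N -> admissible (event_at D t) (level D t).
Proof. exact: closes_admissible. Qed.

Lemma take2P st i a b : take 2 (drop i st) = [:: a; b] ->
  [/\ (i.+1 < size st)%N, nth false st i = a & nth false st i.+1 = b].
Proof.
move=> E; have := congr1 size E; rewrite size_take size_drop /=; case: ifP => sz S; split.
- lia.
- by rewrite -[i]addn0 -nth_drop -(nth_take _ (n0 := 2)) // E.
- by rewrite -addn1 -nth_drop -(nth_take _ (n0 := 2)) // E.
- lia.
- by rewrite -[i]addn0 -nth_drop -(nth_take _ (n0 := 2)) // E.
- by rewrite -addn1 -nth_drop -(nth_take _ (n0 := 2)) // E.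
Qed.
End Levels.

Section Weights.
Variables (k : fieldType) (I : finType) (D : diagram) (Rm : bool -> I -> I -> I -> I -> k).
Implicit Types (s : nat * nat -> I).

Definition crossing_at t p : bool :=
  if event_at D t is Crossing i _ then (p == i) || (p == i.+1) else false.

(** The entry of the R-matrix selected by the labels around the crossing t, where the
    over-strand and the under-strand are found from the sign of the crossing. *)
Definition rfac s t : k :=
  match event_at D t with
  | Crossing i true => Rm true (s (t, i)) (s (t.+1, i.+1)) (s (t, i.+1)) (s (t.+1, i))
  | Crossing i false => Rm false (s (t, i.+1)) (s (t.+1, i)) (s (t, i)) (s (t.+1, i.+1))
  | _ => 1
  end.

(** Labels are constant along strands that are not crossed. *)
Definition dfac s t : k :=
  \prod_(p <- iota 0 (size (level D t)) | ~~ crossing_at t p)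
     (s (t, p) == s (succ_pt D (t, p)))%:R.

Definition lab_weight s : k := \prod_(t < size D) (dfac s t * rfac s t).
End Weights.

Lemma lab_weight_eq (k : fieldType) (I : finType) (D : diagram) (F G : bool -> I -> I -> I -> I -> k) s :
  (forall pos a a' b b', F pos a a' b b' = G pos a a' b b') -> lab_weight D F s = lab_weight D G s.
Proof.
move=> E; apply: eq_bigr => t _; congr (_ * _); rewrite /rfac.
by case: (event_at D t) => // i [].
Qed.

Section InvFormula.
Variables (k : fieldType) (H : hopf k) (R : tensor H H) (v : H) (M : hmod H).
Variables (I : finType) (mu : H -> I -> I -> k) (g : I -> k) (a0 : I).
Hypothesis mu_lin : forall a b, islin (fun d => mu d a b : k^o).
Hypothesis muM : forall d d' a b, mu (d ** d') a b = \sum_c mu d a c * mu d' c b.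
Hypothesis mu1 : forall a b, mu (alg_one H) a b = (a == b)%:R.
Hypothesis hchar_mu : forall d, hchar M d = \sum_a mu d a a.
Hypothesis mu_G : forall w a b, mu (alg_expz (Gelt R v) w) a b = (a == b)%:R * g b ^ w.
Hypothesis mu_U : forall a y i j, mu (Upow a y) i j = g i ^ a * mu y i j * g j ^ (- a).
Variable D : diagram.
Hypothesis Dlink : link_diagram D.

Definition Rcoef (pos : bool) (a a' b b' : I) : k :=
  lift2 (fun e e' => mu e a a' * mu e' b b' : k^o) (if pos then R else R_inv R).

Definition ent1 (d : H * H) (x : nat * nat) (a b : I) : k :=
  match (step D x).2 with
  | Cross _ over => mu (if over then d.1 else d.2) a b
  | _ => (a == b)%:R
  end.

Lemma ent_ent1 ds t p a b : ent mu D ds (t, p) a b = ent1 (nth (0, 0) ds t) (t, p) a b.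
Proof.
rewrite /ent /ent1; case E : (step D (t, p)).2 => [|t' o|m lr] //.
suff -> : t' = t by [].
move: E; rewrite /step; case: (nth _ _ _); case: (event_at _ _) => [i lr|i lr|i pos];
  do ?[case: ifP => _ //]; try by move=> [].
Qed.

Lemma ent1_delta d t p a b : ~~ crossing_at D t p -> ent1 d (t, p) a b = (a == b)%:R.
Proof.
rewrite /ent1 /crossing_at /step; case: (nth _ _ _).
  case: (event_at D t) => [i lr|i lr|i pos] //; first by do 2?case: ifP.
  by move=> /norP [/negPf -> /negPf ->].
by move=> _; case: (event_at D t.-1) => [i lr|i lr|i pos] //; do 2?case: ifP.
Qed.

(** Each crossing is met by exactly two points, one on the over-strand and one on the
    under-strand; the entries of all other points of the line are Kronecker symbols. *)
Lemma event_sumE s t : (t < size D)%N ->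
  event_sum R (event_at D t) (fun d => \prod_(p <- iota 0 (size (level D t)))
      ent1 d (t, p) (s (t, p)) (s (succ_pt D (t, p))) : k^o) =
  dfac k D s t * rfac D Rcoef s t.
Proof.
move=> tD; have adm := admissible_at Dlink tD.
have dP d : (forall p, ~~ crossing_at D t p) ->
   \prod_(p <- iota 0 (size (level D t))) ent1 d (t, p) (s (t, p)) (s (succ_pt D (t, p))) = dfac k D s t.
  by move=> nc; rewrite /dfac; apply: eq_big => p; [rewrite nc | rewrite ent1_delta].
case E : (event_at D t) => [i lr|i lr|i pos]; rewrite /rfac E.
- by rewrite /= dP ?mulr1 // => p; rewrite /crossing_at E.
- by rewrite /= dP ?mulr1 // => p; rewrite /crossing_at E.
move: adm; rewrite E => /eqP /take2P [szi ti ti1].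
have X1 : succ_pt D (t, i) = (t.+1, i.+1) by rewrite /succ_pt /step ti E eqxx.
have X2 : succ_pt D (t, i.+1) = (t.+1, i).
  by rewrite /succ_pt /step ti1 E eqxx (gtn_eqF (ltnSn i)).
have F d : \prod_(p <- iota 0 (size (level D t))) ent1 d (t, p) (s (t, p)) (s (succ_pt D (t, p))) =
   dfac k D s t * (ent1 d (t, i) (s (t, i)) (s (t.+1, i.+1)) *
             ent1 d (t, i.+1) (s (t, i.+1)) (s (t.+1, i))).
  rewrite (bigD1_seq i) ?iota_uniq ?mem_iota //=; last lia.
  rewrite -big_filter (bigD1_seq i.+1) ?filter_uniq ?iota_uniq //=; last first.
    by rewrite mem_filter mem_iota; lia.
  rewrite X1 X2 mulrA mulrC; congr (_ * _); rewrite big_filter_cond /dfac.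
  have C p : crossing_at D t p = (p == i) || (p == i.+1) by rewrite /crossing_at E.
  by apply: eq_big => p; rewrite -?negb_or -C // => nc; rewrite ent1_delta.
have V1 d : ent1 d (t, i) =2 mu (if pos then d.1 else d.2).
  by move=> x y; rewrite /ent1 /step ti E eqxx.
have V2 d : ent1 d (t, i.+1) =2 mu (if pos then d.2 else d.1).
  by move=> x y; rewrite /ent1 /step ti1 E eqxx (gtn_eqF (ltnSn i)) /=; case: (pos).
rewrite /event_sum.
transitivity (lift2 (fun a b => dfac k D s t *
    (mu (if pos then a else b) (s (t, i)) (s (t.+1, i.+1)) *
     mu (if pos then b else a) (s (t, i.+1)) (s (t.+1, i))) : k^o) (if pos then R else R_inv R)).
  by apply: eq_lift2 => a b; rewrite F V1 V2.
rewrite -(@lift2_lin _ _ _ _ _ (fun z : k^o => _ * z : k^o)); last by lin.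
congr (_ * _); rewrite /Rcoef; case: (pos) => //=.
by apply: eq_lift2 => a b; rewrite mulrC.
Qed.

Variable cs : seq (seq point).
Hypothesis csD : based_components D cs.

(** Expanding every character gives a product over points of matrix entries of the
    decorations. Regrouped by events, the decorations of each crossing are summed
    independently, and the invariant becomes a state sum with local weights. *)
Lemma Inv_labels : Inv R v M D cs = sumlab (fun _ => a0) (flatten cs) (fun s =>
  (\prod_(c <- cs) gcyc g D s c) * lab_weight D Rcoef s).
Proof.
have /andP [ca pts] := csD.
have Uf : uniq (flatten cs).
  rewrite (perm_uniq pts); apply: allpairs_uniq_dep; rewrite ?iota_uniq //.
    by move=> t _; rewrite iota_uniq.
  by move=> [t p] [t' p'] _ _ [-> ->].
rewrite /Inv.
transitivity (state_sum R D (fun ds => sumlab (fun _ => a0) (flatten cs) (fun s =>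
   (\prod_(c <- cs) gcyc g D s c) * \prod_(t < size D) (\prod_(p <- iota 0 (size (level D t)))
      ent1 (nth (0, 0) ds t) (t : nat, p) (s (t : nat, p)) (s (succ_pt D (t : nat, p)))) : k^o))).
  apply: state_sum_ext => ds.
  rewrite (prod_hchar a0 muM mu1 hchar_mu mu_G mu_U) //; last first.
    by apply: sub_all ca => c /andP [].
  apply: eq_sumlab => s.
  transitivity (\prod_(c <- cs) (gcyc g D s c * \prod_(y <- c) ent mu D ds y (s y) (s (succ_pt D y)))).
    rewrite big_seq [RHS]big_seq; apply: eq_bigr => c cc.
    by have /andP [c0 cy] := allP ca c cc; exact: (cyc_split mu g ds s c0 cy).
  rewrite big_split /=; congr (_ * _).
  rewrite -big_flatten (perm_big _ pts) /= big_allpairs_dep.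
  transitivity (\prod_(0 <= t < (size D).+1) \prod_(p <- iota 0 (size (level D t)))
     ent mu D ds (t, p) (s (t, p)) (s (succ_pt D (t, p)))).
    by rewrite /index_iota subn0.
  (* The topmost line carries no points, so only lines below an event contribute. *)
  rewrite big_mkord big_ord_recr /= level_size //= big_nil mulr1.
  apply: eq_bigr => t _; apply: eq_bigr => p _; exact: ent_ent1.
rewrite state_sum_sumlab; apply: eq_sumlab => s.
rewrite state_sum_mull; congr (_ * _).
rewrite (state_sum_prod R D (fun t d => \prod_(p <- iota 0 (size (level D t)))
      ent1 d (t, p) (s (t, p)) (s (succ_pt D (t, p))))).
by apply: eq_bigr => t _; apply: event_sumE.
Qed.
End InvFormula.

(** * A potential on the horizontal lines of a diagram *)

Section Potential.

Definition wt (b : bool) : int := if b then 1 else -1.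

(** The direction of a strand and its pair of labels. *)
Definition strand := (bool * (bool * bool))%type.
Definition lab1 (x : strand) : int := wt x.1 * wt x.2.1.
Definition lab2 (x : strand) : int := wt x.1 * wt x.2.2.
(** Makes the two ends of an extremum cancel for both orientations: the ordered pair
    of antiparallel strands contributes the product of the two weights of the label
    with a minus sign. *)
Definition downw (x : strand) : int := if x.1 then 0 else wt x.2.1 * wt x.2.2.
Definition tot1 (l : seq strand) : int := \sum_(x <- l) lab1 x.
Definition tot2 (l : seq strand) : int := \sum_(x <- l) lab2 x.

(** The sum, over all pairs of strands, of the signed second weight of the left strand
    times the signed first weight of the right strand, corrected on downward strands. *)
Fixpoint pot (l : seq strand) : int :=
  if l is x :: l' then lab2 x * tot1 l' + downw x + pot l' else 0.

Lemma pot_cat l1 l2 : pot (l1 ++ l2) = pot l1 + pot l2 + tot2 l1 * tot1 l2.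
Proof.
elim: l1 => [|x l1 IH] /=; first by rewrite /tot2 big_nil; ring.
by rewrite IH /tot1 /tot2 big_cat big_cons /=; ring.
Qed.

Lemma tot1_cat l1 l2 : tot1 (l1 ++ l2) = tot1 l1 + tot1 l2.
Proof. by rewrite /tot1 big_cat. Qed.

Lemma pot_mid l1 x y l2 : pot (l1 ++ [:: x; y] ++ l2) =
  pot (l1 ++ l2) + (lab2 x * lab1 y + downw x + downw y)
  + tot2 l1 * (lab1 x + lab1 y) + (lab2 x + lab2 y) * tot1 l2.
Proof. by rewrite !pot_cat !tot1_cat /= /tot1 /tot2 !big_cons !big_nil; ring. Qed.

(** The two ends of an extremum have the same labels and opposite directions, so they
    cancel against every other strand, and downw removes their mutual term. *)
Lemma pot_turn l1 b a l2 : pot (l1 ++ [:: (b, a); (~~ b, a)] ++ l2) = pot (l1 ++ l2).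
Proof.
rewrite pot_mid /lab1 /lab2 /downw /=.
by case: b => /=; rewrite /wt; case: (wt a.1) (wt a.2) => ? [] ?; ring.
Qed.

(** When both total weights of the two strands are conserved, the terms with the other
    strands agree and only the mutual term of the two strands changes. *)
Lemma pot_cross l1 (x y x' y' : strand) l2 : x.1 -> y.1 -> x'.1 -> y'.1 ->
  lab1 x + lab1 y = lab1 x' + lab1 y' -> lab2 x + lab2 y = lab2 x' + lab2 y' ->
  pot (l1 ++ [:: x; y] ++ l2) - pot (l1 ++ [:: x'; y'] ++ l2) = lab2 x * lab1 y - lab2 x' * lab1 y'.
Proof.
rewrite !pot_mid /downw => -> -> -> -> -> ->; ring.
Qed.

Lemma mkseq_split (T : Type) (f : nat -> T) i n : (i <= n)%N ->
  mkseq f n = mkseq f i ++ mkseq (fun j => f (i + j)%N) (n - i).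
Proof.
move=> le_in; rewrite /mkseq -[in LHS](subnKC le_in) iotaD map_cat add0n.
by rewrite -[X in iota X (n - i)]addn0 iotaDl -map_comp.
Qed.

Lemma mkseq_split2 (T : Type) (f : nat -> T) i n : (i.+1 < n)%N ->
  mkseq f n = mkseq f i ++ [:: f i; f i.+1] ++ mkseq (fun j => f (i.+2 + j)%N) (n - i.+2).
Proof.
move=> lin; rewrite (@mkseq_split _ f i n) ?(@mkseq_split _ _ 2 (n - i)); try lia.
rewrite /= addn0 addn1 (_ : n - i - 2 = n - i.+2)%N; last by lia.
congr (_ ++ _ :: _ :: _); by apply: eq_mkseq => j; congr f; lia.
Qed.

Definition strands (st : seq bool) (f : nat -> bool * bool) : seq strand :=
  mkseq (fun p => (nth false st p, f p)) (size st).

Lemma pot_insert st i b (f h : nat -> bool * bool) : (i <= size st)%N ->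
  (forall p, (p < size st)%N -> h (insert2 i p) = f p) -> h i = h i.+1 ->
  pot (strands (take i st ++ [:: b; ~~ b] ++ drop i st) h) = pot (strands st f).
Proof.
move=> ist hf hi; set st' := _ ++ _.
have sz : size st' = (size st).+2.
  by rewrite /st' size_cat /= size_drop size_take_min; lia.
have n1 p : (p < i)%N -> nth false st' p = nth false st p.
  by move=> pi; rewrite /st' nth_cat size_takel // pi nth_take.
have n2 p : nth false st' (i.+2 + p) = nth false st (i + p).
  rewrite /st' nth_cat size_takel // ltnNge (_ : i <= i.+2 + p)%N /=; last lia.
  by rewrite (_ : i.+2 + p - i = p.+2)%N /= ?nth_drop //; lia.
have n3 : nth false st' i = b by rewrite /st' nth_cat size_takel // ltnn subnn.
have n4 : nth false st' i.+1 = ~~ b.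
  by rewrite /st' nth_cat size_takel // ltnNge leqnSn /= subSnn.
rewrite /strands sz (@mkseq_split2 _ _ i (size st).+2); last by rewrite !ltnS.
rewrite n3 n4 hi pot_turn (@mkseq_split _ _ i (size st)) //.
congr (pot (_ ++ _)).
  rewrite /mkseq; apply/eq_in_map => p; rewrite mem_iota add0n /= => pi.
  by rewrite n1 // -hf /insert2 ?pi //; lia.
rewrite (_ : (size st).+2 - i.+2 = size st - i)%N; last by lia.
rewrite /mkseq; apply/eq_in_map => p; rewrite mem_iota add0n /= => pi.
rewrite n2 -hf /insert2; last by lia.
by rewrite (_ : i + p < i = false)%N //; lia.
Qed.

Lemma pot_crossing st i (f h : nat -> bool * bool) : (i.+1 < size st)%N ->
  nth false st i -> nth false st i.+1 ->
  (forall p, (p < size st)%N -> (p != i) && (p != i.+1) -> h p = f p) ->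
  wt (f i).1 + wt (f i.+1).1 = wt (h i).1 + wt (h i.+1).1 ->
  wt (f i).2 + wt (f i.+1).2 = wt (h i).2 + wt (h i.+1).2 ->
  pot (strands st f) - pot (strands st h) =
  wt (f i).2 * wt (f i.+1).1 - wt (h i).2 * wt (h i.+1).1.
Proof.
move=> ist ti ti1 hf c1 c2; rewrite /strands.
rewrite (@mkseq_split2 _ (fun p => (nth false st p, f p)) i (size st)) //.
rewrite (@mkseq_split2 _ (fun p => (nth false st p, h p)) i (size st)) //.
have E1 : mkseq (fun p => (nth false st p, h p)) i = mkseq (fun p => (nth false st p, f p)) i.
  by rewrite /mkseq; apply/eq_in_map => p; rewrite mem_iota => pi; rewrite hf //; lia.
have E2 : mkseq (fun j => (nth false st (i.+2 + j), h (i.+2 + j)%N)) (size st - i.+2) =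
          mkseq (fun j => (nth false st (i.+2 + j), f (i.+2 + j)%N)) (size st - i.+2).
  by rewrite /mkseq; apply/eq_in_map => p; rewrite mem_iota => pi; rewrite hf //; lia.
rewrite E1 E2 pot_cross //=; rewrite /lab1 /lab2 /= ti ti1 /wt !mul1r //.
Qed.
End Potential.

(** * The total twist of a labeling vanishes *)

Section TwistSum.
Variable D : diagram.
Hypothesis Dlink : link_diagram D.
Variable s : nat * nat -> bool * bool.

(** The exponent by which the rank two weight of a crossing differs from the product of
    the rank one weights. It has the same form for both signs of the crossing, because
    the first component is read at the right strand and the second at the left one. *)
Definition twist (t : nat) : int :=
  if event_at D t is Crossing i _ then
    wt (s (t, i.+1)).1 * wt (s (t, i)).2 - wt (s (t.+1, i.+1)).1 * wt (s (t.+1, i)).2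
  else 0.

Hypothesis s_const : forall t p, (t < size D)%N -> (p < size (level D t))%N ->
  ~~ crossing_at D t p -> s (t, p) = s (succ_pt D (t, p)).
Hypothesis s_cons1 : forall t i pos, (t < size D)%N -> event_at D t = Crossing i pos ->
  wt (s (t, i)).1 + wt (s (t, i.+1)).1 = wt (s (t.+1, i)).1 + wt (s (t.+1, i.+1)).1.
Hypothesis s_cons2 : forall t i pos, (t < size D)%N -> event_at D t = Crossing i pos ->
  wt (s (t, i)).2 + wt (s (t, i.+1)).2 = wt (s (t.+1, i)).2 + wt (s (t.+1, i.+1)).2.

Local Notation pot_at t := (pot (strands (level D t) (fun p => s (t, p)))).

Lemma crossing_up t p : (t < size D)%N -> crossing_at D t p -> nth false (level D t) p.
Proof.
move=> tD; rewrite /crossing_at; case E : (event_at D t) => [//|//|i pos].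
have := admissible_at Dlink tD; rewrite E => /eqP /take2P [_ ti ti1].
by case/orP => /eqP ->.
Qed.

Lemma size_level_lt t p : (t <= size D)%N -> (p < size (level D t))%N -> (t < size D)%N.
Proof.
rewrite leq_eqVlt => /orP [/eqP -> |//]; by rewrite level_size.
Qed.

Lemma down_const t p : (t <= size D)%N -> (p < size (level D t))%N ->
  ~~ nth false (level D t) p -> s (t, p) = s (succ_pt D (t, p)).
Proof.
move=> tD pl dn; have tD' := size_level_lt tD pl.
by apply: s_const => //; apply: contra dn; exact: crossing_up.
Qed.

Lemma insert2K i p : delete2 i (insert2 i p) = p.
Proof.
rewrite /delete2 /insert2; case: (ltnP p i) => pi; first by rewrite pi.
by rewrite ltnNge (leq_trans pi) // !leqW.
Qed.

Lemma insert2_neq i p : (insert2 i p != i) && (insert2 i p != i.+1).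
Proof. by rewrite /insert2; case: ifP => pi; lia. Qed.

Lemma nth_insert2 st i a b p : (i <= size st)%N ->
  nth false (take i st ++ [:: a; b] ++ drop i st) (insert2 i p) = nth false st p.
Proof.
move=> ist; rewrite /insert2; case: ifP => pi.
  by rewrite nth_cat size_takel // pi nth_take.
rewrite nth_cat size_takel // (_ : p.+2 < i = false)%N; last by lia.
rewrite (_ : p.+2 - i = (p - i).+2)%N /= ?nth_drop; last by lia.
by congr nth; lia.
Qed.

(** Extrema insert or delete an adjacent pair of antiparallel strands with equal labels,
    which pot ignores; at a crossing the difference of the mutual terms is the twist. *)
Lemma pot_step t : (t < size D)%N -> pot_at t - pot_at t.+1 = twist t.
Proof.
move=> tD; have adm := admissible_at Dlink tD; have nx := level_next tD.
rewrite /twist; case E : (event_at D t) => [i lr|i lr|i pos]; move: adm nx; rewrite E /=.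
- move=> ist nx0; have nx : level D t.+1 =
    take i (level D t) ++ [:: ~~ lr; ~~ ~~ lr] ++ drop i (level D t) by rewrite negbK.
  apply/eqP; rewrite subr_eq0 eq_sym; apply/eqP.
  have sz : size (level D t.+1) = (size (level D t)).+2.
    by rewrite nx size_cat /= size_drop size_takel //; lia.
  have n3 : nth false (level D t.+1) i = ~~ lr.
    by rewrite nx nth_cat size_takel // ltnn subnn.
  have n4 : nth false (level D t.+1) i.+1 = lr.
    by rewrite nx nth_cat size_takel // ltnNge leqnSn /= subSnn /= negbK.
  rewrite [in LHS]nx; apply: pot_insert => //.
    move=> p pl; case up : (nth false (level D t) p).
      rewrite [RHS]s_const //; last by rewrite /crossing_at E.
      by rewrite /succ_pt /step up E.
    have [/negPf n1 /negPf n2] := andP (insert2_neq i p).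
    rewrite down_const //; last by rewrite nx nth_insert2 // up.
      by rewrite /succ_pt /step nx nth_insert2 // up /= E n1 n2 /= insert2K.
    by rewrite sz /insert2; case: ifP => _; rewrite ?ltnS // leqW // ltnW.
  case: (lr) n3 n4 => n3 n4.
    have -> : s (t.+1, i) = s (succ_pt D (t.+1, i)).
      by apply: down_const; rewrite ?n3 // sz ltnS leqW.
    by rewrite /succ_pt /step n3 /= E eqxx.
  have -> : s (t.+1, i.+1) = s (succ_pt D (t.+1, i.+1)).
    by apply: down_const; rewrite ?n4 // sz !ltnS.
  by rewrite /succ_pt /step n4 /= E (gtn_eqF (ltnSn i)) eqxx.
- move=> /eqP tk nx; have [szi ti ti1] := take2P tk.
  apply/eqP; rewrite subr_eq0; apply/eqP.
  set st' := level D t.+1 in nx *.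
  have it : (i <= size st')%N by rewrite nx size_cat size_takel ?leq_addr //; lia.
  have st_eq : level D t = take i st' ++ [:: lr; ~~ lr] ++ drop i st'.
    rewrite nx take_cat size_takel ?ltnn ?subnn ?take0 ?cats0; last by lia.
    rewrite drop_cat size_takel ?ltnn ?subnn ?drop0; last by lia.
    by rewrite -tk -[in LHS](cat_take_drop i (level D t)) -[in LHS](cat_take_drop 2 (drop i _)) drop_drop.
  rewrite [in LHS]st_eq; apply: pot_insert => //.
    move=> p pl; case up : (nth false (level D t) (insert2 i p)).
      have [/negPf n1 /negPf n2] := andP (insert2_neq i p).
      rewrite s_const //; last by rewrite /crossing_at E.
        by rewrite /succ_pt /step up E n1 n2 /= insert2K.
      by rewrite st_eq size_cat /= size_drop size_takel // /insert2; case: ifP; lia.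
    move: up; rewrite st_eq nth_insert2 // => up.
    by rewrite [RHS]down_const ?up // /succ_pt /step -/st' up /= E.
  case: (lr) ti ti1 => ti ti1.
    rewrite s_const //; [by rewrite /succ_pt /step ti E eqxx | lia | by rewrite /crossing_at E].
  rewrite [RHS]s_const //; last by rewrite /crossing_at E.
  by rewrite /succ_pt /step ti1 E (gtn_eqF (ltnSn i)) eqxx.
- move=> /eqP tk nx; have [szi ti ti1] := take2P tk; rewrite nx.
  rewrite (@pot_crossing _ i) ?ti ?ti1 //; [ring | | exact: s_cons1 E | exact: s_cons2 E].
  move=> p pl pn; have [/negPf n1 /negPf n2] := andP pn.
  case up : (nth false (level D t) p).
    by rewrite [RHS]s_const // ?/crossing_at ?E ?n1 ?n2 // /succ_pt /step up E n1 n2.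
  by rewrite down_const ?nx ?up // /succ_pt /step nx up /= E.
Qed.

(** The sum telescopes, and there are no strands below and above the diagram. *)
Lemma twist_sum : \sum_(t < size D) twist t = 0.
Proof.
have E m : (m <= size D)%N -> \sum_(t < m) twist t = pot_at 0%N - pot_at m.
  elim: m => [|m IH] mD; first by rewrite big_ord0 subrr.
  by rewrite big_ord_recr /= IH ?pot_step // ?(ltnW mD) //; rewrite -(pot_step mD); ring.
by rewrite E // level_size // /level take0.
Qed.
End TwistSum.

(** * Comparison of two state sums *)

Section Comparison.
Variables (k : fieldType) (D : diagram) (cs : seq (seq point)).
Hypothesis Dlink : link_diagram D.
Variables (R1 : bool -> bool -> bool -> bool -> bool -> k).
Local Notation B2 := (bool * bool)%type.
Variables (R2 : bool -> B2 -> B2 -> B2 -> B2 -> k).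
Variables (g1 : bool -> k) (g2 : B2 -> k) (r : k).
Hypothesis r_neq0 : r != 0.
Hypothesis g2E : forall a, g2 a = g1 a.1 * g1 a.2.
Hypothesis R1_cons : forall pos a a' b b', R1 pos a a' b b' != 0 -> wt a + wt b = wt a' + wt b'.
Hypothesis R2_pos : forall a a' b b', R2 true a a' b b' =
  R1 true a.1 a'.1 b.1 b'.1 * R1 true a.2 a'.2 b.2 b'.2 *
  r ^ (wt b.1 * wt a.2 - wt a'.1 * wt b'.2).
Hypothesis R2_neg : forall a a' b b', R2 false a a' b b' =
  R1 false a.1 a'.1 b.1 b'.1 * R1 false a.2 a'.2 b.2 b'.2 *
  r ^ (wt a.1 * wt b.2 - wt b'.1 * wt a'.2).

Local Notation fs s := (fun x => (s x).1).
Local Notation sn s := (fun x => (s x).2).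

Lemma gfac_pair x n a b : gfac D g2 x n a b = gfac D g1 x n a.1 b.1 * gfac D g1 x n a.2 b.2.
Proof.
rewrite /gfac; case: (step D x).2 => [|t o|m lr]; rewrite ?mulr1 //.
by rewrite !g2E !expfzMl mulrACA.
Qed.

Lemma gcyc_pair (s : nat * nat -> B2) c :
  gcyc g2 D s c = gcyc g1 D (fs s) c * gcyc g1 D (sn s) c.
Proof.
have W c' b : gcwt g2 D s c' b = gcwt g1 D (fs s) c' b.1 * gcwt g1 D (sn s) c' b.2.
  elim: c' => [|x [|y p] IH]; first by rewrite mulr1.
    by rewrite /= gfac_pair !mulr1.
  by rewrite !gcwt2 IH gfac_pair mulrACA.
by case: c => [|x p]; rewrite /gcyc ?mulr1 // W g2E expfzMl mulrACA.
Qed.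

Lemma dfac_pair (s : nat * nat -> B2) t : dfac k D s t = dfac k D (fs s) t * dfac k D (sn s) t.
Proof.
rewrite /dfac -big_split; apply: eq_bigr => p _ /=.
by rewrite -natrM mulnb.
Qed.

Lemma rfac_pair (s : nat * nat -> B2) t :
  rfac D R2 s t = rfac D R1 (fs s) t * rfac D R1 (sn s) t * r ^ twist D s t.
Proof.
rewrite /rfac /twist; case: (event_at D t) => [i lr|i lr|i [|]]; rewrite ?expr0z ?mulr1 //.
Qed.

(** If one of the rank one weights vanishes, so does the rank two weight. Otherwise no
    local factor vanishes, so both labelings are constant along strands and conserved
    at the crossings, and then the exponents add up to zero by twist_sum. *)
Lemma lab_weight_pair (s : nat * nat -> B2) :
  lab_weight D R2 s = lab_weight D R1 (fs s) * lab_weight D R1 (sn s).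
Proof.
have E : lab_weight D R2 s = lab_weight D R1 (fs s) * lab_weight D R1 (sn s) *
    r ^ (\sum_(t < size D) twist D s t).
  rewrite /lab_weight -big_split /=.
  elim/big_ind3: _ => [|x1 x2 x3 y1 y2 y3 -> ->|t _]; first by rewrite mul1r.
    by rewrite expfzDr //; ring.
  by rewrite dfac_pair rfac_pair; ring.
rewrite E; case: (eqVneq (lab_weight D R1 (fs s) * lab_weight D R1 (sn s)) 0) => [-> | nz].
  by rewrite mul0r.
have [n1 n2] : lab_weight D R1 (fs s) != 0 /\ lab_weight D R1 (sn s) != 0.
  by apply/andP; rewrite -negb_or -mulf_eq0.
have V (s' : nat * nat -> bool) : lab_weight D R1 s' != 0 -> forall t, (t < size D)%N ->
    dfac k D s' t != 0 /\ rfac D R1 s' t != 0.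
  move=> /prodf_neq0 nz' t tD; have := nz' (Ordinal tD) isT.
  by rewrite mulf_eq0 negb_or => /andP.
have C (s' : nat * nat -> bool) t p : lab_weight D R1 s' != 0 ->
    (t < size D)%N -> (p < size (level D t))%N ->
    ~~ crossing_at D t p -> s' (t, p) = s' (succ_pt D (t, p)).
  move=> nz' tD pl nc; have [+ _] := V _ nz' t tD.
  rewrite /dfac prodf_seq_neq0 => /allP /(_ p); rewrite mem_iota nc pl => /(_ isT).
  by case: (s' (t, p) =P s' (succ_pt D (t, p))) => // _; rewrite eqxx.
have K (s' : nat * nat -> bool) t i pos : lab_weight D R1 s' != 0 ->
    (t < size D)%N -> event_at D t = Crossing i pos ->
    wt (s' (t, i)) + wt (s' (t, i.+1)) = wt (s' (t.+1, i)) + wt (s' (t.+1, i.+1)).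
  move=> nz' tD Ev; have [_ +] := V _ nz' t tD.
  rewrite /rfac Ev; case: pos {Ev} => /R1_cons; first by move=> ->; rewrite addrC.
  by rewrite addrC.
rewrite twist_sum ?expr0z ?mulr1 //.
- move=> t p tD pl nc; apply/eqP; rewrite -pair_eqE /pair_eq /=.
  by rewrite (C _ t p n1) // (C _ t p n2) // !eqxx.
- by move=> t i pos; exact: K n1.
- by move=> t i pos; exact: K n2.
Qed.

Lemma gcyc_ext (g : bool -> k) (s s' : nat * nat -> bool) c : s =1 s' -> gcyc g D s c = gcyc g D s' c.
Proof.
move=> E; have W c' b : gcwt g D s c' b = gcwt g D s' c' b.
  elim: c' => [|x [|y p] IH] //; first by rewrite /= E.
  by rewrite !gcwt2 IH !E.
by case: c => [|x p] //; rewrite /gcyc W !E.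
Qed.

Lemma lab_weight_ext (s s' : nat * nat -> bool) : s =1 s' -> lab_weight D R1 s = lab_weight D R1 s'.
Proof.
move=> E; apply: eq_bigr => t _; congr (_ * _).
  by apply: eq_bigr => p _; rewrite !E.
by rewrite /rfac; case: (event_at D t) => [//|//|i [|]]; rewrite !E.
Qed.

Lemma labels_square :
  sumlab (fun _ => (false, false)) (flatten cs) (fun s =>
    (\prod_(c <- cs) gcyc g2 D s c) * lab_weight D R2 s) =
  (sumlab (fun _ => false) (flatten cs) (fun s =>
    (\prod_(c <- cs) gcyc g1 D s c) * lab_weight D R1 s)) ^+ 2.
Proof.
rewrite expr2 -sumlab_pair.
- apply: eq_sumlab => s; rewrite lab_weight_pair mulrACA; congr (_ * _).
  by rewrite -big_split; apply: eq_bigr => c _; exact: gcyc_pair.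
- by move=> s s' E; rewrite (lab_weight_ext E); congr (_ * _); apply: eq_bigr => c _; exact: gcyc_ext.
- by move=> s s' E; rewrite (lab_weight_ext E); congr (_ * _); apply: eq_bigr => c _; exact: gcyc_ext.
Qed.
End Comparison.

(** * The Hopf algebra laws of the Taft algebras *)

Section TaftHopf.
Variables (k : fieldType) (q : k) (l n : nat) (A : taft q l n).
Hypothesis l_gt0 : (0 < l)%N.
Local Notation H := (taft_hopf A).
Local Notation K := (tK A).
Local Notation X := (tx A).
Local Notation S := (@antip _ H).

Lemma falgE (a b : H) : a ** b = (a : A) * b.
Proof.
rewrite /= lift2T //; split=> [w | v'] c x y; first by rewrite mulrDl scalerAl.
by rewrite mulrDr scalerAr.
Qed.

Lemma monomialsE (m : exponents l n * exponents l n) :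
  (monomials l K X)`_(enum_rank m) = monomial K X m.
Proof.
rewrite (nth_map m) ?nth_enum_rank // -cardE; exact: ltn_ord.
Qed.

Lemma monomial_exp (a : A) :
  a = \sum_(m : exponents l n * exponents l n)
        coord (monomials l K X) (enum_rank m) a *: monomial K X m.
Proof.
rewrite {1}(coord_basis (taft_basis A) (memvf a)) (reindex enum_rank) /=; last first.
  exact: onW_bij (enum_rank_bij _).
by apply: eq_bigr => m _; rewrite monomialsE.
Qed.

(** Each law below is a linear or multiplicative condition on one element, which the
    presentation only grants on generators; the monomial basis shows that the
    generators generate. *)
Lemma taft_ind (P : A -> Prop) : P 1 -> (forall a x y, P x -> P y -> P (a *: x + y)) ->
  (forall x y, P x -> P y -> P (x * y)) -> (forall i, P (K i)) -> (forall i, P (X i)) ->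
  forall a, P a.
Proof.
move=> P1 PL PM PK PX.
have P0 : P 0 by have := PL (-1) 1 1 P1 P1; rewrite scaleN1r addNr.
have Pe x j : P x -> P (x ^+ j).
  by move=> Px; elim: j => [|j IH]; rewrite ?expr0 // exprS; exact: PM.
move=> a; rewrite (monomial_exp a).
apply: (big_ind P) => [//|x y Px Py|m _]; first by rewrite -[x]scale1r; exact: PL.
rewrite -[_ *: _]addr0; apply: PL => //.
by apply: (PM); apply: (big_ind P) => [//|//|i _]; exact: Pe.
Qed.

Lemma sw2_K (U : vectType k) i (f : H -> H -> U) : bilin f -> sw2 (K i : H) f = f (K i) (K i).
Proof. by move=> fl; rewrite /sw2 /= tcomulK lift2T. Qed.
Lemma sw2_KV (U : vectType k) i (f : H -> H -> U) : bilin f ->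
  sw2 ((K i)^-1 : H) f = f (K i)^-1 (K i)^-1.
Proof. by move=> fl; rewrite /sw2 /= tcomulKV lift2T. Qed.
Lemma sw2_x (U : vectType k) i (f : H -> H -> U) : bilin f ->
  sw2 (X i : H) f = f (X i) 1 + f (K i) (X i).
Proof. by move=> fl; rewrite /sw2 /= tcomulx linearD /= !lift2T. Qed.
Lemma sw2_t1 (U : vectType k) (f : H -> H -> U) : bilin f -> sw2 (1 : H) f = f 1 1.
Proof. by move=> fl; rewrite /sw2 /= tcomul1 lift2T. Qed.

Lemma lift2_tmul (U : vectType k) (f : H -> H -> U) (s t : tensor_alg H H) : bilin f ->
  lift2 f (s ** t) = lift2 (fun a b => lift2 (fun c d => f (a ** c) (b ** d)) t) s.
Proof.
move=> fl; move: s; apply: tensor_ext => [| |a b]; try by lin.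
move: t; apply: tensor_ext => [| |c d]; try by lin.
rewrite mulTT lift2T; last by lin.
rewrite lift2T; last by lin.
by rewrite lift2T; last by lin.
Qed.

Lemma tsw2M (U : vectType k) (f : H -> H -> U) : bilin f -> forall h h' : H,
  sw2 (h ** h') f = sw2 h (fun a b => sw2 h' (fun c d => f (a ** c) (b ** d))).
Proof. by move=> fl h h'; rewrite falgE /sw2 /= tcomulM lift2_tmul. Qed.

Lemma tmulA (a b c : H) : a ** (b ** c) = (a ** b) ** c.
Proof. by rewrite !falgE mulrA. Qed.
Lemma tmul1 (a : H) : alg_one H ** a = a. Proof. by rewrite falgE mul1r. Qed.
Lemma tmulr1 (a : H) : a ** alg_one H = a. Proof. by rewrite falgE mulr1. Qed.

Lemma islin_eq (U : vectType k) (f g : H -> U) : islin f -> islin g ->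
  forall a x y, f x = g x -> f y = g y -> f (a *: x + y) = g (a *: x + y).
Proof. by move=> fl gl a x y e e'; rewrite fl gl e e'. Qed.

Lemma tcoassoc (U : vectType k) (f : H -> H -> H -> U) : trilin f -> forall h : H,
    sw2 h (fun a b => sw2 a (fun c d => f c d b)) =
    sw2 h (fun a b => sw2 b (fun c d => f a c d)).
Proof.
move=> fl h; move: U f fl; apply: (taft_ind (P := fun h : H => forall U f, trilin f ->
    sw2 h (fun a b => sw2 a (fun c d => f c d b)) =
    sw2 h (fun a b => sw2 b (fun c d => f a c d)) :> Vector.sort U)) h.
- by move=> U f fl; rewrite !sw2_t1; try by lin.
- move=> a x y Px Py U f fl; apply: (@islin_eq U (fun h => sw2 h (fun a b => sw2 a (fun c d => f c d b)))
   (fun h => sw2 h (fun a b => sw2 b (fun c d => f a c d)))); [lin | lin | exact: Px | exact: Py].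
- move=> x y Px Py U f fl; rewrite -falgE !tsw2M; try by lin.
  transitivity (sw2 (y : H) (fun c d => sw2 c (fun c1 c2 => sw2 (x : H) (fun a b => sw2 a (fun a1 a2 =>
    f (a1 ** c1) (a2 ** c2) (b ** d)))))).
    rewrite sw2C; apply: eq_sw2 => c d; rewrite [RHS]sw2C; apply: eq_sw2 => a b.
    by rewrite tsw2M; [rewrite sw2C | lin].
  transitivity (sw2 (x : H) (fun a b => sw2 b (fun b1 b2 => sw2 (y : H) (fun c d => sw2 c (fun c1 c2 =>
    f (a ** c1) (b1 ** c2) (b2 ** d)))))).
    transitivity (sw2 (y : H) (fun c d => sw2 c (fun c1 c2 => sw2 (x : H) (fun a b => sw2 b (fun b1 b2 =>
    f (a ** c1) (b1 ** c2) (b2 ** d)))))).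
      apply: eq_sw2 => c d; apply: eq_sw2 => c1 c2.
      by apply: (Px _ (fun a1 a2 b => f (a1 ** c1) (a2 ** c2) (b ** d))); lin.
    under eq_sw2 do rewrite sw2C; rewrite sw2C; apply: eq_sw2 => a b.
    by under eq_sw2 do rewrite sw2C; rewrite sw2C.
  apply: eq_sw2 => a b.
  transitivity (sw2 b (fun b1 b2 => sw2 (y : H) (fun c d => sw2 d (fun d1 d2 =>
     f (a ** c) (b1 ** d1) (b2 ** d2))))).
    apply: eq_sw2 => b1 b2.
    by apply: (Py _ (fun c1 c2 d => f (a ** c1) (b1 ** c2) (b2 ** d))); lin.
  rewrite sw2C; apply: eq_sw2 => c d.
  by rewrite tsw2M; last by lin.
- by move=> i U f fl; rewrite !sw2_K; try by lin.
- move=> i U f fl; rewrite !sw2_x; try by lin.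
  by rewrite sw2_K ?sw2_t1 ?addrA //; lin.
Qed.

Lemma tcounitM (a b : H) : counit (a ** b) = counit a * counit b.
Proof. by rewrite falgE; apply: Defs.tcounitM. Qed.

Lemma tcounitl (h : H) : sw2 h (fun a b => (counit a : k) *: b) = h.
Proof.
apply: (taft_ind (P := fun h : H => sw2 h (fun a b => (counit a : k) *: b) = h)) h.
- by rewrite sw2_t1; [rewrite /= tcounit1 scale1r | lin].
- move=> a x y Px Py; apply: (@islin_eq H (fun h => sw2 h (fun a b => (counit a : k) *: b)) id) => //; lin.
- move=> x y Px Py; rewrite -falgE tsw2M; last by lin.
  rewrite -{2}Px -{2}Py (@sw2_lin _ _ _ _ (fun z => z ** _)); last by lin.
  apply: eq_sw2 => a b; rewrite (@sw2_lin _ _ _ _ (fun z => _ ** z)); last by lin.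
  by apply: eq_sw2 => c d; rewrite tcounitM mulZl mulZr scalerA.
- by move=> i; rewrite sw2_K; [rewrite /= tcounitK scale1r | lin].
- by move=> i; rewrite sw2_x; [rewrite /= tcounitK tcounitx scale1r scale0r add0r | lin].
Qed.

Lemma tcounitr (h : H) : sw2 h (fun a b => (counit b : k) *: a) = h.
Proof.
apply: (taft_ind (P := fun h : H => sw2 h (fun a b => (counit b : k) *: a) = h)) h.
- by rewrite sw2_t1; [rewrite /= tcounit1 scale1r | lin].
- move=> a x y Px Py; apply: (@islin_eq H (fun h => sw2 h (fun a b => (counit b : k) *: a)) id) => //; lin.
- move=> x y Px Py; rewrite -falgE tsw2M; last by lin.
  rewrite -{2}Px -{2}Py (@sw2_lin _ _ _ _ (fun z => z ** _)); last by lin.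
  apply: eq_sw2 => a b; rewrite (@sw2_lin _ _ _ _ (fun z => _ ** z)); last by lin.
  by apply: eq_sw2 => c d; rewrite tcounitM mulZl mulZr scalerA.
- by move=> i; rewrite sw2_K; [rewrite /= tcounitK scale1r | lin].
- by move=> i; rewrite sw2_x; [rewrite /= tcounit1 tcounitx scale1r scale0r addr0 | lin].
Qed.

Lemma tantipM' (a b : H) : S (a ** b) = S b ** S a.
Proof. by rewrite !falgE; apply: tantipM. Qed.

Lemma tantip_K i : S (K i : H) = (K i)^-1 :> A. Proof. exact: tantipK. Qed.
Lemma tantip_X i : S (X i : H) = - ((K i)^-1 * X i) :> A. Proof. exact: tantipx. Qed.
Lemma tantip_one : S (1 : H) = 1 :> A. Proof. exact: tantip1. Qed.

Lemma tantipL (h : H) : sw2 h (fun a b => S a ** b) = (counit h : k) *: alg_one H.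
Proof.
apply: (taft_ind (P := fun h : H => sw2 h (fun a b => S a ** b) = (counit h : k) *: alg_one H)) h.
- by rewrite sw2_t1; [rewrite tantip_one falgE mulr1 /= tcounit1 scale1r | lin].
- move=> a x y Px Py; apply: (@islin_eq H (fun h => sw2 h (fun a b => S a ** b))
     (fun h => (counit h : k) *: alg_one H)) => //; lin.
- move=> x y Px Py; rewrite -falgE tsw2M; last by lin.
  rewrite sw2C tcounitM mulrC -scalerA scalerA mulrC -scalerA -Py scale_sw2.
  apply: eq_sw2 => c d.
  transitivity (S c ** (sw2 (x : H) (fun a b => S a ** b)) ** d).
    rewrite (@sw2_lin _ _ _ _ (fun z => S c ** z ** d)); last by lin.
    by apply: eq_sw2 => a b; rewrite tantipM' !tmulA.
  by rewrite Px mulZr mulZl tmulr1.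
- by move=> i; rewrite sw2_K; [rewrite tantip_K falgE (rel_VK (taft_rel A)) /= tcounitK scale1r | lin].
- move=> i; rewrite sw2_x; last by lin.
  by rewrite tantip_K tantip_X !falgE mulr1 addNr /= tcounitx scale0r.
Qed.

Lemma tantipR (h : H) : sw2 h (fun a b => a ** S b) = (counit h : k) *: alg_one H.
Proof.
apply: (taft_ind (P := fun h : H => sw2 h (fun a b => a ** S b) = (counit h : k) *: alg_one H)) h.
- by rewrite sw2_t1; [rewrite tantip_one falgE mulr1 /= tcounit1 scale1r | lin].
- move=> a x y Px Py; apply: (@islin_eq H (fun h => sw2 h (fun a b => a ** S b))
     (fun h => (counit h : k) *: alg_one H)) => //; lin.
- move=> x y Px Py; rewrite -falgE tsw2M; last by lin.
  rewrite tcounitM mulrC -scalerA -Px scale_sw2.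
  apply: eq_sw2 => a b.
  transitivity (a ** (sw2 (y : H) (fun c d => c ** S d)) ** S b).
    rewrite (@sw2_lin _ _ _ _ (fun z => a ** z ** S b)); last by lin.
    by apply: eq_sw2 => c d; rewrite tantipM' !tmulA.
  by rewrite Py mulZr mulZl tmulr1.
- by move=> i; rewrite sw2_K; [rewrite tantip_K falgE (rel_KV (taft_rel A)) /= tcounitK scale1r | lin].
- move=> i; rewrite sw2_x; last by lin.
  rewrite tantip_one tantip_X !falgE mulr1 mulrN mulrA (rel_KV (taft_rel A)) mul1r subrr /= tcounitx scale0r //.
Qed.

(** Finite dimension turns surjectivity of the antipode into bijectivity, and the image
    contains the generators and is closed under products. *)
Lemma antip_surj (a : H) : exists b, S b = a.
Proof.
apply: (taft_ind (P := fun a : H => exists b, S b = a)) a.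
- by exists 1; exact: tantip_one.
- by move=> c _ _ [x <-] [y <-]; exists (c *: x + y); rewrite linearP.
- by move=> _ _ [x <-] [y <-]; exists (y ** x); rewrite tantipM' falgE.
- by move=> i; exists (K i)^-1; exact: tantipKV.
- move=> i; exists (- (X i : H) ** (K i)^-1).
  rewrite tantipM' !falgE linearN /= tantipKV tantipx opprK mulrA.
  by rewrite (rel_KV (taft_rel A)) mul1r.
Qed.

Lemma tantipK' : cancel S (antipV H).
Proof. by apply: lker0_lfunK; apply: surj_lker0; exact: antip_surj. Qed.
Lemma tantipVK : cancel (antipV H) S.
Proof. by apply: lker0_lfunVK; apply: surj_lker0; exact: antip_surj. Qed.

Lemma tsw2S (U : vectType k) (f : H -> H -> U) : bilin f -> forall h : H,
    sw2 (S h) f = sw2 h (fun a b => f (S b) (S a)).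
Proof.
move=> fl h; move: U f fl; apply: (taft_ind (P := fun h : H => forall U f, bilin f ->
    sw2 (S h) f = sw2 h (fun a b => f (S b) (S a)) :> Vector.sort U)) h.
- by move=> U f fl; rewrite tantip_one !sw2_t1 ?tantip_one //; lin.
- move=> a x y Px Py U f fl; apply: (@islin_eq U (fun h => sw2 (S h) f)
   (fun h => sw2 h (fun a b => f (S b) (S a)))); [lin | lin | exact: Px | exact: Py].
- move=> x y Px Py U f fl; rewrite -falgE tantipM' !tsw2M; try by lin.
  rewrite Py; last by lin.
  rewrite [RHS]sw2C; apply: eq_sw2 => c d.
  rewrite Px; last by lin.
  by apply: eq_sw2 => a b; rewrite !tantipM'.
- move=> i U f fl; rewrite tantip_K sw2_K ?tantip_K; last by lin.
  by rewrite /sw2 /= tcomulKV lift2T.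
- move=> i U f fl; rewrite [RHS]sw2_x; last by lin.
  have SX' : S (X i : H) = (-1) *: (((K i)^-1 : H) ** (X i : H)) by rewrite scaleN1r falgE tantip_X.
  rewrite tantip_one SX' tantip_K sw2Z tsw2M; last by lin.
  rewrite sw2_KV; last by lin.
  rewrite sw2_x; last by lin.
  rewrite !falgE mulr1 (rel_VK (taft_rel A)) scaleN1r.
  have fN1 x y : f (- x) y = - f x y by rewrite -scaleN1r (@islinZ _ _ _ (fun z => f z y)) ?scaleN1r //; lin.
  have fN2 x y : f x (- y) = - f x y by rewrite -scaleN1r (@islinZ _ _ _ (fun z => f x z)) ?scaleN1r //; lin.
  by rewrite !scaleN1r fN1 fN2 opprD addrC.
Qed.

Lemma tcounitS (h : H) : counit (S h) = counit h.
Proof.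
apply: (taft_ind (P := fun h : H => counit (S h) = counit h)) h.
- by rewrite tantip_one.
- by move=> a x y Px Py; apply: (@islin_eq _ (fun h => counit (S h)) (fun h => counit h)) => //; lin.
- by move=> x y Px Py; rewrite -falgE tantipM' !tcounitM Px Py mulrC.
- by move=> i; rewrite tantip_K /= tcounitKV tcounitK.
- move=> i; have SX' : S (X i : H) = (-1) *: (((K i)^-1 : H) ** (X i : H)) by rewrite scaleN1r falgE tantip_X.
  rewrite SX' (@islinZ _ _ _ (fun z : H => counit z)); last by lin.
  by rewrite tcounitM /= tcounitx mulr0 scaler0.
Qed.

Lemma taft_hopf_laws : hopf_laws H.
Proof.
split.
- exact: tmulA.
- exact: tmul1.
- exact: tmulr1.
- exact: tcoassoc.
- exact: tcounitl.
- exact: tcounitr.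
- exact: tsw2M.
- exact: tcomul1.
- exact: tcounitM.
- exact: tcounit1.
- exact: tantipL.
- exact: tantipR.
- exact: tantipM'.
- exact: tantip_one.
- exact: tantipK'.
- exact: tantipVK.
- exact: tsw2S.
- exact: tcounitS.
Qed.
End TaftHopf.

(** * Characters and twisted actions of the Taft algebras *)

Section TaftAction.
Variables (k : fieldType) (q : k) (l n : nat) (A : taft q l n).
Hypothesis l_gt0 : (0 < l)%N.
Hypothesis q_l : q ^+ l = 1.
Local Notation H := (taft_hopf A).
Local Notation K := (tK A).
Local Notation X := (tx A).
Local Notation S := (@antip _ H).
Local Notation S' := (antipV H).
Local Notation L := (taft_hopf_laws A).

Lemma q_neq0 : q != 0.
Proof.
by apply: contraPneq q_l => ->; rewrite expr0n gtn_eqF // => /eqP; rewrite eq_sym oner_eq0.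
Qed.

(** The form calK is given on the monomial basis. The algebra map to the field defined by
    the universal property takes the same values on monomials. *)
Lemma calK_morph (a : lattice n) : exists f : {lrmorphism A -> k^o},
  [/\ forall h, calK A a h = f h, forall i, f (K i) = q ^ (a 0 i) & forall i, f (X i) = 0].
Proof.
have Q (z : int) : q ^ z != 0 by rewrite expfz_neq0 // q_neq0.
have rels : taft_relations q l (fun i : 'I_n => q ^ (a 0 i) : k^o)
    (fun i => q ^ (- a 0 i) : k^o) (fun _ => 0 : k^o).
  split=> [i j|i|i|i|i j|i j|i].
  - by rewrite mulrC.
  - by rewrite -invr_expz (@mulfV k).
  - by rewrite -invr_expz (@mulVf k).
  - by rewrite -[LHS]/((q ^ a 0 i : k) ^+ l) exprnP exprzAC -exprnP q_l exp1rz.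
  - by rewrite mulr0 mul0r scaler0.
  - by rewrite !mulr0 scaler0.
  - by rewrite expr0n gtn_eqF.
have [f [fK _ fX]] := taft_univ A rels; exists f; split=> // h.
have fl : islin f by move=> c x y; rewrite linearP.
rewrite /calK linfunK; last first.
  move=> c x y; rewrite scaler_sumr -big_split; apply: eq_bigr => m _ /=.
  by rewrite linearP /= mulrDl -mulrA.
rewrite [in RHS](monomial_exp h) (islin_sum fl); apply: eq_bigr => m _.
rewrite (islinZ fl); congr (_ * _).
have fX' : f (\prod_(i < n) X i ^+ m.1 i) = \prod_(i < n) (0 : k) ^+ m.1 i.
  by rewrite rmorph_prod; apply: eq_bigr => i _; rewrite rmorphXn /= fX.
have fK' : f (\prod_(i < n) K i ^+ m.2 i) = \prod_(i < n) q ^ (a 0 i * (m.2 i)%:Z).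
  by rewrite rmorph_prod; apply: eq_bigr => i _; rewrite rmorphXn /= fK -exprz_exp.
rewrite /monomial rmorphM /= fX' fK'; case: ifP => [/forallP m0|/forallPn [i mi]].
  rewrite [X in _ = X * _]big1 => [|i _]; last by rewrite (eqP (m0 i)).
  rewrite mul1r /pairing; elim/big_rec2: _ => [|i x y _ <-]; first by rewrite expr0z.
  by rewrite expfzDr ?q_neq0 // !mxE.
by rewrite (bigD1 i) //= expr0n (negPf mi) !mul0r.
Qed.

Lemma calK_char a : is_char (calK A a : ldual H).
Proof.
have [f [fE _ _]] := calK_morph a; split; first by rewrite fE rmorph1.
by move=> x y; rewrite falgE !fE rmorphM.
Qed.

Lemma calK_K a i : calK A a (K i) = q ^ (a 0 i).
Proof. by have [f [fE fK _]] := calK_morph a; rewrite fE fK. Qed.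

Lemma calK_X a i : calK A a (X i) = 0.
Proof. by have [f [fE _ fX]] := calK_morph a; rewrite fE fX. Qed.

Lemma char_ext (chi chi' : ldual H) : is_char chi -> is_char chi' ->
  (forall i, chi (K i) = chi' (K i)) -> (forall i, chi (X i) = chi' (X i)) -> chi = chi'.
Proof.
move=> [c1 cM] [c1' cM'] cK cX; apply/lfunP => h.
apply: (taft_ind (P := fun h : H => chi h = chi' h)) h => //.
- by rewrite c1 c1'.
- by move=> a x y ex ey; rewrite !linearP /= ex ey.
- by move=> x y ex ey; rewrite -falgE cM cM' ex ey.
Qed.

Lemma grouplike_K i : grouplike (K i : H).
Proof. by split; [exact: tcomulK | exact: tcounitK]. Qed.

Lemma char_exp_calK a : char_exp (calK A a : ldual H) l = counit.
Proof.
have cP := calK_char a.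
apply: char_ext => [||i|i]; [exact: char_expP L _ cP _ | exact: is_char_eps L | |].
  rewrite (char_exp_g _ (grouplike_K i)) calK_K [RHS]tcounitK.
  by rewrite exprnP exprzAC -exprnP q_l exp1rz.
rewrite [RHS]tcounitx.
have E m : char_exp (calK A a : ldual H) m (X i : H) = 0 :> k.
  elim: m => [|m IH]; first exact: tcounitx.
  rewrite [char_exp _ _]/= dual_mulE sw2_x; last by lin.
  by rewrite IH calK_X mul0r mulr0 addr0.
exact: E.
Qed.

Lemma antip_KV i : S ((K i)^-1 : H) = K i :> A. Proof. exact: tantipKV. Qed.

Lemma antipV_K i : S' (K i : H) = (K i)^-1 :> A.
Proof. by rewrite -[RHS](@tantipK' _ _ _ _ A) antip_KV. Qed.

Lemma antipV_X i : S' (X i : H) = - (X i * (K i)^-1) :> A.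
Proof.
have E : S (- (X i * (K i)^-1) : H) = X i :> A.
  rewrite linearN /= tantipM tantipKV tantipx mulrN opprK mulrA.
  by rewrite (rel_KV (taft_rel A)) mul1r.
by rewrite -[RHS](@tantipK' _ _ _ _ A) E.
Qed.

Lemma K_X i j : K i * X j = (theta q (epsilon i) (epsilon j) * q ^+ (i == j)) *: (X j * K i).
Proof. by rewrite scalerAl -(rel_Kx (taft_rel A)) -!mulrA (rel_VK (taft_rel A)) mulr1. Qed.

Lemma antip2_X i : S (S (X i : H)) = q^-1 *: X i :> A.
Proof.
rewrite /= tantipx linearN /= tantipM tantipKV tantipx mulNr opprK -mulrA.
have E := K_X i i; rewrite eqxx expr1 /theta subrr expr0z mul1r in E.
apply: (scalerI q_neq0); rewrite scalerA mulfV ?q_neq0 // scale1r scalerAr -E.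
by rewrite mulrA (rel_VK (taft_rel A)) mul1r.
Qed.

Section Bullet.
Variable a : lattice n.
Local Notation chi := (calK A a : ldual H).
Local Notation bul := (bullet chi).

Lemma bullet_K i (m : A) : bul (K i : H) m = q ^ (a 0 i) *: (K i * m * (K i)^-1) :> A.
Proof.
by rewrite bullet_grouplike; [rewrite calK_K !falgE antipV_K | exact: grouplike_K].
Qed.

Lemma bullet_X i (m : A) : bul (X i : H) m =
  q ^ (a 0 i) *: (X i * m * (K i)^-1) - m * X i * (K i)^-1 :> A.
Proof.
rewrite bulletE sw2_x; last by lin.
rewrite (hit_chi1 L (calK_char a)) antipV_K antipV_X !falgE mul1r mulrN mulrA addrC; congr (_ - _).
rewrite hit_chiE sw2_x; last by lin.
by rewrite calK_X scale0r add0r calK_K -!scalerAl.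
Qed.
End Bullet.
End TaftAction.

(** * Simple modules over the double of a Taft algebra *)

Section TaftModule.
Variables (k : fieldType) (q : k) (l n : nat) (A : taft q l n).
Hypothesis l_gt0 : (0 < l)%N.
Hypothesis q_l : q ^+ l = 1.
Local Notation H := (taft_hopf A).
Local Notation D := (drinfeld_double H).
Local Notation K := (tK A).
Local Notation X := (tx A).
Local Notation S' := (antipV H).
Local Notation L := (taft_hopf_laws A).
Local Notation R := (double_R H).
Local Notation u := (drinfeld_u R).
Variable a : lattice n.
Local Notation chi := (calK A a : ldual H).
Local Notation bul := (bullet chi).
Local Notation rho := (yd_act chi).
Local Notation chiP := (calK_char A l_gt0 q_l a).
Variable g : H.
Hypothesis gP : grouplike g.
Variables (I : finType) (f : I -> H) (lam : I -> ldual H) (w : 'I_n -> I -> k).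
Hypothesis fK : forall i b, bul (K i : H) (f b) = w i b *: f b.
Hypothesis fX : forall i b, exists c b', bul (X i : H) (f b) = c *: f b'.
Hypothesis lamf : forall b c, lam b (f c) = (b == c)%:R :> k.
Variable b0 : I.
Hypothesis fb0 : f b0 = g.
Hypothesis fW : forall b, f b \in bullet_space chi g.

(** The span of the f b contains the generator g and is stable under the generators of
    the algebra, hence is the whole module. *)
Lemma taft_expW m : m \in bullet_space chi g -> m = \sum_b (lam b m : k) *: f b.
Proof.
pose T (m : H) := m = \sum_b (lam b m : k) *: f b.
have Tl c x y : T x -> T y -> T (c *: x + y).
  rewrite /T => {1}-> {1}->; rewrite scaler_sumr -big_split; apply: eq_bigr => b _ /=.
  by rewrite scalerA -scalerDl linearP.
have T0 : T 0 by rewrite /T big1 // => b _; rewrite linear0 scale0r.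
have Tf b : T (f b).
  rewrite /T (bigD1 b) //= lamf eqxx scale1r big1 ?addr0 // => c /negPf cb.
  by rewrite lamf cb scale0r.
have TZ c x : T x -> T (c *: x) by move=> Tx; rewrite -[_ *: _]addr0; exact: Tl.
have Tgen (h : H) : (forall b, T (bul h (f b))) -> forall z, T z -> T (bul h z).
  move=> Th z Tz; rewrite Tz (@islin_sum _ _ _ (fun z => bul h z)); last by lin.
  apply: (big_ind T) => [//|x y Tx Ty|b _]; first by rewrite -[x]scale1r; exact: Tl.
  by rewrite (@islinZ _ _ _ (fun z => bul h z)); [exact: TZ | lin].
have Tb h : forall z, T z -> T (bul h z).
  apply: (taft_ind (P := fun h : H => forall z, T z -> T (bul h z))) h.
  - by move=> z Tz; rewrite (bullet1 L chiP).
  - move=> c x y Tx Ty z Tz; have E : islin (fun h : H => bul h z) by lin.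
    by rewrite E; apply: Tl; [exact: Tx | exact: Ty].
  - by move=> x y Tx Ty z Tz; rewrite -falgE (bulletM L chiP); apply: (Tx); exact: Ty.
  - by move=> i; apply: Tgen => b; rewrite fK; exact: TZ.
  - by move=> i; apply: Tgen => b; have [c [b' ->]] := fX i b; exact: TZ.
by move=> /bullet_spaceP [h ->]; apply: Tb; rewrite -fb0; exact: Tf.
Qed.

Local Notation mu := (mcoef chi f lam).

Lemma taft_mcoefM d d' b c : mu (d ** d') b c = \sum_e mu d b e * mu d' e c.
Proof. exact: (mcoefM L chiP gP fW taft_expW). Qed.

Lemma mu_h h b c : mu (counit ⊗ h : D) b c = lam b (bul h (f c)).
Proof. by rewrite /mcoef (rho_h L). Qed.

Lemma mu_hK i b c : mu (counit ⊗ (K i : H) : D) b c = (b == c)%:R * w i c.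
Proof. by rewrite mu_h fK linearZ /= lamf /GRing.scale /= mulrC. Qed.

Lemma u_weight i b c : mu u b c * w i c = w i b * mu u b c.
Proof.
have E := congr1 (fun d => mu d b c) (u_antip2 L (counit ⊗ (K i : H) : D)).
have SSK : antip (antip (K i : H)) = (K i : H) by rewrite tantip_K antip_KV.
move: E; rewrite !(antipDh L) SSK.
by rewrite (diag_mulr taft_mcoefM _ _ _ (mu_hK i)) (diag_mull taft_mcoefM _ _ _ (mu_hK i)).
Qed.

(** The square of the antipode fixes every K i, so u commutes with them and preserves
    their joint eigenspaces, which are lines. *)
Lemma u_diag : (forall b c, b != c -> exists i, w i b != w i c) ->
  forall b c, mu u b c = (b == c)%:R * mu u c c.
Proof.
move=> wN b c; case: eqVneq => [->|/wN [i wi]]; first by rewrite mul1r.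
have /eqP := u_weight i b c; rewrite mulrC -subr_eq0 -mulrBl mulf_eq0 subr_eq0 eq_sym (negPf wi) /=.
by rewrite mul0r => /eqP.
Qed.

(** The square of the antipode multiplies X i by the inverse of q, so u changes by the
    factor q along each arrow of the module. *)
Lemma u_step i b c s : (forall b c, b != c -> exists i, w i b != w i c) ->
  bul (X i : H) (f b) = s *: f c -> s != 0 -> mu u b b = q * mu u c c.
Proof.
move=> wN fbc s0; have ud := u_diag wN.
have E := congr1 (fun d => mu d c b) (u_antip2 L (counit ⊗ (X i : H) : D)).
move: E; rewrite !(antipDh L) (antip2_X A l_gt0 q_l) tensZr mulZl.
rewrite (@islinZ _ _ _ (fun d => mu d c b : k^o)); last exact: lin_mcoef.
rewrite (diag_mull taft_mcoefM _ _ _ ud) (diag_mulr taft_mcoefM _ _ _ ud).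
rewrite !mu_h fbc linearZ /= lamf eqxx /GRing.scale /= mulr1 => E.
have q0 := q_neq0 l_gt0 q_l.
by apply: (mulIf s0); rewrite -mulrA E mulVKf // mulrC.
Qed.

(** On a vector where H acts through a character psi, the sum over dual bases that
    defines u contracts. *)
Lemma u_extremal (psi : ldual H) m : (forall h, bul h m = (psi h : k) *: m) ->
  rho u m = sw2 m (fun m0 m1 => (psi (S' m1) : k) *: m0).
Proof.
move=> pm; rewrite {1}(ev_dec u) (@islin_sum _ _ _ (fun d => rho d m)); last by lin.
transitivity (sw2 m (fun m0 m1 => \sum_(i < \dim {:H}) coord (vbasis {:H}) i m1 *:
    ((psi (S' (vbasis {:H})`_i) : k) *: m0))).
  rewrite -sum_sw2; apply: eq_bigr => i _.
  rewrite rhoT (ev_u L) pm dual_actE sw2Z scale_sw2; apply: eq_sw2 => m0 m1.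
  by rewrite !scalerA dual_basisE mulrC.
apply: eq_sw2 => m0 m1.
by rewrite -(dual_coord m1 (F := fun x => (psi (S' x) : k) *: m0)); last by lin.
Qed.

Lemma antip_u_grouplike : rho (antip u) g = (chi g : k)^-1 *: g.
Proof.
rewrite {1}(ev_dec u) linear_sum /= (@islin_sum _ _ _ (fun d => rho d g)); last by lin.
transitivity (bul (S' g) g).
  rewrite (dual_coord (S' g) (F := fun x => bul x g)); last by lin.
  apply: eq_bigr => i _; rewrite antipDT (rhoM L chiP) (rho_p L chiP) (rho_h L).
  rewrite dual_actE /sw2 (proj1 gP) lift2T; last by lin.
  rewrite comp_lfunE dual_basisE (@islinZ _ _ _ (fun x => bul _ x)); last by lin.
  by rewrite (ev_u L) (antipVK L).
have [gg gg'] := grouplike_inv L gP.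
have E : bul g g = (chi g : k) *: g by rewrite bullet_grouplike // -(hmulA L) gg (hmul1r L).
have c0 := chi_neq0 L gP chiP.
apply: (scalerI c0); rewrite scalerA mulfV // scale1r.
have F : bul (S' g) (bul g g) = g by rewrite -(bulletM L chiP) gg' (bullet1 L chiP).
by rewrite -[RHS]F E (@islinZ _ _ _ (fun x => bul (S' g) x)); last by lin.
Qed.

Variable v : D.
Hypothesis hv : ribbon_element R v.
Variable c : k.
Hypothesis vc : acts_as (bullet_mod chi g : hmod D) v c.

Lemma v_scalar m : m \in bullet_space chi g -> rho v m = c *: m.
Proof. exact: (acts_asE L chiP gP vc). Qed.

Lemma taft_mu_v b e : mu v b e = (b == e)%:R * c.
Proof. by rewrite /mcoef v_scalar // linearZ /= lamf /GRing.scale /= mulrC. Qed.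

(** The product u s(u) is evaluated on the group-like generator g, where s(u) acts by the
    inverse of chi(g). *)
Lemma c_square : (forall b c, b != c -> exists i, w i b != w i c) ->
  c ^+ 2 = mu u b0 b0 / chi g.
Proof.
move=> wN; have [_ vv _ _ _] := hv.
have := congr1 (fun d => mu d b0 b0) vv.
rewrite (diag_mull taft_mcoefM _ _ _ (taft_mu_v)) taft_mu_v eqxx mul1r -expr2 => ->.
rewrite (diag_mull taft_mcoefM _ _ _ (u_diag wN)); congr (_ * _).
rewrite /mcoef fb0 antip_u_grouplike linearZ /= -fb0 lamf eqxx /GRing.scale /= mulr1.
by [].
Qed.

(** The scalar of v is its eigenvalue on the group-like generator g, and the lth powers
    of chi and g are trivial. *)
Lemma c_root : (g : A) ^+ l = 1 -> c ^+ l = 1.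
Proof.
move=> gl; have E : counit (rho v g) = c :> k.
  rewrite v_scalar; last by have := fW b0; rewrite fb0.
  rewrite (@islinZ _ _ _ (fun z : H => counit z)); last by lin.
  by rewrite (proj2 gP) /GRing.scale /= mulr1.
have em m : elt_exp g m = (g : A) ^+ m :> A.
  elim: m => [|m IH]; first by rewrite expr0.
  by rewrite exprS -IH -falgE.
have el : elt_exp g l = alg_one H by rewrite em gl.
rewrite -E; apply: (central_scalar_root L hv chiP gP l_gt0 _ el).
  exact: char_exp_calK.
by rewrite -(chi_elt_exp g chiP l) el (proj1 chiP).
Qed.
Lemma Rcoef_true b b' e e' : Rcoef R mu true b b' e e' =
  sw2 (f e') (fun n0 n1 => lam b (bul n1 (f b')) * lam e n0 : k^o).
Proof.
by rewrite /Rcoef /mcoef (rho_R L chiP chiP (F := fun x y => lam b x * lam e y : k^o)); last by lin.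
Qed.
End TaftModule.

(** * Tables of the R-matrix and of its inverse *)

Section InverseTables.
Variables (k : fieldType) (T : finType).
Implicit Types (F G Q : T -> T -> T -> T -> k).

(** Matrix multiplication for tables indexed by row and column of the over-strand,
    followed by row and column of the under-strand. *)
Definition tmul F G b b' e e' : k := \sum_(p : T * T) F b p.1 e p.2 * G p.1 b' p.2 e'.

(** A left inverse of F agrees with any right inverse of F. So the table of the inverse
    R-matrix can be read off from a table that inverts that of the R-matrix. *)
Lemma tmul_unique F G Q :
  (forall b b' e e', tmul F G b b' e e' = (b == b')%:R * (e == e')%:R) ->
  (forall b b' e e', tmul Q F b b' e e' = (b == b')%:R * (e == e')%:R) ->
  forall b b' e e', G b b' e e' = Q b b' e e'.
Proof.
move=> FG QF b b' e e'.
transitivity (\sum_(z : T * T) tmul Q F b z.1 e z.2 * G z.1 b' z.2 e').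
  rewrite -[LHS](sum_deltal (b, e) (fun z => G z.1 b' z.2 e')); apply: eq_bigr => -[z w] _ /=.
  by rewrite QF -natrM mulnb.
transitivity (\sum_(x : T * T) Q b x.1 e x.2 * tmul F G x.1 b' x.2 e'); last first.
  rewrite -[RHS](sum_deltal (b', e') (fun z => Q b z.1 e z.2)); apply: eq_bigr => -[x y] _ /=.
  by rewrite FG mulrC -natrM mulnb [x == b']eq_sym [y == e']eq_sym.
rewrite /tmul; under eq_bigr do rewrite mulr_suml; rewrite exchange_big.
apply: eq_bigr => x _; rewrite mulr_sumr; apply: eq_bigr => z _ /=.
by rewrite mulrA.
Qed.
End InverseTables.

Section InverseCoef.
Variables (k : fieldType) (H : hopf k).
Hypothesis L : hopf_laws H.
Local Notation D := (drinfeld_double H).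
Local Notation DD := (tensor_alg D D).
Local Notation R := (double_R H).
Variables (I : finType) (mu : D -> I -> I -> k).
Hypothesis mu_lin : forall a b, islin (fun d => mu d a b : k^o).
Hypothesis muM : forall d d' a b, mu (d ** d') a b = \sum_c mu d a c * mu d' c b.
Hypothesis mu1 : forall a b, mu (alg_one D) a b = (a == b)%:R.

Definition tcoefs (t : tensor D D) (b b' e e' : I) : k :=
  lift2 (fun d d' => mu d b b' * mu d' e e' : k^o) t.

Lemma tcoefsM (s t : DD) b b' e e' : tcoefs (s ** t) b b' e e' = tmul (tcoefs s) (tcoefs t) b b' e e'.
Proof.
have Bl x y z w : bilin (fun d d' : D => mu d x y * mu d' z w : k^o) by split=> ?; lin.
rewrite /tmul; move: s; apply: (@tensor_ext k D D k^o) => [| |a c].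
- by rewrite /tcoefs; lin.
- by apply: lin_bigsum => p; rewrite /tcoefs; lin.
move: t; apply: (@tensor_ext k D D k^o) => [| |a' c'].
- by rewrite /tcoefs; lin.
- by apply: lin_bigsum => p; rewrite /tcoefs; lin.
rewrite mulTT /tcoefs lift2T // !muM big_distrlr /= pair_bigA /=.
apply: eq_bigr => -[x y] _ /=; rewrite !lift2T //; ring.
Qed.

Lemma Rcoef_inv b b' e e' :
  tmul (Rcoef R mu true) (Rcoef R mu false) b b' e e' = (b == b')%:R * (e == e')%:R.
Proof.
rewrite -[LHS]/(tmul (tcoefs R) (tcoefs (R_inv R)) b b' e e') -tcoefsM (R_invR L).
rewrite /tcoefs /= lift2T; last by split=> ?; lin.
by rewrite !mu1.
Qed.
End InverseCoef.

Section TaftInv.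
Variables (k : fieldType) (q : k) (l n : nat) (A : taft q l n).
Hypothesis l_gt0 : (0 < l)%N.
Hypothesis q_l : q ^+ l = 1.
Local Notation H := (taft_hopf A).
Local Notation D := (drinfeld_double H).
Local Notation L := (taft_hopf_laws A).
Local Notation R := (double_R H).
Local Notation u := (drinfeld_u R).
Variable a : lattice n.
Local Notation chi := (calK A a : ldual H).
Local Notation chiP := (calK_char A l_gt0 q_l a).
Variable g : H.
Hypothesis gP : grouplike g.
Variables (I : finType) (f : I -> H) (lam : I -> ldual H) (w : 'I_n -> I -> k).
Hypothesis fK : forall i b, bullet chi (tK A i : H) (f b) = w i b *: f b.
Hypothesis fX : forall i b, exists c b', bullet chi (tx A i : H) (f b) = c *: f b'.
Hypothesis lamf : forall b c, lam b (f c) = (b == c)%:R :> k.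
Variable b0 : I.
Hypothesis fb0 : f b0 = g.
Hypothesis fW : forall b, f b \in bullet_space chi g.
Local Notation mu := (mcoef chi f lam).
Hypothesis wN : forall b c, b != c -> exists i, w i b != w i c.
Variable U : I -> k.
Hypothesis U_neq0 : forall b, U b != 0.
Hypothesis U_u : forall b, mu u b b = U b.
Variables (v : D) (c : k).
Hypothesis hv : ribbon_element R v.
Hypothesis vc : acts_as (bullet_mod chi g : hmod D) v c.
Variables (Di : diagram) (cs : seq (seq point)).
Hypothesis Dlink : link_diagram Di.
Hypothesis csD : based_components Di cs.

Lemma taft_Inv : Inv R v (bullet_mod chi g) Di cs =
  sumlab (fun _ => b0) (flatten cs) (fun s =>
    (\prod_(d <- cs) gcyc (pivot U c) Di s d) * lab_weight Di (Rcoef R mu) s).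
Proof.
have EW := taft_expW l_gt0 q_l fK fX lamf fb0.
have M1 b e := mcoef1 L chiP lamf b e.
have MM := taft_mcoefM l_gt0 q_l gP fK fX lamf fb0 fW.
have Mu b e : mu u b e = (b == e)%:R * U e.
  by rewrite (u_diag l_gt0 q_l gP fK fX lamf fb0 fW wN) U_u.
have Mv := taft_mu_v l_gt0 q_l gP lamf fW vc.
apply: Inv_labels => //.
- by move=> d; rewrite (hchar_mcoef L chiP gP fW EW).
- by move=> z b e; apply: (mu_Gexp L hv MM M1 U_neq0 Mu Mv).
- by move=> z y i j; apply: (mu_Upow L hv MM M1 U_neq0 Mu Mv).
Qed.

Lemma taft_Rcoef_inv b b' e e' :
  tmul (Rcoef R mu true) (Rcoef R mu false) b b' e e' = (b == b')%:R * (e == e')%:R.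
Proof.
apply: (Rcoef_inv L); first exact: lin_mcoef.
  exact: (taft_mcoefM l_gt0 q_l gP fK fX lamf fb0 fW).
by move=> x y; exact: (mcoef1 L chiP lamf).
Qed.
End TaftInv.

(** * Actions of monomials *)

Section MonomialForms.
Variables (k : fieldType) (q : k) (l n : nat) (A : taft q l n).
Hypothesis l_gt0 : (0 < l)%N.
Hypothesis q_l : q ^+ l = 1.
Local Notation H := (taft_hopf A).
Local Notation K := (tK A).
Local Notation X := (tx A).
Local Notation S' := (antipV H).
Local Notation L := (taft_hopf_laws A).

Definition mono_coord (m : exponents l n * exponents l n) : ldual H :=
  linfun (fun h : A => coord (monomials l K X) (enum_rank m) h : k^o).

Lemma mono_coordE m m' : mono_coord m (monomial K X m') = (m == m')%:R :> k.
Proof.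
rewrite linfunK => [|c x y]; last by rewrite linearP.
rewrite -monomialsE coord_free ?(basis_free (taft_basis A)) //.
by rewrite (inj_eq enum_rank_inj) eq_sym.
Qed.

Lemma char_antipV (psi : ldual H) (h : H) : is_char psi -> grouplike h ->
  psi (S' h) = (psi h : k)^-1 :> k.
Proof.
move=> psiP hP; have n0 := chi_neq0 L hP psiP.
apply: (mulfI n0); rewrite mulfV // -(proj2 psiP) (proj1 (grouplike_inv L hP)).
exact: (proj1 psiP).
Qed.

Lemma grouplike_Kn i j : grouplike (K i ^+ j : H).
Proof.
elim: j => [|j IH]; first exact: grouplike1 L.
by rewrite exprS -(falgE (A := A)); apply: (grouplikeM L) => //; exact: grouplike_K.
Qed.

Lemma is_char_exp (psi : ldual H) (x : A) j : is_char psi -> psi (x ^+ j) = (psi x : k) ^+ j :> k.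
Proof.
move=> psiP; elim: j => [|j IH]; first exact: (proj1 psiP).
by rewrite exprS -(falgE (A := A)) (proj2 psiP) IH exprS.
Qed.

Lemma Kn_X i j m : K i ^+ m * X j =
  (theta q (epsilon i) (epsilon j) * q ^+ (i == j)) ^+ m *: (X j * K i ^+ m).
Proof.
elim: m => [|m IH]; first by rewrite !expr0 mul1r mulr1 scale1r.
rewrite [in LHS]exprSr -[LHS]mulrA K_X -scalerAr [X in _ *: X]mulrA IH -scalerAl -mulrA -exprSr.
by rewrite scalerA -exprS.
Qed.

Lemma bullet_Kn (a : lattice n) i j (m : H) (c : k) :
  bullet (calK A a : ldual H) (K i : H) m = c *: m ->
  bullet (calK A a : ldual H) (K i ^+ j : H) m = c ^+ j *: m.
Proof.
move=> E; have cP := calK_char A l_gt0 q_l a.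
elim: j => [|j IH]; first by rewrite scale1r; exact: (bullet1 L cP).
rewrite exprS -(falgE (A := A)) (bulletM L cP) IH.
by rewrite (@islinZ _ _ _ (fun z => bullet _ _ z)); [rewrite E scalerA exprSr | lin].
Qed.
Lemma bullet_char (a b : lattice n) (m : H) :
  (forall i, bullet (calK A a : ldual H) (K i : H) m = q ^ (b 0 i) *: m) ->
  (forall i, bullet (calK A a : ldual H) (X i : H) m = 0) ->
  forall h, bullet (calK A a : ldual H) h m = (calK A b h : k) *: m.
Proof.
move=> mK mX; have cP := calK_char A l_gt0 q_l a; have [d1 dM] := calK_char A l_gt0 q_l b.
apply: (taft_ind (P := fun h : H => bullet (calK A a : ldual H) h m = (calK A b h : k) *: m)).
- by rewrite (bullet1 L cP) d1 scale1r.
- move=> c x y ex ey; have bl : islin (fun h : H => bullet (calK A a : ldual H) h m) by lin.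
  by rewrite bl ex ey linearP scalerDl scalerA.
- move=> x y ex ey; rewrite -(falgE (A := A)) (bulletM L cP) dM ey.
  rewrite (@islinZ _ _ _ (fun z => bullet _ (x : H) z)); last by lin.
  by rewrite ex scalerA mulrC.
- by move=> i; rewrite calK_K.
- by move=> i; rewrite calK_X // scale0r.
Qed.

Lemma sw2_grouplike (U : vectType k) (h : H) (F : H -> H -> U) :
  grouplike h -> bilin F -> sw2 h F = F h h.
Proof. by move=> hP Fl; rewrite /sw2 (proj1 hP) lift2T. Qed.

(** The coproduct of X i m, with the factor m left unexpanded, so that products of
    several X i with a group-like element are expanded one factor at a time. *)
Lemma sw2_Xmul (U : vectType k) i (m : A) (F : H -> H -> U) : bilin F ->
  sw2 (X i * m : H) F = sw2 (m : H) (fun c d => F ((X i : H) ** c) d) +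
                        sw2 (m : H) (fun c d => F ((K i : H) ** c) ((X i : H) ** d)).
Proof.
move=> Fl; rewrite -(falgE (A := A)) tsw2M // sw2_x; last by lin.
by congr (_ + _); apply: eq_sw2 => c d; rewrite (hmul1l L).
Qed.

Lemma char_antipV_X (psi : ldual H) i (m : A) : is_char psi -> psi (X i) = 0 :> k ->
  psi (S' (X i * m : H)) = 0 :> k.
Proof.
move=> psiP pX; rewrite -(falgE (A := A)) (antipVM L) (proj2 psiP) antipV_X linearN /=.
by rewrite -(falgE (A := A)) (proj2 psiP) pX mul0r oppr0 mulr0.
Qed.
End MonomialForms.

Section Exponents.
Variables (k : fieldType) (l : nat) (q : k) (i0 : nat).
Hypothesis l_gt1 : (1 < l)%N.
Hypothesis l_odd : odd l.
Hypothesis q_prim : l.-primitive_root q.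
Hypothesis i0E : i0 = (l.+1 %/ 2)%N.
(** A fourth root of q in the group generated by q, since 2 i0 = 1 modulo l. All
    matrix entries below are powers of it, up to factors 1 - q. *)
Definition root4 : k := q ^+ (i0 * i0).
Local Notation r := root4.

Lemma i0_double : (i0 * 2 = l.+1)%N.
Proof. by rewrite i0E divnK // dvdn2 /= l_odd. Qed.
Lemma i0_gt1 : (1 < i0)%N. Proof. have := i0_double; case: (l) l_gt1 l_odd => [|[|[|m]]] //; lia. Qed.
Lemma i0_lt : (i0 < l)%N. Proof. have := i0_double; lia. Qed.
Local Notation ql := (prim_expr_order q_prim).
Lemma prim_root_neq0 : q != 0. Proof. by apply: (q_neq0 (ltnW l_gt1)); exact: ql. Qed.
Lemma root4_sq : r ^+ 2 = q ^+ i0.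
Proof. by rewrite /root4 -exprM -mulnA i0_double mulnS exprD exprM exprAC ql expr1n mulr1. Qed.
Lemma root4_pow4 : r ^+ 4 = q.
Proof. by rewrite (exprM r 2 2) root4_sq -exprM i0_double exprS ql mulr1. Qed.
Lemma root4_neq0 : r != 0. Proof. by rewrite /root4 expf_neq0 // prim_root_neq0. Qed.
Lemma root4_exp : r ^+ l = 1. Proof. by rewrite /root4 exprAC ql expr1n. Qed.
Lemma root4_sq_i0 : (r ^+ 2) ^+ i0 = r.
Proof. by rewrite -exprM mulnC i0_double exprS root4_exp mulr1. Qed.
Lemma exp_i0_pred : q ^+ (i0 - 1) = r ^- 2.
Proof.
apply: (mulIf prim_root_neq0); rewrite -exprSr subn1 prednK ?(ltnW i0_gt1) // -root4_sq -[X in _ * X]root4_pow4.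
by field; rewrite root4_neq0.
Qed.
Lemma prim_root_neq1 : q != 1.
Proof.
by apply: contraTneq l_gt1 => q1; have := prim_order_dvd q_prim 1; rewrite expr1 q1 eqxx dvdn1 => /eqP ->.
Qed.
Lemma prim_root_sq_neq1 : q ^+ 2 != 1.
Proof.
clear i0 i0E; rewrite -(prim_order_dvd q_prim); apply: contraL l_odd => /dvdn_leq /= l2.
have -> : l = 2%N by have := l2 isT; lia.
by [].
Qed.
End Exponents.

(** * The module of rank one *)

Section RankOne.
Variables (k : fieldType) (l : nat) (q : k) (i0 : nat).
Hypothesis l_gt1 : (1 < l)%N.
Hypothesis l_odd : odd l.
Hypothesis q_prim : l.-primitive_root q.
Hypothesis i0E : i0 = (l.+1 %/ 2)%N.
Local Notation r := (root4 q i0).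

(** The entry of the R-matrix in row b, column b' for the over-strand and row e, column
    e' for the under-strand. It is the R-matrix of the two-dimensional module of quantum
    sl2, up to a scalar. *)
Definition T1 (b b' e e' : bool) : k :=
  if (b == b') && (e == e') then (if b == e then r^-1 else r)
  else if [&& b, ~~ b', ~~ e & e'] then r^-1 * (1 - r ^+ 4) else 0.
Definition Q1 (b b' e e' : bool) : k :=
  if (b == b') && (e == e') then (if b == e then r else r^-1)
  else if [&& b, ~~ b', ~~ e & e'] then - (r ^- 3 * (1 - r ^+ 4)) else 0.

Lemma Q1T1 b b' e e' : tmul Q1 T1 b b' e e' = (b == b')%:R * (e == e')%:R.
Proof.
have root4_neq0 := root4_neq0 i0 l_gt1 q_prim.
rewrite /tmul -(pair_bigA _ (fun x y => Q1 b x e y * T1 x b' y e')) /= !big_bool /Q1 /T1.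
by case: b; case: b'; case: e; case: e'; rewrite /= ?mulr0 ?mul0r ?addr0 ?add0r ?mulr1 ?mulfV ?mulVf //; field.
Qed.

Lemma T1_cons b b' e e' : T1 b b' e e' != 0 -> wt b + wt e = wt b' + wt e'.
Proof. by rewrite /T1; case: b; case: b'; case: e; case: e'; rewrite /= ?eqxx. Qed.

Lemma Q1_cons b b' e e' : Q1 b b' e e' != 0 -> wt b + wt e = wt b' + wt e'.
Proof. by rewrite /Q1; case: b; case: b'; case: e; case: e'; rewrite /= ?eqxx. Qed.

(** The eigenvalues of u. *)
Definition U1 (b : bool) : k := if b then r else r ^+ 5.

Variable A : taft q l 1.
Local Notation H := (taft_hopf A).
Local Notation L := (taft_hopf_laws A).
Local Notation K := (tK A ord0).
Local Notation X := (tx A ord0).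
Local Notation a := ((i0 - 1)%N%:Z *: epsilon ord0 : lattice 1).
Local Notation chi := (calK A a : ldual H).
Local Notation g := (Kpow A (i0%:Z *: epsilon ord0) : H).
Local Notation bul := (bullet chi).
Local Notation l0 := (ltnW l_gt1).
Local Notation ql := (prim_expr_order q_prim).

Lemma g1E : g = K ^+ i0 :> A.
Proof. by rewrite /Kpow big_ord1 !mxE !eqxx mulr1. Qed.

(** The basis vector labelled by true is the image of the group-like one under X, up to
    a scalar. *)
Definition f1 (b : bool) : H := if b then X * K ^+ (i0 - 1) else K ^+ i0.

Lemma i0_lt' : (i0 < l)%N. Proof. exact: i0_lt l_gt1 l_odd q_prim i0E. Qed.
Lemma i01_lt : (i0 - 1 < l)%N. Proof. by apply: leq_ltn_trans i0_lt'; rewrite leq_subr. Qed.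

Definition m1 (b : bool) : exponents l 1 * exponents l 1 :=
  ([ffun => if b then Ordinal l_gt1 else Ordinal l0],
   [ffun => if b then Ordinal i01_lt else Ordinal i0_lt']).

Lemma f1E b : f1 b = monomial (tK A) (tx A) (m1 b) :> A.
Proof.
rewrite /monomial !big_ord1 !ffunE /f1; case: b => /=; first by rewrite expr1.
by rewrite expr0 mul1r.
Qed.

Definition lam1 (b : bool) : ldual H := mono_coord A (m1 b).

Lemma lam1f b c : lam1 b (f1 c) = (b == c)%:R :> k.
Proof.
rewrite f1E mono_coordE; congr (_%:R); congr nat_of_bool.
apply/eqP/eqP => [/(congr1 (fun m : exponents l 1 * exponents l 1 => m.1 ord0 : nat)) | -> //].
by rewrite !ffunE; case: b; case: c.
Qed.

Lemma KnX m : K ^+ m * X = q ^+ m *: (X * K ^+ m).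
Proof. by rewrite Kn_X /theta subrr expr0z eqxx expr1 mul1r. Qed.

Lemma chiK : q ^ (a 0 ord0) = r ^- 2.
Proof. by rewrite !mxE !eqxx mulr1 -exprnP (exp_i0_pred l_gt1 l_odd q_prim i0E). Qed.

Lemma KK : K * K^-1 = 1. Proof. exact: (rel_KV (taft_rel A)). Qed.

Lemma KnV m : (0 < m)%N -> K ^+ m * K^-1 = K ^+ (m - 1).
Proof. by case: m => // m _; rewrite exprSr -mulrA KK mulr1 subn1. Qed.

(** The weights of K on the basis. *)
Definition w1 (i : 'I_1) (b : bool) : k := if b then r ^+ 2 else r ^- 2.

Lemma f1K i b : bul (tK A i : H) (f1 b) = w1 i b *: f1 b.
Proof.
rewrite (ord1 i) (bullet_K l0 ql) chiK /f1 /w1; case: b.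
  have KX : K * X = q *: (X * K) by have := KnX 1; rewrite !expr1.
  have -> : K * (X * K ^+ (i0 - 1)) * K^-1 = q *: (X * K ^+ (i0 - 1)).
    rewrite mulrA KX -!scalerAl; congr (_ *: _).
    by rewrite -[X * K * _]mulrA -exprS exprSr -!mulrA KK mulr1.
  rewrite scalerA.
  congr (_ *: _); rewrite -[X in _ * X](root4_pow4 l_odd q_prim i0E); field.
  exact: root4_neq0 l_gt1 q_prim.
by rewrite -exprS (exprSr K) -mulrA KK mulr1.
Qed.

Definition s1 : k := r ^- 2 * (1 - r ^+ 4).

Lemma f1X0 : bul (X : H) (f1 false) = s1 *: f1 true.
Proof.
have i1 := i0_gt1 l_gt1 l_odd q_prim i0E.
rewrite (bullet_X l0 ql) chiK /f1 KnX -!scalerAl -!mulrA KnV ?(ltnW i1) // -scalerBl.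
congr (_ *: _); rewrite /s1 -(root4_sq l_odd q_prim i0E); field; exact: root4_neq0 l_gt1 q_prim.
Qed.

Lemma f1X1 : bul (X : H) (f1 true) = 0.
Proof.
rewrite (bullet_X l0 ql) chiK /f1 -[X * _ * X]mulrA KnX (exp_i0_pred l_gt1 l_odd q_prim i0E).
by rewrite -scalerAr -scalerAl mulrA subrr.
Qed.

Lemma s1_neq0 : s1 != 0.
Proof.
apply: mulf_neq0; first by rewrite invr_neq0 // expf_neq0 // (root4_neq0 _ l_gt1 q_prim).
by rewrite subr_eq0 eq_sym (root4_pow4 l_odd q_prim i0E) (prim_root_neq1 l_gt1 q_prim).
Qed.

Lemma f1X i b : exists c b', bul (tx A i : H) (f1 b) = c *: f1 b'.
Proof.
rewrite (ord1 i); case: b; last by exists s1, true; exact: f1X0.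
by exists 0, true; rewrite f1X1 scale0r.
Qed.

Lemma g1P : grouplike g.
Proof. by rewrite g1E; exact: grouplike_Kn. Qed.

Lemma f1_false : f1 false = g. Proof. by rewrite g1E. Qed.

Local Notation chiP := (calK_char A l0 ql a).

Lemma f1W b : f1 b \in bullet_space chi g.
Proof.
have gW : f1 false \in bullet_space chi g.
  by rewrite f1_false -[X in X \in _](bullet1 L chiP); exact: mem_bullet_space.
case: b => //; have -> : f1 true = s1^-1 *: bul (X : H) (f1 false).
  by rewrite f1X0 scalerA mulVf ?s1_neq0 // scale1r.
by rewrite f1_false; apply: memvZ; exact: mem_bullet_space.
Qed.

Lemma w1N b c : b != c -> exists i, w1 i b != w1 i c.
Proof.
move=> bc; have N : r ^+ 2 != r ^- 2.
  have root4_neq0 := root4_neq0 i0 l_gt1 q_prim; apply/eqP => E.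
  have := prim_root_neq1 l_gt1 q_prim; rewrite -(root4_pow4 l_odd q_prim i0E) (exprM r 2 2) expr2 {1}E.
  by rewrite mulVf ?eqxx // expf_neq0.
by exists ord0; move: N; rewrite /w1; case: b bc; case: c => // _; rewrite eq_sym.
Qed.
Local Notation mu := (mcoef chi f1 lam1).
Local Notation u := (drinfeld_u (double_R H)).

Lemma sw2_f1true (U : vectType k) (F : H -> H -> U) : bilin F ->
  sw2 (f1 true) F = F (f1 true) (K ^+ (i0 - 1)) + F (f1 false) (X * K ^+ (i0 - 1)).
Proof.
have i1 := i0_gt1 l_gt1 l_odd q_prim i0E.
move=> Fl; rewrite /f1 sw2_Xmul //; congr (_ + _).
  by rewrite sw2_grouplike; [rewrite falgE | exact: grouplike_Kn | lin].
rewrite sw2_grouplike; [|exact: grouplike_Kn | by lin].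
by rewrite !falgE -exprS subn1 prednK // ltnW.
Qed.

(** The exponents of K that occur in the coproduct are i0 and i0 - 1. Since 2 i0 = 1
    modulo l, the weights, which are squares of powers of r, turn into r or its inverse. *)
Lemma w1_exp b : (w1 ord0 b) ^+ i0 = r ^ wt b /\ (w1 ord0 b) ^+ (i0 - 1) = r ^ (- wt b).
Proof.
have i1 := i0_gt1 l_gt1 l_odd q_prim i0E; have rn := root4_neq0 i0 l_gt1 q_prim.
have E : (w1 ord0 b) ^+ i0 = r ^ wt b.
  by rewrite /w1 /wt; case: b; rewrite ?exprVn (root4_sq_i0 l_odd q_prim i0E).
split=> //; have w0 : w1 ord0 b != 0 by rewrite /w1; case: (b); rewrite ?invr_eq0 expf_neq0.
apply: (mulIf w0); rewrite -exprSr subn1 prednK ?(ltnW i1) // E /w1 /wt.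
by case: (b); rewrite ?opprK ?expr1z ?exprN1; field.
Qed.

Lemma f1Kn j b : bul (K ^+ j : H) (f1 b) = (w1 ord0 b) ^+ j *: f1 b.
Proof. by apply: (bullet_Kn l0 ql); exact: f1K. Qed.

Lemma lamZ (p : ldual H) (x : k) (h : H) : p (x *: h) = x * (p h : k) :> k.
Proof. by rewrite linearZ. Qed.

Lemma Rcoef1_true b b' e e' : Rcoef (double_R H) mu true b b' e e' = T1 b b' e e'.
Proof.
have [wi wj] := w1_exp b'; have rn := root4_neq0 i0 l_gt1 q_prim.
rewrite (Rcoef_true l0 ql); case: e'.
  rewrite sw2_f1true; last by lin.
  rewrite -(falgE (A := A)) (bulletM L chiP) !f1Kn wj !lam1f lamZ lam1f.
  rewrite (@islinZ _ _ _ (fun z => bul (X : H) z)) ?lamZ; last by lin.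
  case: b' {wi wj}; first by rewrite f1X1 linear0 /T1; case: b; case: e; rewrite /= ?mulr0 ?mul0r ?addr0 ?mulr1.
  rewrite f1X0 lamZ lam1f /s1 /T1.
  by case: b; case: e; rewrite /= ?mulr0 ?mul0r ?addr0 ?add0r ?mulr1 //; field.
rewrite sw2_grouplike; [|exact: grouplike_Kn|by lin].
rewrite f1Kn wi lamZ !lam1f /T1.
by case: b' {wi wj}; case: b; case: e; rewrite /= ?mulr0 ?mul0r ?addr0 ?add0r ?mulr1.
Qed.

Lemma Rcoef1_false b b' e e' : Rcoef (double_R H) mu false b b' e e' = Q1 b b' e e'.
Proof.
apply: (tmul_unique (F := Rcoef (double_R H) mu true)) => [x x' y y'|x x' y y'].
  exact: (taft_Rcoef_inv l0 ql g1P f1K f1X lam1f f1_false f1W).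
rewrite -Q1T1 /tmul; apply: eq_bigr => p _; by rewrite Rcoef1_true.
Qed.

Lemma mu_u1 b : mu u b b = U1 b.
Proof.
have E : mu u true true = r.
  rewrite /mcoef (u_extremal (psi := calK A (i0%:Z *: epsilon ord0))); last first.
    apply: (bullet_char l0 ql) => i; rewrite (ord1 i) ?f1X1 // f1K !mxE !eqxx mulr1.
    by rewrite /w1 -exprnP (root4_sq l_odd q_prim i0E).
  have pP := calK_char A l0 ql (i0%:Z *: epsilon ord0).
  rewrite sw2_f1true; last by lin.
  have pX : calK A (i0%:Z *: epsilon ord0) X = 0 by exact: (calK_X A l0 ql).
  rewrite (char_antipV_X (K ^+ (i0 - 1)) pP pX) scale0r addr0 lamZ lam1f mulr1.
  rewrite (char_antipV pP (grouplike_Kn A ord0 _)) (is_char_exp _ _ pP) (calK_K A l0 ql).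
  rewrite !mxE !eqxx mulr1 -exprnP -(root4_sq l_odd q_prim i0E) (proj2 (w1_exp true)).
  by rewrite exprN1 invrK.
case: b; rewrite /U1 //.
rewrite (u_step l0 ql g1P f1K f1X lam1f f1_false f1W w1N f1X0 s1_neq0) E.
by rewrite -[X in X * _](root4_pow4 l_odd q_prim i0E) -exprSr.
Qed.

Variables (v : drinfeld_double H) (c : k).
Hypothesis hv : ribbon_element (double_R H) v.
Hypothesis vc : acts_as (bullet_mod chi g : hmod (drinfeld_double H)) v c.

Lemma c1_square : c ^+ 2 = r ^+ 6.
Proof.
rewrite (c_square l0 ql g1P f1K f1X lam1f f1_false f1W hv vc w1N) mu_u1 /U1.
(* The generator is the power i0 of K, and chi takes the value r^-2 on K. *)
have -> : chi g = r^-1 :> k.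
  rewrite g1E (is_char_exp _ _ chiP) (calK_K A l0 ql) chiK.
  exact: (proj1 (w1_exp false)).
by rewrite invrK -exprSr.
Qed.

Lemma c1_root : c ^+ l = 1.
Proof.
apply: (c_root l0 ql g1P f1_false f1W hv vc).
by rewrite g1E exprAC (rel_Kl (taft_rel A)) expr1n.
Qed.

Lemma U1_neq0 b : U1 b != 0.
Proof. by have rn := root4_neq0 i0 l_gt1 q_prim; case: b => //; exact: expf_neq0. Qed.

Definition R1 (pos : bool) := if pos then T1 else Q1.

Lemma Inv1 Di cs : link_diagram Di -> based_components Di cs ->
  Inv (double_R H) v (taft_mod A a (i0%:Z *: epsilon ord0)) Di cs =
  sumlab (fun _ => false) (flatten cs) (fun s =>
    (\prod_(d <- cs) gcyc (pivot U1 c) Di s d) * lab_weight Di R1 s).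
Proof.
move=> LD BC.
rewrite /taft_mod (taft_Inv l0 ql g1P f1K f1X lam1f f1_false f1W w1N U1_neq0 mu_u1 hv vc LD BC).
apply: eq_sumlab => s; congr (_ * _).
by apply: lab_weight_eq => -[] b b' e e'; rewrite ?Rcoef1_true ?Rcoef1_false.
Qed.
End RankOne.

(** * The module of rank two *)

Section QCommute.
Variables (k : fieldType) (B : algType k).
Implicit Types (x y : B) (c : k).

(** Commutation up to a scalar passes to powers. *)
Lemma qcomm_expr c y x m : y * x = c *: (x * y) -> y * x ^+ m = c ^+ m *: (x ^+ m * y).
Proof.
move=> E; elim: m => [|m IH]; first by rewrite !expr0 mulr1 mul1r scale1r.
by rewrite exprSr mulrA IH -scalerAl -(mulrA _ y x) E -scalerAr mulrA scalerA -!exprSr.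
Qed.

Lemma qcomm_expl c y x m : y * x = c *: (x * y) -> y ^+ m * x = c ^+ m *: (x * y ^+ m).
Proof.
move=> E; elim: m => [|m IH]; first by rewrite !expr0 mulr1 mul1r scale1r.
by rewrite (exprSr y) -(mulrA _ y x) E -scalerAr (mulrA _ x y) IH -scalerAl -(mulrA x) scalerA -exprS.
Qed.
End QCommute.

Section RankTwo.
Variables (k : fieldType) (l : nat) (q : k) (i0 : nat).
Hypothesis l_gt1 : (1 < l)%N.
Hypothesis l_odd : odd l.
Hypothesis q_prim : l.-primitive_root q.
Hypothesis i0E : i0 = (l.+1 %/ 2)%N.
Local Notation r := (root4 q i0).
Variable A : taft q l 2.
Local Notation H := (taft_hopf A).
Local Notation L := (taft_hopf_laws A).
Local Notation K0 := (tK A ord0).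
Local Notation K1 := (tK A ord_max).
Local Notation X0 := (tx A ord0).
Local Notation X1 := (tx A ord_max).
Local Notation a := ((l - 1)%N%:Z *: epsilon ord_max : lattice 2).
Local Notation chi := (calK A a : ldual H).
Local Notation g := (Kpow A (i0%:Z *: (epsilon ord0 + epsilon ord_max)) : H).
Local Notation bul := (bullet chi).
Local Notation l0 := (ltnW l_gt1).
Local Notation ql := (prim_expr_order q_prim).
Local Notation chiP := (calK_char A l0 ql a).
Local Notation B2 := (bool * bool)%type.

Lemma lstar2 (b c : lattice 2) : lstar b c = b 0 ord_max * c 0 ord0.
Proof.
rewrite /lstar !big_ord_recl big_ord0 !big_mkcond !big_ord_recl !big_ord0 /= !add0r !addr0.
rewrite [X in _ + X]big1 ?addr0 => [|i /= i1]; last by case: i i1 => -[|[|]].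
by congr (b 0 _ * c 0 _); apply: val_inj.
Qed.

Lemma theta01 : theta q (epsilon (ord0 : 'I_2)) (epsilon ord_max) = q^-1.
Proof. by rewrite /theta !lstar2 !mxE /= -exprN1. Qed.

Lemma theta10 : theta q (epsilon (ord_max : 'I_2)) (epsilon ord0) = q.
Proof. by rewrite /theta !lstar2 !mxE /= -[RHS]expr1z. Qed.

Lemma thetaii (i : 'I_2) : theta q (epsilon i) (epsilon i) = 1.
Proof. by rewrite /theta subrr expr0z. Qed.

Lemma K0X0 : K0 * X0 = q *: (X0 * K0).
Proof. by rewrite K_X thetaii mul1r eqxx expr1. Qed.
Lemma K0X1 : K0 * X1 = q^-1 *: (X1 * K0).
Proof. by rewrite K_X theta01 mulr1. Qed.
Lemma K1X0 : K1 * X0 = q *: (X0 * K1).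
Proof. by rewrite K_X theta10 mulr1. Qed.
Lemma K1X1 : K1 * X1 = q *: (X1 * K1).
Proof. by rewrite K_X thetaii mul1r eqxx expr1. Qed.
Lemma X1X0 : X1 * X0 = q *: (X0 * X1).
Proof. by rewrite (rel_xx (taft_rel A)) theta10. Qed.
Lemma K1K0 : K1 * K0 = K0 * K1. Proof. exact: (rel_KK (taft_rel A)). Qed.
Lemma K0V : K0 * K0^-1 = 1. Proof. exact: (rel_KV (taft_rel A)). Qed.
Lemma K1V : K1 * K1^-1 = 1. Proof. exact: (rel_KV (taft_rel A)). Qed.

Definition mono2 e d p s : A := X0 ^+ e * X1 ^+ d * (K0 ^+ p * K1 ^+ s).

Lemma X0mono e d p s : X0 * mono2 e d p s = mono2 e.+1 d p s.
Proof. by rewrite /mono2 !mulrA -exprS. Qed.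

Lemma X1mono e d p s : X1 * mono2 e d p s = q ^+ e *: mono2 e d.+1 p s.
Proof. by rewrite /mono2 !mulrA (qcomm_expr _ X1X0) -!scalerAl -[X in X * _ * _]mulrA -exprS. Qed.

Lemma Kmono_x c0 c1 x p s : K0 * x = c0 *: (x * K0) -> K1 * x = c1 *: (x * K1) ->
  K0 ^+ p * K1 ^+ s * x = (c0 ^+ p * c1 ^+ s) *: (x * (K0 ^+ p * K1 ^+ s)).
Proof.
move=> E0 E1; rewrite -mulrA (qcomm_expl _ E1) -scalerAr (mulrA _ x) (qcomm_expl _ E0) -scalerAl scalerA.
by rewrite (mulrA x) mulrC.
Qed.

Lemma monoX0 e d p s : mono2 e d p s * X0 = q ^+ (p + s + d) *: mono2 e.+1 d p s.
Proof.
rewrite /mono2 -mulrA (Kmono_x _ _ K0X0 K1X0) -scalerAr -(mulrA _ _ (X0 * _)) (mulrA (X1 ^+ d) X0).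
rewrite (qcomm_expl _ X1X0) -scalerAl -scalerAr scalerA !mulrA -exprSr.
by rewrite -!exprD addnC.
Qed.

Lemma monoX1 e d p s : mono2 e d p s * X1 = (q^-1 ^+ p * q ^+ s) *: mono2 e d.+1 p s.
Proof.
by rewrite /mono2 -mulrA (Kmono_x _ _ K0X1 K1X1) -scalerAr (mulrA _ X1) -(mulrA _ _ X1) -exprSr.
Qed.

Lemma monoV0 e d p s : mono2 e d p.+1 s * K0^-1 = mono2 e d p s.
Proof.
have K10 : K1 ^+ s * K0 = K0 * K1 ^+ s.
  by have := qcomm_expl s (c := 1) (y := K1) (x := K0); rewrite !scale1r expr1n scale1r; apply; exact: K1K0.
by rewrite /mono2 exprSr -[K0 ^+ p * _ * _]mulrA -K10 -!mulrA K0V mulr1.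
Qed.

Lemma monoV1 e d p s : mono2 e d p s.+1 * K1^-1 = mono2 e d p s.
Proof. by rewrite /mono2 exprSr -!mulrA K1V mulr1. Qed.

Lemma K0mono e d p s : K0 * mono2 e d p s * K0^-1 = (q ^+ e * q^-1 ^+ d) *: mono2 e d p s.
Proof.
rewrite -[in RHS](monoV0 e d p s) scalerAl; congr (_ * _).
rewrite /mono2 !mulrA (qcomm_expr _ K0X0) -!scalerAl -!scalerA; congr (_ *: _).
by rewrite -[_ * K0 * _]mulrA (qcomm_expr _ K0X1) -!scalerAr -!scalerAl !mulrA -[_ * K0 * K0 ^+ p]mulrA -exprS.
Qed.

Lemma K1mono e d p s : K1 * mono2 e d p s * K1^-1 = (q ^+ e * q ^+ d) *: mono2 e d p s.
Proof.
rewrite -[in RHS](monoV1 e d p s) scalerAl; congr (_ * _).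
have K10 : K1 * K0 ^+ p = K0 ^+ p * K1.
  by have := qcomm_expr p (c := 1) (y := K1) (x := K0); rewrite !scale1r expr1n scale1r; apply; exact: K1K0.
rewrite /mono2 !mulrA (qcomm_expr _ K1X0) -!scalerAl -!scalerA; congr (_ *: _).
rewrite -[_ * K1 * _]mulrA (qcomm_expr _ K1X1) -!scalerAr -!scalerAl !mulrA.
by rewrite -[_ * K1 * K0 ^+ p]mulrA K10 exprS !mulrA.
Qed.
Local Notation j0 := (i0 - 1)%N.
Definition expo (b : bool) : nat := if b then j0 else i0.
Arguments expo : simpl never.
(** The factor q on the vector labelled by (true, true) normalizes the basis so that the
    R-matrix becomes the product of two rank one tables times a power of r. *)
Definition f2 (b : B2) : H := (if b.1 && b.2 then q else 1) *: mono2 b.1 b.2 (expo b.1) (expo b.2).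

Arguments f2 : simpl never.
Lemma i0_j : i0 = j0.+1.
Proof. by rewrite subn1 prednK // ltnW // (i0_gt1 l_gt1 l_odd q_prim i0E). Qed.
Lemma expo_ltl b : (expo b < l)%N.
Proof.
have il := i0_lt l_gt1 l_odd q_prim i0E.
by rewrite /expo; case: b => //; apply: leq_ltn_trans il; rewrite leq_subr.
Qed.
Lemma b_ltl (b : bool) : (b < l)%N.
Proof. by apply: leq_ltn_trans l_gt1; case: b. Qed.

Definition m2 (b : B2) : exponents l 2 * exponents l 2 :=
  ([ffun i => Ordinal (b_ltl (if i == ord0 then b.1 else b.2))],
   [ffun i => Ordinal (expo_ltl (if i == ord0 then b.1 else b.2))]).

Lemma mono2E (b : B2) : mono2 b.1 b.2 (expo b.1) (expo b.2) = monomial (tK A) (tx A) (m2 b).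
Proof.
by rewrite /monomial !big_ord_recl !big_ord0 !ffunE /= !mulr1; congr (_ * tx A _ ^+ _ * (_ * tK A _ ^+ _)); apply: val_inj.
Qed.

Definition lam2 (b : B2) : ldual H := (if b.1 && b.2 then q^-1 else 1) *: mono_coord A (m2 b).

Lemma q0 : q != 0. Proof. exact: prim_root_neq0 l_gt1 q_prim. Qed.

Lemma lam2f b c : lam2 b (f2 c) = (b == c)%:R :> k.
Proof.
rewrite /lam2 /f2 mono2E scale_lfunE linearZ /= mono_coordE.
have -> : (m2 b == m2 c) = (b == c).
  apply/eqP/eqP => [E|-> //].
  have := congr1 (fun m : exponents l 2 * exponents l 2 => m.1 ord0 : nat) E.
  have := congr1 (fun m : exponents l 2 * exponents l 2 => m.1 ord_max : nat) E.
  by rewrite !ffunE /=; case: (b) => -[] []; case: (c) => -[] [].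
case: eqP => [->|_]; last by rewrite /GRing.scale /= !mulr0.
by rewrite /GRing.scale /= mulr1; case: ifP; rewrite ?mulr1 // mulVf ?q0.
Qed.

Lemma chiK0 : q ^ (a 0 ord0) = 1.
Proof. by rewrite !mxE /= mulr0 expr0z. Qed.
Lemma chiK1 : q ^ (a 0 ord_max) = q^-1.
Proof.
rewrite !mxE /= mulr1 -exprnP; apply: (mulIf q0).
by rewrite -exprSr subn1 prednK ?l0 // ql mulVf ?q0.
Qed.

Definition rsgn (b : bool) : k := if b then r else r^-1.
Lemma rn0 : r != 0. Proof. exact: root4_neq0 l_gt1 q_prim. Qed.
Lemma rsgn_wt (x y : bool) : r ^ (wt x * wt y) = rsgn (x == y).
Proof. by case: x; case: y; rewrite /rsgn /wt /= ?mulr1 ?mul1r ?mulrNN ?expr1z ?exprN1. Qed.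
Lemma qr : q = r ^+ 4. Proof. by rewrite (root4_pow4 l_odd q_prim i0E). Qed.

(** The weights of the two K i on the basis. *)
Definition w2 (i : 'I_2) (b : B2) : k :=
  rsgn b.1 ^+ 2 * (rsgn (if i == ord0 then ~~ b.2 else b.2)) ^+ 2.

Lemma ord2 (i : 'I_2) : i = ord0 \/ i = ord_max.
Proof. by case: i => -[|[|]] //= i2; [left | right]; apply: val_inj. Qed.

Lemma f2K i b : bul (tK A i : H) (f2 b) = w2 i b *: f2 b.
Proof.
have qE : q = r ^+ 4 := qr; have rn := rn0.
rewrite (bullet_K l0 ql) /f2 -scalerAr -scalerAl.
case: (ord2 i) => ->; rewrite ?chiK0 ?chiK1 ?K0mono ?K1mono !scalerA; congr (_ *: _);
  rewrite /w2 /= /rsgn; move: (r) rn qE => z zn ->; case: b => -[] [] /=; field => //.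
Qed.

(** The matrix entries of the X i: with the normalization of f2, the arrow of X ord0 from
    (false, false) is scaled by s2 and all others by t2. *)
Definition s2 : k := 1 - q.
Definition t2 : k := q^-1 * (1 - q).

Lemma bulX0 e d p s : bul (X0 : H) (mono2 e d p s) =
  (1 - q ^+ (p + s + d)) *: (mono2 e.+1 d p s * K0^-1).
Proof.
by rewrite (bullet_X l0 ql) chiK0 scale1r X0mono monoX0 -scalerAl scalerBl scale1r.
Qed.

Lemma bulX1 e d p s : bul (X1 : H) (mono2 e d p s) =
  (q^-1 * q ^+ e - q^-1 ^+ p * q ^+ s) *: (mono2 e d.+1 p s * K1^-1).
Proof.
by rewrite (bullet_X l0 ql) chiK1 X1mono monoX1 -!scalerAl scalerBl scalerA.
Qed.

Lemma expo_add (b : bool) : (expo b + b = i0)%N.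
Proof. by case: b; rewrite /expo /= ?addn0 // addn1 -i0_j. Qed.
Lemma expoF : expo false = (expo true).+1. Proof. exact: i0_j. Qed.

Lemma expo_V (b : bool) s : q^-1 ^+ expo b * q ^+ (s + i0) = q ^+ (s + b).
Proof.
rewrite -(expo_add b) addnA [(s + _)%N]addnC -addnA exprD mulrA -exprMn mulVf ?q0 //.
by rewrite expr1n mul1r.
Qed.

Lemma q2i0 : q ^+ (i0 + i0) = q.
Proof. by rewrite addnn -muln2 (i0_double l_odd i0E) exprS ql mulr1. Qed.

Lemma f2X0F (d : bool) : bul (X0 : H) (f2 (false, d)) = (if d then t2 else s2) *: f2 (true, d).
Proof.
rewrite /f2 /= scale1r bulX0 -addnA expo_add q2i0 -/s2 expoF monoV0.
case: d => /=; rewrite ?scale1r // scalerA; congr (_ *: _).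
by rewrite /s2 /t2; field; exact: q0.
Qed.

Lemma bulZ c (h m : H) : bul h (c *: m) = c *: bul h m.
Proof. by rewrite (@islinZ _ _ _ (fun z => bul h z)); last by lin. Qed.

Lemma f2X0T d : bul (X0 : H) (f2 (true, d)) = 0.
Proof.
rewrite /f2 bulZ /= bulX0 -addnA expo_add.
have -> : (expo true + i0 = l)%N by have := i0_double l_odd i0E; rewrite /expo; lia.
by rewrite ql subrr scale0r scaler0.
Qed.

Lemma f2X1F (e : bool) : bul (X1 : H) (f2 (e, false)) = t2 *: f2 (e, true).
Proof.
rewrite /f2 /= andbF scale1r bulX1 andbT (expo_V e 0 : _ * q ^+ expo false = _) expoF monoV1.
case: e => /=; rewrite ?scale1r ?scalerA; congr (_ *: _); rewrite /t2; field; exact: q0.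
Qed.

Lemma f2X1T e : bul (X1 : H) (f2 (e, true)) = 0.
Proof.
rewrite /f2 bulZ /= bulX1.
have -> : q^-1 ^+ expo e * q ^+ expo true = q^-1 * q ^+ e.
  apply: (mulIf q0); rewrite -mulrA -exprSr -i0_j (expo_V e 0 : _ * q ^+ i0 = _).
  by rewrite mulrAC mulVf ?q0 ?mul1r.
by rewrite subrr scale0r scaler0.
Qed.

Lemma q1n : 1 - q != 0.
Proof. by rewrite subr_eq0 eq_sym (prim_root_neq1 l_gt1 q_prim). Qed.
Lemma s2_neq0 : s2 != 0. Proof. exact: q1n. Qed.
Lemma t2_neq0 : t2 != 0. Proof. by rewrite mulf_neq0 ?q1n // invr_eq0 q0. Qed.

Lemma f2X i b : exists c b', bul (tx A i : H) (f2 b) = c *: f2 b'.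
Proof.
case: (ord2 i) b => -> [[] d].
- by exists 0, (true, d); rewrite f2X0T scale0r.
- by eexists; eexists; exact: f2X0F.
- case: d; last by eexists; eexists; exact: f2X1F.
  by exists 0, (true, true); rewrite f2X1T scale0r.
- case: d; last by eexists; eexists; exact: f2X1F.
  by exists 0, (true, true); rewrite f2X1T scale0r.
Qed.

Definition kk (b : B2) : H := K0 ^+ expo b.1 * K1 ^+ expo b.2.

Arguments kk : simpl never.

Lemma kkP b : grouplike (kk b).
Proof. by rewrite /kk -(falgE (A := A)); apply: (grouplikeM L); exact: grouplike_Kn. Qed.

Lemma g2E : g = kk (false, false).
Proof. by rewrite /Kpow !big_ord_recl big_ord0 !mxE /= !mulr1; congr (_ * tK A _ ^+ _); apply: val_inj. Qed.

Lemma g2P : grouplike g. Proof. by rewrite g2E; exact: kkP. Qed.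

Lemma f2_00 : f2 (false, false) = g.
Proof. by rewrite g2E /f2 /mono2 /= scale1r !mul1r. Qed.

Lemma f2W b : f2 b \in bullet_space chi g.
Proof.
have gW : f2 (false, false) \in bullet_space chi g.
  by rewrite f2_00 -[X in X \in _](bullet1 L chiP); exact: mem_bullet_space.
have step (h m : H) c m' : c != 0 -> bul h m = c *: m' -> m \in bullet_space chi g ->
    m' \in bullet_space chi g.
  move=> c0 E /bullet_spaceP [h' mE]; have -> : m' = c^-1 *: bul h m by rewrite E scalerA mulVf ?scale1r.
  by apply: memvZ; rewrite mE -(bulletM L chiP); exact: mem_bullet_space.
have W0 d : f2 (false, d) \in bullet_space chi g.
  by case: d => //; exact: step t2_neq0 (f2X1F false) gW.
by case: b => -[] d //; apply: step (f2X0F d) (W0 d); case: (d); [exact: t2_neq0 | exact: s2_neq0].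
Qed.

Lemma w2E b : w2 ord0 b = (if b.1 == b.2 then 1 else if b.1 then q else q^-1) /\
  w2 ord_max b = (if b.1 != b.2 then 1 else if b.1 then q else q^-1).
Proof.
have rn := rn0; have qE := qr.
rewrite /w2 /rsgn; move: (r) rn qE => z zn ->.
by case: b => -[] [] /=; split; field.
Qed.

Lemma w2N b c : b != c -> exists i, w2 i b != w2 i c.
Proof.
have q1 := prim_root_neq1 l_gt1 q_prim.
have qV1 : q^-1 != 1 by rewrite invr_eq1.
have qVq : q^-1 != q.
  apply/eqP => E; have := prim_root_sq_neq1 l_gt1 l_odd q_prim.
  by rewrite expr2 -{1}E mulVf ?q0 ?eqxx.
(* The weights of the first K separate (true, false) from (false, true), those of
   the second K separate all other pairs. *)
pose i : 'I_2 := if (b.1 == c.1) || (b.2 == c.2) || (b.1 == b.2) then ord_max else ord0.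
move=> bc; exists i; have [b0 b1] := w2E b; have [c0 c1] := w2E c.
case: b bc @i b0 b1 => -[] []; case: c c0 c1 => -[] [] //= c0 c1 _ b0 b1;
  rewrite ?b0 ?b1 ?c0 ?c1 // eq_sym //.
Qed.

Lemma sw2_kk (U : vectType k) b (F : H -> H -> U) : bilin F -> sw2 (kk b) F = F (kk b) (kk b).
Proof. by apply: sw2_grouplike; exact: kkP. Qed.

Lemma f2kk b : f2 b = (if b.1 && b.2 then q else 1) *: (X0 ^+ b.1 * X1 ^+ b.2 * kk b).
Proof. by []. Qed.

Lemma K0kk d : K0 * kk (true, d) = kk (false, d).
Proof. by rewrite /kk /= mulrA -exprS -expoF. Qed.

Lemma K1kk e : K1 * kk (e, true) = kk (e, false).
Proof.
have K10 p : K1 * K0 ^+ p = K0 ^+ p * K1.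
  by have := qcomm_expr p (c := 1) (y := K1) (x := K0); rewrite !scale1r expr1n scale1r; apply; exact: K1K0.
by rewrite /kk /= mulrA K10 -mulrA -exprS -expoF.
Qed.

Section Coproducts.
Variables (U : vectType k) (F : H -> H -> U).
Hypothesis Fl : bilin F.

Lemma sw2_f00 : sw2 (f2 (false, false)) F = F (f2 (false, false)) (kk (false, false)).
Proof. by rewrite f2_00 g2E sw2_kk. Qed.

Lemma sw2_f10 : sw2 (f2 (true, false)) F =
  F (f2 (true, false)) (kk (true, false)) + F (f2 (false, false)) ((X0 : H) ** kk (true, false)).
Proof.
rewrite !f2kk /= !scale1r !expr1 !mulr1 !mul1r sw2_Xmul // !sw2_kk; try by lin.
by rewrite !falgE K0kk.
Qed.

Lemma sw2_f01 : sw2 (f2 (false, true)) F =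
  F (f2 (false, true)) (kk (false, true)) + F (f2 (false, false)) ((X1 : H) ** kk (false, true)).
Proof.
rewrite !f2kk /= !scale1r !expr1 !mul1r sw2_Xmul // !sw2_kk; try by lin.
by rewrite !falgE K1kk.
Qed.

Lemma sw2_f11 : sw2 (f2 (true, true)) F =
  F (f2 (true, true)) (kk (true, true)) + q *: F (f2 (true, false)) ((X1 : H) ** kk (true, true)) +
  F (f2 (false, true)) ((X0 : H) ** kk (true, true)) +
  q *: F (f2 (false, false)) ((X0 : H) ** ((X1 : H) ** kk (true, true))).
Proof.
rewrite !f2kk /= !scale1r !expr1 !mulr1 !mul1r -mulrA sw2Z.
rewrite sw2_Xmul // sw2_Xmul; last by lin.
rewrite sw2_Xmul; last by lin.
rewrite !sw2_kk; try by lin.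
rewrite !falgE K1kk K0kk !scalerDr !addrA; congr (_ + _ + _ + _).
  by rewrite (@islinZ _ _ _ (fun z => F z _)); last by lin.
rewrite -[LHS](@islinZ _ _ _ (fun z => F z _)); last by lin.
by rewrite mulrA K0X1 -scalerAl scalerA mulfV ?q0 // scale1r -mulrA K0kk.
Qed.
End Coproducts.

(** The scalar by which kk e acts on the basis vector b. *)
Definition kap (e b : B2) : k :=
  rsgn (e.1 != b.1) * rsgn (e.1 == b.2) * (rsgn (e.2 != b.1) * rsgn (e.2 != b.2)).

(** The weights are squares of powers of r, and expo e is one half of 1 or of -1 modulo
    l. *)
Lemma rsgn_expo (x e : bool) : (rsgn x ^+ 2) ^+ expo e = rsgn (e != x).
Proof.
have rn := rn0; have E (y : bool) : (rsgn y ^+ 2) ^+ i0 = rsgn y.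
  by rewrite /rsgn; case: y; rewrite ?exprVn (root4_sq_i0 l_odd q_prim i0E).
case: e; last by rewrite -[expo false]/i0 E; case: x.
have sn : rsgn x ^+ 2 != 0 by rewrite expf_neq0 // /rsgn; case: (x); rewrite ?invr_eq0.
apply: (mulIf sn); rewrite -exprSr -expoF -[expo false]/i0 E /rsgn; case: (x) => //=; field => //.
Qed.

Lemma f2kk_act e b : bul (kk e) (f2 b) = kap e b *: f2 b.
Proof.
rewrite /kk -(falgE (A := A)) (bulletM L chiP).
rewrite (bullet_Kn l0 ql _ (f2K _ _)) bulZ (bullet_Kn l0 ql _ (f2K _ _)) scalerA mulrC.
congr (_ *: _); rewrite /w2 /= !(exprMn _ (_ ^+ 2) (_ ^+ 2)) !rsgn_expo /kap.
by case: e => -[] e2; case: b => b1 [].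
Qed.

Local Notation mu := (mcoef chi f2 lam2).
Local Notation u := (drinfeld_u (double_R H)).

(** Written with rsgn instead of integer exponents, so that entries can be compared by
    cases; T2E is the form that is used for diagrams. *)
Definition T2 (b b' e e' : B2) : k := T1 q i0 b.1 b'.1 e.1 e'.1 * T1 q i0 b.2 b'.2 e.2 e'.2 *
  (rsgn (e.1 == b.2) * rsgn (b'.1 != e'.2)).
(** The table inverse to T2. *)
Definition Q2 (b b' e e' : B2) : k := Q1 q i0 b.1 b'.1 e.1 e'.1 * Q1 q i0 b.2 b'.2 e.2 e'.2 *
  (rsgn (b.1 == e.2) * rsgn (e'.1 != b'.2)).

Lemma bul0 (h : H) : bul h 0 = 0.
Proof. by have := bulZ 0 h 0; rewrite !scale0r. Qed.
Lemma lam2Z c b m : lam2 b (c *: m) = c * (lam2 b m : k) :> k.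
Proof. by rewrite linearZ. Qed.
Lemma lam20 b : lam2 b (0 : H) = 0 :> k. Proof. by rewrite linear0. Qed.

Lemma Rcoef2_true b b' e e' : Rcoef (double_R H) mu true b b' e e' = T2 b b' e e'.
Proof.
have actE := (lam2f, f2X0F false, f2X0F true, f2X0T, f2X1F, f2X1T, bul0, lam20, lam2Z, bulZ).
rewrite (Rcoef_true l0 ql) /T2 /T1.
have qE := qr.
case: e' => -[] []; rewrite (sw2_f00, sw2_f10, sw2_f01, sw2_f11); try by lin.
all: rewrite ?(bulletM L chiP) !f2kk_act /GRing.scale /=.
all: case: b' => -[] []; rewrite !actE /kap /s2 /t2 /rsgn /=.
(* What is left are identities between rational functions of r, one for each choice
   of the labels. *)
all: move: (r) rn0 qE => z zn qE; rewrite ?qE {actE qE}; case: b => -[] []; case: e => -[] [];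
  rewrite /= ?(mulr0, mul0r, addr0, add0r, mulr1) //; by field.
Qed.

Lemma rsgnV (x : bool) : rsgn x * rsgn (~~ x) = 1.
Proof. by rewrite /rsgn; case: x; rewrite ?mulfV ?mulVf // rn0. Qed.

(** The second factor of the power of r in Q2 and the first one in T2 involve the same
    inner labels and cancel; the outer two cancel when the outer labels agree. *)
Lemma Q2T2 b b' e e' : tmul Q2 T2 b b' e e' = (b == b')%:R * (e == e')%:R.
Proof.
transitivity (rsgn (b.1 == e.2) * rsgn (b'.1 != e'.2) *
    (tmul (Q1 q i0) (T1 q i0) b.1 b'.1 e.1 e'.1 * tmul (Q1 q i0) (T1 q i0) b.2 b'.2 e.2 e'.2)).
  rewrite /tmul big_distrlr pair_bigA mulr_sumr.
  (* Regroup the inner labels by components instead of by strands. *)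
  pose h (p : B2 * B2) : B2 * B2 := ((p.1.1, p.2.1), (p.1.2, p.2.2)).
  rewrite [RHS](reindex h); last by exists h => -[[? ?] [? ?]].
  apply: eq_bigr => -[[x1 x2] [y1 y2]] _; rewrite /Q2 /T2 /=.
  have E := rsgnV (y1 == x2); rewrite -[RHS]mulr1 -E; ring.
rewrite !(Q1T1 i0 l_gt1 q_prim) -[b == b']/((b.1 == b'.1) && (b.2 == b'.2)).
rewrite -[e == e']/((e.1 == e'.1) && (e.2 == e'.2)).
case: (b.1 =P b'.1) => [->|]; last by rewrite !mul0r mulr0.
case: (e.2 =P e'.2) => [->|]; last by rewrite andbF !mulr0.
by rewrite rsgnV !mulr1 !mul1r andbT mulrC.
Qed.

Lemma Rcoef2_false b b' e e' : Rcoef (double_R H) mu false b b' e e' = Q2 b b' e e'.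
Proof.
apply: (tmul_unique (F := Rcoef (double_R H) mu true)) => [x x' y y'|x x' y y'].
  exact: (taft_Rcoef_inv l0 ql g2P f2K f2X lam2f f2_00 f2W).
by rewrite -Q2T2 /tmul; apply: eq_bigr => p _; rewrite Rcoef2_true.
Qed.

Lemma T2E b b' e e' : T2 b b' e e' = T1 q i0 b.1 b'.1 e.1 e'.1 * T1 q i0 b.2 b'.2 e.2 e'.2 *
  r ^ (wt e.1 * wt b.2 - wt b'.1 * wt e'.2).
Proof.
rewrite /T2 expfzDr ?rn0 // -invr_expz !rsgn_wt; congr (_ * (_ * _)).
by rewrite /rsgn; case: (_ == _); rewrite /= ?invrK.
Qed.

Lemma Q2E b b' e e' : Q2 b b' e e' = Q1 q i0 b.1 b'.1 e.1 e'.1 * Q1 q i0 b.2 b'.2 e.2 e'.2 *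
  r ^ (wt b.1 * wt e.2 - wt e'.1 * wt b'.2).
Proof.
rewrite /Q2 expfzDr ?rn0 // -invr_expz !rsgn_wt; congr (_ * (_ * _)).
by rewrite /rsgn; case: (_ == _); rewrite /= ?invrK.
Qed.

Definition U2 (b : B2) : k := U1 q i0 b.1 * U1 q i0 b.2.

Lemma mu_u2 b : mu u b b = U2 b.
Proof.
have stepX := u_step l0 ql g2P f2K f2X lam2f f2_00 f2W w2N.
have E : mu u (true, true) (true, true) = r ^+ 2.
  rewrite /mcoef (u_extremal (psi := calK A (epsilon ord_max))); last first.
    apply: (bullet_char l0 ql) => i.
      rewrite f2K; congr (_ *: _); have [a0 a1] := w2E (true, true).
      by case: (ord2 i) => ->; rewrite ?a0 ?a1 !mxE //= ?expr1z.
    by case: (ord2 i) => ->; rewrite ?f2X0T ?f2X1T.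
  have pP := calK_char A l0 ql (epsilon ord_max).
  have pX i : calK A (epsilon ord_max) (tx A i) = 0 by exact: (calK_X A l0 ql).
  rewrite sw2_f11; last by lin.
  rewrite !falgE !(char_antipV_X _ pP (pX _)) !scale0r !scaler0 !addr0 lam2Z lam2f eqxx mulr1.
  rewrite (char_antipV pP (kkP _)) /kk -(falgE (A := A)) (proj2 pP).
  rewrite !(is_char_exp _ _ pP) !(calK_K A l0 ql) !mxE /= expr0z expr1z expr1n mul1r.
  by rewrite (exp_i0_pred l_gt1 l_odd q_prim i0E) invrK.
have E10 : mu u (true, false) (true, false) = r ^+ 6.
  rewrite (stepX _ _ _ _ (f2X1F true) t2_neq0) E.
  by rewrite -[X in X * _](root4_pow4 l_odd q_prim i0E) -exprD.
have E01 : mu u (false, true) (false, true) = r ^+ 6.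
  rewrite (stepX _ _ _ _ (f2X0F true) t2_neq0) E.
  by rewrite -[X in X * _](root4_pow4 l_odd q_prim i0E) -exprD.
have E00 : mu u (false, false) (false, false) = r ^+ 10.
  rewrite (stepX _ _ _ _ (f2X0F false) s2_neq0) E10.
  by rewrite -[X in X * _](root4_pow4 l_odd q_prim i0E) -exprD.
by case: b => -[] []; rewrite ?E ?E10 ?E01 ?E00 /U2 /U1 /=; ring.
Qed.

Variables (v : drinfeld_double H) (c : k).
Hypothesis hv : ribbon_element (double_R H) v.
Hypothesis vc : acts_as (bullet_mod chi g : hmod (drinfeld_double H)) v c.

Lemma c2_square : c ^+ 2 = r ^+ 12.
Proof.
rewrite (c_square l0 ql g2P f2K f2X lam2f f2_00 f2W hv vc w2N) mu_u2.
have -> : chi g = r ^- 2 :> k.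
  rewrite g2E /kk -(falgE (A := A)) (proj2 chiP) !(is_char_exp _ _ chiP) !(calK_K A l0 ql).
  rewrite chiK0 chiK1 expr1n mul1r exprVn; congr (_^-1).
  exact: esym (root4_sq l_odd q_prim i0E).
by rewrite invrK /U2 /U1 /= -!exprD.
Qed.

Lemma c2_root : c ^+ l = 1.
Proof.
apply: (c_root l0 ql g2P f2_00 f2W hv vc).
have E : GRing.comm (K0 ^+ i0) (K1 ^+ i0) by apply: commrX; apply: commr_sym; apply: commrX; exact: K1K0.
by rewrite g2E /kk (exprMn_comm _ E) !(exprAC _ i0) !(rel_Kl (taft_rel A)) !expr1n mulr1.
Qed.

Lemma U2_neq0 b : U2 b != 0.
Proof. by rewrite mulf_neq0 // (U1_neq0 i0 l_gt1 q_prim). Qed.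

Definition R2 (pos : bool) := if pos then T2 else Q2.

Lemma Inv2 Di cs : link_diagram Di -> based_components Di cs ->
  Inv (double_R H) v (taft_mod A a (i0%:Z *: (epsilon ord0 + epsilon ord_max))) Di cs =
  sumlab (fun _ => (false, false)) (flatten cs) (fun s =>
    (\prod_(d <- cs) gcyc (pivot U2 c) Di s d) * lab_weight Di R2 s).
Proof.
move=> LD BC.
rewrite /taft_mod (taft_Inv l0 ql g2P f2K f2X lam2f f2_00 f2W w2N U2_neq0 mu_u2 hv vc LD BC).
apply: eq_sumlab => s; congr (_ * _).
by apply: lab_weight_eq => -[] b b' e e'; rewrite ?Rcoef2_true ?Rcoef2_false.
Qed.
End RankTwo.

(** * The comparison theorem *)

(** Since l is odd, an lth root of unity is a power of its own square. *)
Lemma odd_root_square (k : fieldType) l (x y : k) : odd l ->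
  x ^+ l = 1 -> y ^+ l = 1 -> x ^+ 2 = y ^+ 2 -> x = y.
Proof.
move=> lo xl yl E.
have sq (z : k) : z ^+ l = 1 -> z = (z ^+ 2) ^+ (l.+1 %/ 2).
  by move=> zl; rewrite -exprM mulnC (i0_double lo erefl) exprS zl mulr1.
by rewrite (sq x xl) (sq y yl) E.
Qed.

Theorem theorem5p12
  (k : closedFieldType) (char_k : [pchar k] =i pred0)
  (l : nat) (l_gt1 : (1 < l)%N) (l_odd : odd l)
  (q : k) (q_prim : l.-primitive_root q)
  (i0 : nat) (i0E : i0 = (l.+1 %/ 2)%N)
  (A2 : taft q l 2) (A1 : taft q l 1)
  (v2 : drinfeld_double (taft_hopf A2)) (v1 : drinfeld_double (taft_hopf A1))
  (hv2 : ribbon_element (double_R (taft_hopf A2)) v2)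
  (hv1 : ribbon_element (double_R (taft_hopf A1)) v1) :
  let M2 := taft_mod A2 ((l - 1)%N%:Z *: epsilon ord_max)
                        (i0%:Z *: (epsilon ord0 + epsilon ord_max)) in
  let M1 := taft_mod A1 ((i0 - 1)%N%:Z *: epsilon ord0) (i0%:Z *: epsilon ord0) in
  forall (c2 c1 : k),
  acts_as M2 v2 c2 -> acts_as M1 v1 c1 ->
  forall (L : diagram) (cs : seq (seq point)),
  link_diagram L -> based_components L cs ->
  Invbar (double_R (taft_hopf A2)) v2 M2 c2 L cs
  = (Invbar (double_R (taft_hopf A1)) v1 M1 c1 L cs) ^+ 2.
Proof.
move=> M2 M1 c2 c1 vc2 vc1 L cs Llink Lcs.
have rn := root4_neq0 i0 l_gt1 q_prim.
have cE : c2 = c1 ^+ 2.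
  apply: (odd_root_square l_odd).
  - exact: (c2_root l_gt1 l_odd q_prim i0E hv2 vc2).
  - by rewrite exprAC (c1_root l_gt1 l_odd q_prim i0E hv1 vc1) expr1n.
  - rewrite (c2_square l_gt1 l_odd q_prim i0E hv2 vc2) (c1_square l_gt1 l_odd q_prim i0E hv1 vc1).
    by rewrite -exprM.
have pivE (b : bool * bool) :
    pivot (U2 q i0) (c1 ^+ 2) b = pivot (U1 q i0) c1 b.1 * pivot (U1 q i0) c1 b.2.
  by rewrite /pivot /U2 invfM expr2 mulrACA.
have consE pos b b' e e' : R1 q i0 pos b b' e e' != 0 -> wt b + wt e = wt b' + wt e'.
  by case: pos; [exact: T1_cons | exact: Q1_cons].
rewrite /Invbar (Inv2 l_gt1 l_odd q_prim i0E hv2 vc2 Llink Lcs).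
rewrite (Inv1 l_gt1 l_odd q_prim i0E hv1 vc1 Llink Lcs) cE.
rewrite (labels_square cs Llink rn pivE consE (T2E i0 l_gt1 q_prim) (Q2E i0 l_gt1 q_prim)).
by rewrite !expr2 mulrACA expfzMl.
Qed.
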